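(* Let $\Omega\subset\mathbb R^2$ be a polygonal domain, $\triangle$ a regular triangulation of $\Omega$, and $d\ge 1$ an integer. Let $V_h^0=\ker C_0\subset S^{-1}_{d+1}(\triangle)$, $V^1_{h,\mathrm{curl}}=\ker C_1^{\mathrm{curl}}\subset [S^{-1}_d(\triangle)]^2$, $V^1_{h,\mathrm{div}}=\ker C_1^{\mathrm{div}}\subset[S^{-1}_d(\triangle)]^2$ and $V_h^2=S^{-1}_{d-1}(\triangle)$. Then $$V_h^0=S^0_{d+1}(\triangle)=\{u\in H^1(\Omega): u|_T\in\mathcal P_{d+1}(T)\ \forall T\in\triangle\},$$ $$V^1_{h,\mathrm{curl}}=\{v\in H(\mathrm{curl};\Omega): v|_T\in[\mathcal P_d(T)]^2\ \forall T\in\triangle\},$$ $$V^1_{h,\mathrm{div}}=\{v\in H(\mathrm{div};\Omega): v|_T\in[\mathcal P_d(T)]^2\ \forall T\in\triangle\},$$ $$V_h^2=\{q\in L^2(\Omega): q|_T\in\mathcal P_{d-1}(T)\ \forall T\in\triangle\}.$$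
   Context: Triangulation: $\triangle$ is a finite set of nondegenerate closed triangles whose union is $\overline\Omega$, with $\Omega$ the (connected) interior of that union; any two distinct triangles meet in the empty set, a common vertex, or a common edge. An interior edge is an edge shared by two triangles $T^+,T^-$. $\mathcal P_d(T)$ is the space of polynomials of total degree at most $d$ on $T$. $S^{-1}_d(\triangle)$ is the space of piecewise polynomials of degree at most $d$ on $\triangle$ with no continuity across edges (so an element is a family $(s|_T)_{T}$ with $s|_T\in\mathcal P_d(T)$), and $S^r_d(\triangle)=\{s\in C^r(\Omega): s|_T\in\mathcal P_d(T)\ \forall T\}$ for $r\ge 0$. On $T=\langle v_1,v_2,v_3\rangle$ with barycentric coordinates $\lambda_1,\lambda_2,\lambda_3$ the Bernstein polynomials are $B^d_{ijk}=\frac{d!}{i!j!k!}\lambda_1^i\lambda_2^j\lambda_3^k$, $i+j+k=d$; the B-coefficients of $p\in\mathcal P_d(T)$ are its coordinates in this basis. Elements of $S^{-1}_d(\triangle)$ are identified with the concatenation of their B-coefficient vectors over all triangles, and elements of $[S^{-1}_d(\triangle)]^2$ with two such vectors (one per Cartesian component). Each interior edge $e$ has a fixed orientation with unit tangent $t_e$ pointing from its first endpoint $a$ to its second endpoint $b$, and unit normal $n_e=Rt_e$, $R(a_1,a_2)=(-a_2,a_1)$. The coefficient vector on $e$ of a polynomial $p$ of degree at most $d$ is the vector $(r_0,\dots,r_d)$ with $p(a+t(b-a))=\sum_j r_j\binom dj t^j(1-t)^{d-j}$; it consists of the B-coefficients of $p$ at the $d+1$ domain points on $e$. For $u\in S^{-1}_{d+1}(\triangle)$,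 $C_{0,e}u$ is the coefficient vector on $e$ of $u|_{T^+}$ minus that of $u|_{T^-}$. For $v\in[S^{-1}_d(\triangle)]^2$, $C^{\mathrm{curl}}_{1,e}v$ is the coefficient vector on $e$ of $v|_{T^+}\cdot t_e$ minus that of $v|_{T^-}\cdot t_e$, and $C^{\mathrm{div}}_{1,e}v$ is the analogous difference with $n_e$ in place of $t_e$. $C_0$, $C_1^{\mathrm{curl}}$, $C_1^{\mathrm{div}}$ are obtained by stacking these blocks over all interior edges (no boundary conditions). Here $\mathrm{curl}\,v=\partial_xv^y-\partial_yv^x$. *)

(* Defs.v *)
From mathcomp Require Import all_boot all_order all_algebra.
From mathcomp Require Import all_classical all_reals all_analysis.
From mathcomp Require Import zify ring lra.

Set Implicit Arguments.
Unset Strict Implicit.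
Unset Printing Implicit Defensive.

Import Order.TTheory GRing.Theory Num.Theory.
Import numFieldNormedType.Exports.

Local Open Scope classical_set_scope.
Local Open Scope ring_scope.

Notation plane R := (R * R)%type.

(* [measurableTypeR R] is [R] with its Borel sets, as used by the library to
   state the Lebesgue measure. *)
Definition leb2 {R : realType} :
    {measure set (measurableTypeR R * measurableTypeR R) -> \bar R} :=
  (@lebesgue_measure R \x @lebesgue_measure R)%E.

(* Twice the signed area of the triangle pqr. *)
Definition area2 (R : realType) (p q r : plane R) : R :=
  (q.1 - p.1) * (r.2 - p.2) - (q.2 - p.2) * (r.1 - p.1).

Definition nondegenerate (R : realType) (v : 'I_3 -> plane R) : Prop :=
  area2 (v 0) (v 1) (v 2) != 0.

Definition triangle (R : realType) (v : 'I_3 -> plane R) : set (plane R) :=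
  [set x | exists l : 'I_3 -> R,
     [/\ forall k, 0 <= l k, \sum_k l k = 1,
         x.1 = \sum_k l k * (v k).1 & x.2 = \sum_k l k * (v k).2]].

Definition line_point (R : realType) (a b : plane R) (t : R) : plane R :=
  (a.1 + t * (b.1 - a.1), a.2 + t * (b.2 - a.2)).

Definition edge_segment (R : realType) (a b : plane R) : set (plane R) :=
  line_point a b @` `[0, 1].

Definition vertices (R : realType) (v : 'I_3 -> plane R) : set (plane R) :=
  range v.

Definition common_edge (R : realType) (v w : 'I_3 -> plane R) (a b : plane R) :
    Prop :=
  [/\ a != b, vertices v a /\ vertices v b & vertices w a /\ vertices w b].

Definition meet_properly (R : realType) (v w : 'I_3 -> plane R) : Prop :=
  [\/ triangle v `&` triangle w = set0,
      exists2 a, vertices v a /\ vertices w a &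
        triangle v `&` triangle w = [set a]
    | exists a b, common_edge v w a b /\
        triangle v `&` triangle w = edge_segment a b].

Definition triangulation (R : realType) (Omega : set (plane R)) (N : nat)
    (tri : 'I_N -> 'I_3 -> plane R) : Prop :=
  [/\ forall T, nondegenerate (tri T),
      forall T T', T != T' -> meet_properly (tri T) (tri T'),
      closure Omega = \bigcup_T triangle (tri T)
    & Omega = interior (\bigcup_T triangle (tri T))].

Definition domain (R : realType) (Omega : set (plane R)) : Prop :=
  [/\ Omega !=set0, open Omega & connected Omega].

(* An edge shared by T^+ and T^-, oriented from [org] to [dst]. *)
Record edge (R : realType) (N : nat) := Edge {
  plus : 'I_N;
  minus : 'I_N;
  org : plane R;
  dst : plane R }.

Definition interior_edge (R : realType) (N : nat)
    (tri : 'I_N -> 'I_3 -> plane R) (e : edge R N) : Prop :=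
  plus e != minus e /\
  common_edge (tri (plus e)) (tri (minus e)) (org e) (dst e).

(* [E] lists every interior edge exactly once, each one with an arbitrary but
   fixed orientation and an arbitrary but fixed naming of its two triangles. *)
Definition interior_edges (R : realType) (N M : nat)
    (tri : 'I_N -> 'I_3 -> plane R) (E : 'I_M -> edge R N) : Prop :=
  (forall i, interior_edge tri (E i)) /\
  forall e, interior_edge tri e ->
    exists! i, [set org (E i); dst (E i)] = [set org e; dst e].

Definition tangent (R : realType) (N : nat) (e : edge R N) : plane R :=
  let w := (dst e).1 - (org e).1 in
  let h := (dst e).2 - (org e).2 in
  (w / Num.sqrt (w ^+ 2 + h ^+ 2), h / Num.sqrt (w ^+ 2 + h ^+ 2)).

Definition normal (R : realType) (N : nat) (e : edge R N) : plane R :=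
  (- (tangent e).2, (tangent e).1).

Definition Pd (R : realType) (d : nat) : set (plane R -> R) :=
  [set p : plane R -> R | exists c : nat -> nat -> R, forall x,
     p x = \sum_(i < d.+1) \sum_(j < d.+1 | (i + j <= d)%N)
             c i j * x.1 ^+ i * x.2 ^+ j].

(* The indices k + 1 and k + 2 are taken in 'I_3 = Z/3. *)
Definition bary (R : realType) (v : 'I_3 -> plane R) (k : 'I_3)
    (x : plane R) : R :=
  area2 x (v (k + 1)) (v (k + 2)) / area2 (v k) (v (k + 1)) (v (k + 2)).

(* These are indeed the barycentric coordinates. *)
Lemma bary_sum (R : realType) (v : 'I_3 -> plane R) (x : plane R) :
  nondegenerate v ->
  [/\ \sum_k bary v k x = 1, \sum_k bary v k x * (v k).1 = x.1
    & \sum_k bary v k x * (v k).2 = x.2].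
Proof.
rewrite /nondegenerate /bary !big_ord_recl !big_ord0 !addr0.
have -> : lift ord0 ord0 = 1 :> 'I_3 by exact: val_inj.
have -> : lift ord0 (lift ord0 ord0) = 2 :> 'I_3 by exact: val_inj.
have -> : ord0 = 0 :> 'I_3 by exact: val_inj.
have -> : 0 + 1 = 1 :> 'I_3 by exact: val_inj.
have -> : 0 + 2 = 2 :> 'I_3 by exact: val_inj.
have -> : 1 + 1 = 2 :> 'I_3 by exact: val_inj.
have -> : 1 + 2 = 0 :> 'I_3 by exact: val_inj.
have -> : 2 + 1 = 0 :> 'I_3 by exact: val_inj.
have -> : 2 + 2 = 1 :> 'I_3 by exact: val_inj.
rewrite -!(mulrAC _ _ (_ ^-1)).
move: (v 0) (v 1) (v 2) => p q r D0.
have -> : area2 q r p = area2 p q r by rewrite /area2; ring.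
have -> : area2 r p q = area2 p q r by rewrite /area2; ring.
by split; apply: (mulIf D0); rewrite !mulrDl ?mul1r !divfK //;
  rewrite /area2; ring.
Qed.

Definition bindex (d : nat) : finType :=
  {alpha : {ffun 'I_3 -> 'I_d.+1} | (\sum_k alpha k == d)%N}.

Definition bernstein (R : realType) (d : nat) (v : 'I_3 -> plane R)
    (alpha : bindex d) (x : plane R) : R :=
  d`!%:R / (\prod_k (val alpha k)`!)%:R * \prod_k bary v k x ^+ val alpha k.

(* S^{-1}_d: an element is the concatenation of its B-coefficient vectors. *)
Definition Sm1 (R : realType) (N d : nat) := {ffun 'I_N * bindex d -> R}.

Definition piece (R : realType) (N d : nat) (tri : 'I_N -> 'I_3 -> plane R)
    (s : Sm1 R N d) (T : 'I_N) (x : plane R) : R :=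
  \sum_(alpha : bindex d) s (T, alpha) * bernstein (tri T) alpha x.

Definition S0 (R : realType) (Omega : set (plane R)) (N d : nat)
    (tri : 'I_N -> 'I_3 -> plane R) : set (plane R -> R) :=
  [set u : plane R -> R | {within Omega, continuous u} /\
     forall T, exists2 p, Pd d p &
       forall x, (triangle (tri T) `&` Omega) x -> u x = p x].

Definition edge_form (R : realType) (d : nat) (r : 'rV[R]_d.+1) (t : R) : R :=
  \sum_(j < d.+1) r 0 j * 'C(d, j)%:R * t ^+ j * (1 - t) ^+ (d - j).

Definition edge_coefs (R : realType) (a b : plane R) (d : nat)
    (p : plane R -> R) : 'rV[R]_d.+1 :=
  xget 0 [set r | forall t, p (line_point a b t) = edge_form r t].

(* The coefficient vector of a polynomial of degree at most d on a line exists
   and is unique, so that [edge_coefs] never returns its default value on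
   piecewise polynomials of degree at most d. *)
Lemma edge_form_inj (R : realType) (d : nat) (r r' : 'rV[R]_d.+1) :
  edge_form r =1 edge_form r' -> r = r'.
Proof.
move=> rr'.
pose q j : R := (r 0 (inord j) - r' 0 (inord j)) * 'C(d, j)%:R.
have Q0 (n : nat) : (\poly_(j < d.+1) q j).[n%:R] = 0.
  have n1 : n.+1%:R != 0 :> R by rewrite pnatr_eq0.
  have /eqP := rr' (n%:R / n.+1%:R).
  rewrite -subr_eq0 -sumrB => /eqP E.
  have := congr1 ( *%R (n.+1%:R ^+ d)) E; rewrite mulr0 => <-.
  rewrite horner_poly mulr_sumr; apply: eq_bigr => j _; rewrite /q inord_val.
  have -> : 1 - n%:R / n.+1%:R = n.+1%:R^-1 :> R.
    by rewrite -[X in X - _](divff n1) -mulrBl -natrB // subSnn mul1r.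
  have jd : (j <= d)%N by rewrite -ltnS.
  have -> : n.+1%:R ^+ d = n.+1%:R ^+ j * n.+1%:R ^+ (d - j) :> R.
    by rewrite -exprD subnKC.
  rewrite expr_div_n exprVn; field.
  by rewrite !expf_neq0.
have {}Q0 : \poly_(j < d.+1) q j = 0.
  apply/eqP; apply/negPn/negP => /max_poly_roots H.
  set Q := \poly_(j < d.+1) q j in Q0 H.
  suff : (size Q < size Q)%N by rewrite ltnn.
  rewrite -{1}(size_iota 0 (size Q)) -(size_map (fun n => n%:R : R)); apply: H.
    by apply/allP => _ /mapP[n _ ->]; apply/eqP.
  by rewrite map_inj_uniq ?iota_uniq //; move=> x y /eqP; rewrite eqr_nat => /eqP.
apply/rowP => j; have := congr1 (fun p : {poly R} => p`_j) Q0.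
rewrite coef_poly ltn_ord coef0 /q inord_val => /eqP.
by rewrite mulf_eq0 pnatr_eq0 -leqn0 leqNgt bin_gt0 -ltnS ltn_ord orbF
           subr_eq0 => /eqP.
Qed.

Lemma edge_form_exists (R : realType) (d : nat) (P : {poly R}) :
  (size P <= d.+1)%N -> exists r : 'rV_d.+1, forall t, P.[t] = edge_form r t.
Proof.
move=> sP.
exists (\row_j \sum_(m < d.+1)
  (if (m <= j)%N then P`_m * 'C(d - m, j - m)%:R / 'C(d, j)%:R else 0)) => t.
rewrite (horner_coef_wide _ sP) /edge_form.
under [RHS]eq_bigr => j _ do rewrite mxE !mulr_suml.
rewrite exchange_big; apply: eq_bigr => m _.
have md : (m <= d)%N by rewrite -ltnS.
have {1}-> : t ^+ m = t ^+ m * ((1 - t) + t) ^+ (d - m).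
  by rewrite subrK expr1n mulr1.
rewrite exprDn !mulr_sumr -(big_mkord xpredT (fun i =>
  P`_m * (t ^+ m * ((1 - t) ^+ (d - m - i) * t ^+ i *+ 'C(d - m, i))))).
rewrite -(big_mkord xpredT (fun j => (if (m <= j)%N then
  P`_m * 'C(d - m, j - m)%:R / 'C(d, j)%:R else 0)
  * 'C(d, j)%:R * t ^+ j * (1 - t) ^+ (d - j))).
rewrite [RHS](@big_cat_nat _ _ _ m) //=; last by rewrite ltnW.
rewrite [X in _ = X + _]big_nat_cond [X in _ = X + _]big1; last first.
  by move=> j; rewrite andbT => /andP[_ jm]; rewrite ifF ?mul0r // leqNgt jm.
rewrite add0r.
rewrite -{1}[X in index_iota X d.+1](add0n m) big_addn subSn //.
rewrite [LHS]big_nat_cond [RHS]big_nat_cond.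
apply: eq_bigr => i; rewrite andbT ltnS => /andP[_ im].
have C0 : 'C(d, i + m)%:R != 0 :> R.
  by rewrite pnatr_eq0 -lt0n bin_gt0; lia.
rewrite leq_addl addnK divfK // exprD subnDA subnAC -mulr_natr.
by ring.
Qed.

Lemma edge_coefsP (R : realType) (a b : plane R) (d : nat) (p : plane R -> R)
    (P : {poly R}) (r : 'rV[R]_d.+1) :
  (size P <= d.+1)%N -> (forall t, p (line_point a b t) = P.[t]) ->
  edge_coefs a b d p = r <-> forall t, p (line_point a b t) = edge_form r t.
Proof.
move=> sP pP.
have H : forall t, p (line_point a b t) = edge_form (edge_coefs a b d p) t.
  have [r0 r0P] := edge_form_exists sP.
  rewrite /edge_coefs; case: xgetP => [r1 _ //|/(_ r0)[]].
  by move=> t /=; rewrite pP r0P.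
split => [<- //|rP]; apply: edge_form_inj => t.
by rewrite -H rP.
Qed.

Lemma piece_line (R : realType) (N d : nat) (tri : 'I_N -> 'I_3 -> plane R)
    (s : Sm1 R N d) (T : 'I_N) (a b : plane R) :
  exists2 P : {poly R}, (size P <= d.+1)%N &
    forall t, piece tri s T (line_point a b t) = P.[t].
Proof.
have baryP k : exists2 L : {poly R}, (size L <= 2)%N &
    forall t, bary (tri T) k (line_point a b t) = L.[t].
  exists ((bary (tri T) k b - bary (tri T) k a) *: 'X + (bary (tri T) k a)%:P).
    rewrite (leq_trans (size_polyD _ _)) // geq_max.
    rewrite (leq_trans (size_scale_leq _ _)) ?size_polyX //.
    by rewrite (leq_trans (size_polyC_leq1 _)).
  by move=> t; rewrite !hornerE /bary /area2 /=; ring.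
have [L sL LE] : exists2 L : 'I_3 -> {poly R}, forall k, (size (L k) <= 2)%N &
    forall k t, bary (tri T) k (line_point a b t) = (L k).[t].
  have /choice[L HL] : forall k, exists Lk : {poly R}, (size Lk <= 2)%N /\
    forall t, bary (tri T) k (line_point a b t) = Lk.[t].
    by move=> k; have [Lk ? ?] := baryP k; exists Lk.
  by exists L => k; have [] := HL k.
pose B (alpha : bindex d) :=
  (d`!%:R / (\prod_k (val alpha k)`!)%:R) *: \prod_k L k ^+ val alpha k.
exists (\sum_(alpha : bindex d) s (T, alpha) *: B alpha).
  rewrite (leq_trans (size_sum _ _ _)) //; apply/bigmax_leqP => alpha _.
  rewrite (leq_trans (size_scale_leq _ _)) // (leq_trans (size_scale_leq _ _)) //.
  rewrite (leq_trans (size_poly_prod_leq _ _)) // card_ord.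
  have S : (\sum_k size (L k ^+ val alpha k)
            <= \sum_(k < 3) (val alpha k + 1))%N.
    apply: leq_sum => k _; rewrite (leq_trans (size_poly_exp_leq _ _)) //.
    by have := sL k; nia.
  rewrite big_split sum1_card card_ord (eqP (valP alpha)) in S.
  by rewrite leq_subLR (leq_ltn_trans S) //= addnC addSnnS addnS -addSnnS.
move=> t; rewrite horner_sum; apply: eq_bigr => alpha _.
rewrite hornerZ hornerZ horner_prod /bernstein; congr (_ * (_ * _)).
by apply: eq_bigr => k _; rewrite LE horner_exp.
Qed.

Definition edge_jump (R : realType) (N : nat) (e : edge R N) (d : nat)
    (f : 'I_N -> plane R -> R) : 'rV[R]_d.+1 :=
  edge_coefs (org e) (dst e) d (f (plus e))
  - edge_coefs (org e) (dst e) d (f (minus e)).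

Definition C0 (R : realType) (N M d : nat) (tri : 'I_N -> 'I_3 -> plane R)
    (E : 'I_M -> edge R N) (u : Sm1 R N d) : 'M[R]_(M, d.+1) :=
  \matrix_(i < M) edge_jump (E i) d (piece tri u).

Definition piece_dot (R : realType) (N d : nat) (tri : 'I_N -> 'I_3 -> plane R)
    (v : Sm1 R N d * Sm1 R N d) (n : plane R) (T : 'I_N) (x : plane R) : R :=
  piece tri v.1 T x * n.1 + piece tri v.2 T x * n.2.

Definition C1curl (R : realType) (N M d : nat)
    (tri : 'I_N -> 'I_3 -> plane R) (E : 'I_M -> edge R N)
    (v : Sm1 R N d * Sm1 R N d) : 'M[R]_(M, d.+1) :=
  \matrix_(i < M) edge_jump (E i) d (piece_dot tri v (tangent (E i))).

Definition C1div (R : realType) (N M d : nat)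
    (tri : 'I_N -> 'I_3 -> plane R) (E : 'I_M -> edge R N)
    (v : Sm1 R N d * Sm1 R N d) : 'M[R]_(M, d.+1) :=
  \matrix_(i < M) edge_jump (E i) d (piece_dot tri v (normal (E i))).

Definition V0 (R : realType) (N M d : nat) (tri : 'I_N -> 'I_3 -> plane R)
    (E : 'I_M -> edge R N) : set (Sm1 R N d.+1) :=
  [set u | C0 tri E u = 0].

Definition V1curl (R : realType) (N M d : nat)
    (tri : 'I_N -> 'I_3 -> plane R) (E : 'I_M -> edge R N) :
    set (Sm1 R N d * Sm1 R N d) :=
  [set v | C1curl tri E v = 0].

Definition V1div (R : realType) (N M d : nat)
    (tri : 'I_N -> 'I_3 -> plane R) (E : 'I_M -> edge R N) :
    set (Sm1 R N d * Sm1 R N d) :=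
  [set v | C1div tri E v = 0].

Definition V2 (R : realType) (N d : nat) : set (Sm1 R N d.-1) := setT.

Arguments V0 {R N M} d tri E.
Arguments V1curl {R N M} d tri E.
Arguments V1div {R N M} d tri E.
Arguments V2 R N d : clear implicits.

(* Functions on Omega are represented by functions on the whole plane whose
   values outside Omega are never used. Classes of functions modulo equality
   almost everywhere are represented by the sets of all their measurable
   representatives, measurability being with respect to the Borel sets. *)

Definition dx (R : realType) (phi : plane R -> R) : plane R -> R :=
  fun x => derive1 (fun t => phi (t, x.2)) x.1.

Definition dy (R : realType) (phi : plane R -> R) : plane R -> R :=
  fun x => derive1 (fun t => phi (x.1, t)) x.2.

Fixpoint Ck (R : realType) (k : nat) (phi : plane R -> R) : Prop :=
  continuous phi /\
  if k is k'.+1 then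
    [/\ forall x, derivable (fun t => phi (t, x.2)) x.1 1,
        forall x, derivable (fun t => phi (x.1, t)) x.2 1,
        Ck k' (dx phi) & Ck k' (dy phi)]
  else True.

Definition test_fun (R : realType) (Omega : set (plane R)) :
    set (plane R -> R) :=
  [set phi : plane R -> R | [/\ forall k, Ck k phi,
     compact (closure [set x | phi x != 0]) &
     closure [set x | phi x != 0] `<=` Omega]].

Definition L2 (R : realType) (Omega : set (plane R)) : set (plane R -> R) :=
  [set u : plane R -> R | u \_ Omega \in Lfun (@leb2 R) 2%:E].

Definition integral_on (R : realType) (Omega : set (plane R))
    (f : plane R -> R) : R :=
  \int[@leb2 R]_(x in Omega) f x.

Definition weak_dx (R : realType) (Omega : set (plane R))
    (u g : plane R -> R) : Prop :=
  forall phi, test_fun Omega phi ->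
    integral_on Omega (fun x => g x * phi x)
    = - integral_on Omega (fun x => u x * dx phi x).

Definition weak_dy (R : realType) (Omega : set (plane R))
    (u g : plane R -> R) : Prop :=
  forall phi, test_fun Omega phi ->
    integral_on Omega (fun x => g x * phi x)
    = - integral_on Omega (fun x => u x * dy phi x).

Definition weak_curl (R : realType) (Omega : set (plane R))
    (v : plane R -> plane R) (g : plane R -> R) : Prop :=
  forall phi, test_fun Omega phi ->
    integral_on Omega (fun x => g x * phi x)
    = - integral_on Omega (fun x => (v x).2 * dx phi x - (v x).1 * dy phi x).

Definition weak_div (R : realType) (Omega : set (plane R))
    (v : plane R -> plane R) (g : plane R -> R) : Prop :=
  forall phi, test_fun Omega phi ->
    integral_on Omega (fun x => g x * phi x)
    = - integral_on Omega (fun x => (v x).1 * dx phi x + (v x).2 * dy phi x).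

Definition H1 (R : realType) (Omega : set (plane R)) : set (plane R -> R) :=
  [set u : plane R -> R | [/\ L2 Omega u,
     exists2 g, L2 Omega g & weak_dx Omega u g &
     exists2 g, L2 Omega g & weak_dy Omega u g]].

Definition L2vec (R : realType) (Omega : set (plane R)) :
    set (plane R -> plane R) :=
  [set v : plane R -> plane R | L2 Omega (fst \o v) /\ L2 Omega (snd \o v)].

Definition Hcurl (R : realType) (Omega : set (plane R)) :
    set (plane R -> plane R) :=
  [set v : plane R -> plane R | L2vec Omega v /\ exists2 g, L2 Omega g & weak_curl Omega v g].

Definition Hdiv (R : realType) (Omega : set (plane R)) :
    set (plane R -> plane R) :=
  [set v : plane R -> plane R | L2vec Omega v /\ exists2 g, L2 Omega g & weak_div Omega v g].

(* u|_T \in P_d(T) for all T, for u defined up to null sets. *)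
Definition piecewise_P (R : realType) (N d : nat)
    (tri : 'I_N -> 'I_3 -> plane R) : set (plane R -> R) :=
  [set u : plane R -> R | forall T, exists2 p, Pd d p &
     u = p %[ae (@leb2 R) in triangle (tri T)]].

Definition piecewise_P2 (R : realType) (N d : nat)
    (tri : 'I_N -> 'I_3 -> plane R) : set (plane R -> plane R) :=
  [set v : plane R -> plane R | piecewise_P d tri (fst \o v) /\ piecewise_P d tri (snd \o v)].

(* The functions on Omega, modulo equality almost everywhere, given by a set of
   pointwise defined functions, of piecewise polynomials, and of pairs of
   piecewise polynomials respectively. *)
Definition fun_class (R : realType) (Omega : set (plane R))
    (A : set (plane R -> R)) : set (plane R -> R) :=
  [set u : plane R -> R | measurable_fun Omega u /\
     exists2 w, A w & u = w %[ae (@leb2 R) in Omega]].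

Definition spline_class (R : realType) (Omega : set (plane R)) (N d : nat)
    (tri : 'I_N -> 'I_3 -> plane R) (V : set (Sm1 R N d)) :
    set (plane R -> R) :=
  [set u : plane R -> R | measurable_fun Omega u /\
     exists2 s, V s & forall T,
       u = piece tri s T %[ae (@leb2 R) in triangle (tri T)]].

Definition spline2_class (R : realType) (Omega : set (plane R)) (N d : nat)
    (tri : 'I_N -> 'I_3 -> plane R) (V : set (Sm1 R N d * Sm1 R N d)) :
    set (plane R -> plane R) :=
  [set v : plane R -> plane R | measurable_fun Omega v /\
     exists2 s, V s & forall T,
       v = (fun x => (piece tri s.1 T x, piece tri s.2 T x))
         %[ae (@leb2 R) in triangle (tri T)]].

(* Main.v *)
Require Import Defs.
From mathcomp Require Import all_boot all_order all_algebra.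
From mathcomp Require Import all_classical all_reals all_analysis.
From mathcomp Require Import unstable measurable_realfun.
From mathcomp Require Import zify ring lra.

(** The core is a statement about a piecewise polynomial field [w]: it has a
    square integrable weak divergence if and only if its normal traces agree
    across the interior edges. Integrating by parts on each triangle gives, for
    a test function [phi],
      [int_Omega w . grad phi = (edge terms) - int_Omega (div_h w) phi],
    and the two edge terms of an edge shared by two triangles combine into the
    integral of the normal jump against [phi]. When the jumps vanish these terms
    cancel in pairs, an unshared edge contributing nothing because it does not
    meet [Omega]. Conversely, testing with functions that concentrate on one
    edge makes the bulk integrals tend to [0] while the edge term stays
    constant, so that the jump is [0]. The spaces [H1] and [H(curl)] follow from
    the fields [(u, 0)], [(0, u)] and [(v2, -v1)].

    For [S0] the edge conditions must also give the agreement of all pieces at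
    an interior vertex [x]: the value at [x] of a piece containing [y] is locally
    constant in [y != x] near [x], hence constant along segments avoiding [x]. *)

Set Implicit Arguments.
Unset Strict Implicit.
Unset Printing Implicit Defensive.

Import Order.TTheory GRing.Theory Num.Theory.
Import numFieldNormedType.Exports.
(* [all_algebra] also has a [nondegenerate]; the one of [Defs] is meant. *)
Import Defs.

Local Open Scope classical_set_scope.
Local Open Scope ring_scope.

(** * Measurability and integrability in the plane *)

(** Three facts are derived rather than assumed. An edge belongs to at most two triangles: in
    barycentric terms, triangles sharing an edge have their opposite vertices on opposite sides of
    it, and a line has only two sides. An open edge meeting [Omega] does have a second triangle, and
    a shared open edge lies in [Omega]. The orientation of the triangles is not fixed, so the sign
    of the area enters Green's formula and decides how two fluxes combine.

    Edge statements concern the open edge only. Vertices, where many triangles can meet, are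
    invisible to edge integrals and to the comparison of polynomials; they matter only for [S0].

    On a triangle, Green's formula is read off horizontal slices, and exchanging the coordinates
    gives the other partial derivative. *)

Lemma pair_continuous {T U V : topologicalType} (f : T -> U) (g : T -> V) :
  continuous f -> continuous g -> continuous (fun x => (f x, g x)).
Proof.
move=> cf cg x.
exact: (@cvg_pair _ _ _ (nbhs x) (nbhs (f x)) (nbhs (g x)) _ _ _ f g (cf x) (cg x)).
Qed.

(** Measurability refers to the product of the two Borel structures. The rational boxes contained in
    [A] are countably many and cover it. *)
Lemma open_measurable_plane {R : realType} (A : set (plane R)) : open A ->
  @measurable _ (measurableTypeR R * measurableTypeR R)%type A.
Proof.
move=> oA.
pose F (q : (rat * rat) * (rat * rat)) : set (measurableTypeR R * measurableTypeR R) :=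
  `]ratr q.1.1, ratr q.1.2[%classic `*` `]ratr q.2.1, ratr q.2.2[%classic.
have -> : A = \bigcup_(q in [set q | F q `<=` A]) F q.
  apply/seteqP; split => [x Ax|x [q qA /qA//]].
  have [e e0 xeA] : exists2 e : R, 0 < e & ball x e `<=` A.
    by apply/nbhs_ballP; move: oA; rewrite openE; apply.
  have H (t : R) : exists q : rat * rat, (t \in `]ratr q.1, ratr q.2[) /\
      forall s, (s \in `]ratr q.1, ratr q.2[) -> ball t e s.
    have [a] := @rat_in_itvoo R (t - e) t ltac:(lra).
    have [b] := @rat_in_itvoo R t (t + e) ltac:(lra).
    rewrite !in_itv/= => /andP[? ?] /andP[? ?]; exists (a, b) => /=.
    split; first by apply/andP.
    move=> s /=; rewrite !in_itv/= /ball/= => /andP[? ?].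
    by rewrite ltr_distlC; apply/andP; split; lra.
  have [q1 [q11 q12]] := H x.1; have [q2 [q21 q22]] := H x.2.
  exists (q1, q2) => /=; last by split.
  by move=> y [/= /q12 y1 /q22 y2]; apply: xeA; split.
rewrite bigcup_mkcond; apply: countable_bigcupT_measurable; first exact: countableP.
move=> q; case: ifPn => _ //.
by apply: measurableX; exact: measurable_itv.
Qed.

Section plane_measure.
Context {R : realType}.
Notation M2 := (measurableTypeR R * measurableTypeR R)%type.
Notation mu2 := (@leb2 R).

Lemma closed_measurable_plane (A : set (plane R)) : closed A -> @measurable _ M2 A.
Proof.
by move/closed_openC/open_measurable_plane/measurableC; rewrite setCK.
Qed.

Lemma continuous_measurable_plane (f : plane R -> R) : continuous f ->
  @measurable_fun _ _ M2 R setT f.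
Proof.
move=> cf; apply: (measurability _ (RGenOpens.measurableE R)).
move=> _ [_ [a [b ->] <-]]; rewrite setTI; apply: open_measurable_plane.
by move/continuousP : cf; apply; exact: interval_open.
Qed.

(** Boundedness is expressed throughout by inclusion in such a box, which is compact and of finite
    measure. *)
Definition box (r : R) : set (plane R) := `[- r, r]%classic `*` `[- r, r]%classic.

Lemma leb2_box (r : R) : (mu2 (box r) < +oo)%E.
Proof.
have fin : (lebesgue_measure [set` `[(- r)%R, r]] < +oo)%E.
  by rewrite lebesgue_measure_itv/=; case: ifP => //= _; rewrite -EFinD ltry.
have -> : mu2 (box r) = (lebesgue_measure [set` `[(- r)%R, r]] *
    lebesgue_measure [set` `[(- r)%R, r]])%E.
  by apply: product_measure1E; exact: measurable_itv.
by rewrite lte_mul_pinfty // ge0_fin_numE.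
Qed.

Lemma continuous_bounded_box (r : R) (f : plane R -> R) : continuous f ->
  [bounded f x | x in box r].
Proof.
move=> cf; set B := box r.
have cB : compact B.
  by apply: compact_setX; exact: segment_compact.
have : compact (f @` B).
  exact: (continuous_compact (continuous_subspaceT cf) cB).
move/compact_bounded => [M [Mr H]]; exists M; split => // N MN x Bx; apply: (H N MN).
by exists x.
Qed.

Lemma integrable_bounded_plane (r : R) (D : set (plane R)) (f : plane R -> R) :
  @measurable _ M2 D -> D `<=` box r ->
  continuous f -> mu2.-integrable D (EFin \o f).
Proof.
move=> mD Dr cf; apply: measurable_bounded_integrable => //.
- apply: le_lt_trans (leb2_box r); apply: le_measure; rewrite ?inE //.
  by apply: measurableX; exact: measurable_itv.
- by apply: measurable_funS (continuous_measurable_plane cf).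
- have [M [Mr H]] := continuous_bounded_box r cf; exists M; split => // N MN x Dx.
  by apply: (H N MN); exact: Dr.
Qed.

End plane_measure.

(** * Triangles and barycentric coordinates *)

Section triangle.
Context {R : realType}.
Implicit Types (p q r x a b : plane R) (v : 'I_3 -> plane R).

Lemma ord3P (k : 'I_3) : [\/ k = 0, k = 1 | k = 2].
Proof.
case: k => [[|[|[|//]]] i]; [apply: Or31|apply: Or32|apply: Or33]; exact: val_inj.
Qed.

Lemma sum3 (V : nmodType) (F : 'I_3 -> V) : \sum_k F k = F 0 + F 1 + F 2.
Proof.
rewrite !big_ord_recl big_ord0 addr0 addrA.
by congr (F _ + F _ + F _); exact: val_inj.
Qed.

Lemma ord3_add : ((1 + 1 = 2 :> 'I_3)%R * (1 + 2 = 0 :> 'I_3)%R *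
  (2 + 1 = 0 :> 'I_3)%R * (2 + 2 = 1 :> 'I_3)%R)%type.
Proof. by do !split; exact: val_inj. Qed.

(* The triangle as an intersection of half-planes; the factor [area2 p q r]
   makes the description insensitive to the orientation of [p, q, r]. *)
Definition halfplanes p q r : set (plane R) :=
  [set x | [/\ 0 <= area2 p q r * area2 x q r, 0 <= area2 p q r * area2 x r p
             & 0 <= area2 p q r * area2 x p q]].

Lemma area2_rot p q r : area2 q r p = area2 p q r.
Proof. by rewrite /area2; ring. Qed.

Lemma area2_swap p q r : area2 q p r = - area2 p q r.
Proof. by rewrite /area2; ring. Qed.

Lemma halfplanes_rot p q r : halfplanes q r p = halfplanes p q r.
Proof.
by apply/seteqP; split => x [h1 h2 h3]; split; move: h1 h2 h3; rewrite (area2_rot p q r).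
Qed.

Lemma halfplanes_swap p q r : halfplanes q p r = halfplanes p q r.
Proof.
have H a b : halfplanes a b r `<=` halfplanes b a r.
  move=> x [h1 h2 h3].
  rewrite /halfplanes /= (area2_swap a b).
  have e (u w : plane R) : area2 x w u = - area2 x u w.
    by rewrite /area2; ring.
  by split; rewrite e mulrNN.
by apply/seteqP; split; exact: H.
Qed.

Lemma bary_uniq v (l : 'I_3 -> R) x : nondegenerate v -> \sum_k l k = 1 ->
  x.1 = \sum_k l k * (v k).1 -> x.2 = \sum_k l k * (v k).2 ->
  forall k, bary v k x = l k.
Proof.
rewrite /nondegenerate !sum3 => D0 l1 x1 x2 k.
have l2 : l 2 = 1 - l 0 - l 1 by rewrite -l1; ring.
rewrite /bary.
have [R1 R2] := (area2_rot (v 0) (v 1) (v 2), area2_rot (v 1) (v 2) (v 0)).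
by case: (ord3P k) => ->; rewrite ?add0r ?ord3_add ?R2 ?R1;
  apply: (mulIf D0); rewrite divfK // /area2 x1 x2 l2; ring.
Qed.

Lemma triangleP v x : nondegenerate v ->
  triangle v x <-> forall k, 0 <= bary v k x.
Proof.
move=> D0; split => [[l [l0 l1 x1 x2]] k|b0].
  by rewrite (bary_uniq D0 l1 x1 x2).
have [? ? ?] := bary_sum x D0.
by exists (fun k => bary v k x); split.
Qed.

Lemma triangle_halfplanes v : nondegenerate v -> triangle v = halfplanes (v 0) (v 1) (v 2).
Proof.
move=> D0.
have e p q r x : area2 p q r != 0 ->
    (0 <= area2 x q r / area2 p q r) = (0 <= area2 p q r * area2 x q r).
  move=> D; have -> : area2 p q r * area2 x q r
      = (area2 p q r) ^+ 2 * (area2 x q r / area2 p q r) by field.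
  by rewrite [RHS]pmulr_rge0 // lt0r sqrf_eq0 D sqr_ge0.
have D1 : area2 (v 1) (v 2) (v 0) != 0 by rewrite area2_rot.
have D2 : area2 (v 2) (v 0) (v 1) != 0 by rewrite -area2_rot.
have [R1 R2] := (area2_rot (v 0) (v 1) (v 2), area2_rot (v 1) (v 2) (v 0)).
apply/seteqP; split => x.
  move/(triangleP _ D0) => H; have := (H 0, H 1, H 2).
  by rewrite /bary ?add0r ?ord3_add !e // R2 R1 => -[[]].
move=> [h0 h1 h2]; apply/(triangleP _ D0) => k; rewrite /bary.
by case: (ord3P k) => ->; rewrite ?add0r ?ord3_add e // ?R2 ?R1.
Qed.

Lemma bary_continuous v k : continuous (bary v k).
Proof.
move=> x; rewrite /bary /area2.
apply: cvgM; last exact: cvg_cst.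
have c1 (y : plane R) : (z.1 - y.1 @[z --> x] --> x.1 - y.1)%R.
  by apply: cvgB; [exact: cvg_fst|exact: cvg_cst].
have c2 (y : plane R) : (z.2 - y.2 @[z --> x] --> x.2 - y.2)%R.
  by apply: cvgB; [exact: cvg_snd|exact: cvg_cst].
have d1 (y : plane R) : (y.1 - z.1 @[z --> x] --> y.1 - x.1)%R.
  by apply: cvgB; [exact: cvg_cst|exact: cvg_fst].
have d2 (y : plane R) : (y.2 - z.2 @[z --> x] --> y.2 - x.2)%R.
  by apply: cvgB; [exact: cvg_cst|exact: cvg_snd].
by apply: cvgB; apply: cvgM.
Qed.

Lemma triangle_closed v : nondegenerate v -> closed (triangle v).
Proof.
move=> D0.
have -> : triangle v = \bigcap_k (bary v k @^-1` [set t | 0 <= t]).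
  apply/seteqP; split => x; first by move/(triangleP _ D0) => H k _; exact: H.
  by move=> H; apply/(triangleP _ D0) => k; exact: H.
apply: closed_bigI => k _; apply: preimage_closed; last exact: closed_ge.
by apply: in1W; exact: bary_continuous.
Qed.

Lemma triangle_box v : triangle v `<=` box (\sum_k (`|(v k).1| + `|(v k).2|)).
Proof.
move=> x [l [l0 l1 x1 x2]].
have ll k : l k <= 1.
  by rewrite -l1 (bigD1 k) //= lerDl sumr_ge0.
have H (y : R) (w : 'I_3 -> R) : y = \sum_k l k * w k -> (forall k, `|w k| <= `|(v k).1| + `|(v k).2|) ->
    y \in `[- (\sum_k (`|(v k).1| + `|(v k).2|)), \sum_k (`|(v k).1| + `|(v k).2|)].
  move=> -> wk; rewrite in_itv/= -ler_norml (le_trans (ler_norm_sum _ _ _)) // ler_sum // => k _.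
  rewrite normrM ger0_norm // (le_trans _ (wk k)) // ler_piMl //.
split => /=; apply: H; first exact: x1.
- by move=> k; rewrite lerDl.
- exact: x2.
- by move=> k; rewrite lerDr.
Qed.

End triangle.

(** * The divergence theorem on a triangle *)

Section edge_integral.
Context {R : realType}.
Notation mu := (@lebesgue_measure R).
Implicit Types (p q r a b : plane R) (f : plane R -> R).

(* Line integral in the parameter of [line_point], that is, divided by the
   length of the edge. *)
Definition eint a b f : R := \int[mu]_(t in `[0, 1]) f (line_point a b t).

Lemma line_point_continuous a b : continuous (line_point a b).
Proof.
by apply: pair_continuous => t; apply: cvgD; try exact: cvg_cst;
  apply: cvgM; [exact: cvg_id|exact: cvg_cst|exact: cvg_id|exact: cvg_cst].
Qed.

Lemma continuous_itv_integrable (g : R -> R) (x y : R) : continuous g ->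
  mu.-integrable `[x, y] (EFin \o g).
Proof.
move=> cg; apply: continuous_compact_integrable; first exact: segment_compact.
exact: continuous_subspaceT.
Qed.

Lemma eint_swap a b f : continuous f -> eint b a f = eint a b f.
Proof.
move=> cf.
have c1 : continuous (f \o line_point b a).
  by move=> t; apply: continuous_comp; [exact: line_point_continuous|exact: cf].
rewrite /eint (@Rintegration_by_substitution_onem _ (f \o line_point b a)) ?lexx ?ler01 //; last first.
  exact: continuous_subspaceT.
rewrite onem1; apply: eq_Rintegral => t _; rewrite /onem /line_point /=; congr (f (_, _)); ring.
Qed.

(* Abscissa of the point of ordinate [y] on the line [ab], meaningful only when
   the line is not horizontal. *)
Definition edge_abs a b (y : R) : R := a.1 + (y - a.2) / (b.2 - a.2) * (b.1 - a.1).

Lemma edge_abs_continuous a b : continuous (edge_abs a b).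
Proof.
move=> t; apply: cvgD; first exact: cvg_cst.
by apply: cvgM; [apply: cvgM; [apply: cvgB; [exact: cvg_id|]|]|]; exact: cvg_cst.
Qed.

Lemma edge_abs_comp_continuous a b f : continuous f ->
  continuous (fun y => f (edge_abs a b y, y)).
Proof.
move=> cf t; apply: (continuous_comp (f := fun y => (edge_abs a b y, y)) (g := f)); last exact: cf.
by apply: pair_continuous; [exact: edge_abs_continuous|move=> ?; exact: cvg_id].
Qed.

(** This is the substitution of the ordinate for the parameter. The factor stays on the left so that
    a horizontal edge, where the substitution degenerates, is covered with both sides equal to 0. *)
Lemma eint_ordinate a b f : continuous f -> a.2 <= b.2 ->
  (b.2 - a.2) * eint a b f = \int[mu]_(y in `[a.2, b.2]) f (edge_abs a b y, y).
Proof.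
move=> cf; rewrite le_eqVlt => /predU1P[->|ab].
  by rewrite subrr mul0r set_itv1 Rintegral_set1.
pose F (t : R) := a.2 + t * (b.2 - a.2).
have dF (t : R) : is_derive t (1 : R) F (b.2 - a.2).
  apply: is_derive_eq; rewrite ?scale1r ?scaler0 ?add0r ?addr0.
  by rewrite /GRing.scale /=; ring.
have F'E : derive1 F = cst (b.2 - a.2).
  by apply/funext => t; rewrite derive1E; exact: derive_val.
have c1 : continuous (f \o line_point a b).
  by move=> t; apply: continuous_comp; [exact: line_point_continuous|exact: cf].
have cF : continuous F by move=> t; exact/differentiable_continuous/derivable1_diffP.
have -> : (b.2 - a.2) * eint a b f =
    \int[mu]_(t in `[0, 1]) ((b.2 - a.2) * f (line_point a b t)).
  by rewrite RintegralZl //; exact: (@continuous_itv_integrable (f \o line_point a b) 0 1 c1).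
have [F0 F1] : F 0 = a.2 /\ F 1 = b.2 by rewrite /F; split; ring.
rewrite /Rintegral; congr fine.
have := @integration_by_substitution_increasing R F
  (fun y => f (edge_abs a b y, y)) 0 1.
rewrite F0 F1 => -> //.
- apply: eq_integral => t _; congr EFin; rewrite F'E /= mulrC /=.
  congr (f _ * _); rewrite /line_point /edge_abs /F; congr (_, _).
  by field; rewrite subr_eq0 gt_eqF.
- by move=> x y _ _ xy; rewrite /F ltrD2l ltr_pM2r // subr_gt0.
- by rewrite F'E => x _; exact: cst_continuous.
- by rewrite F'E; exact: is_cvg_cst.
- by rewrite F'E; exact: is_cvg_cst.
- split; first by move=> x _.
    by apply: cvg_at_right_filter; exact: cF.
  by apply: cvg_at_left_filter; exact: cF.
- by apply: continuous_subspaceT; exact: edge_abs_comp_continuous.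
Qed.

Lemma slice_FTC f (x1 x2 y : R) : x1 <= x2 ->
  (forall x, derivable (fun t => f (t, x.2)) x.1 1) -> continuous (dx f) ->
  \int[mu]_(x in `[x1, x2]) dx f (x, y) = f (x2, y) - f (x1, y).
Proof.
rewrite le_eqVlt => /predU1P[->|x12] df cf.
  by rewrite subrr set_itv1 Rintegral_set1.
pose g t := f (t, y).
have dg t : derivable g t 1 by exact: (df (t, y)).
have cg : continuous g by move=> t; exact/differentiable_continuous/derivable1_diffP.
have cdg : {within `[x1, x2], continuous (fun x => dx f (x, y))}.
  apply: continuous_subspaceT => t.
  apply: (continuous_comp (f := fun t => (t, y)) (g := dx f)); last exact: cf.
  by apply: pair_continuous => ?; [exact: cvg_id|exact: cvg_cst].
have Dg : derivable_oo_LRcontinuous g x1 x2.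
  split; first by move=> x _.
    by apply: cvg_at_right_filter; exact: cg.
  by apply: cvg_at_left_filter; exact: cg.
by rewrite /Rintegral (continuous_FTC2 x12 cdg Dg (fun _ _ => erefl)).
Qed.

End edge_integral.

(** * Horizontal slices of a triangle *)

Section green.
Context {R : realType}.
Notation mu := (@lebesgue_measure R).
Notation M2 := (measurableTypeR R * measurableTypeR R)%type.
Notation mu2 := (@leb2 R).
Implicit Types (p q r a b : plane R) (f : plane R -> R).

(** The sign of [D] decides which of [u] and [w] is the left end of the slice, and [Num.sg D] merges
    the two cases. The factors [k1] and [k2] are the height differences that relate a half-plane
    condition to a difference of abscissas. *)
Lemma slice_integral f (S : set R) (D k1 k2 u w y : R) : D != 0 ->
  0 < k1 -> 0 < k2 -> 0 <= D * (w - u) ->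
  (forall x, S x <-> 0 <= D * (k1 * (x - u)) /\ 0 <= D * (k2 * (w - x))) ->
  (forall x, derivable (fun t => f (t, x.2)) x.1 1) -> continuous (dx f) ->
  \int[mu]_(x in S) dx f (x, y) = Num.sg D * (f (w, y) - f (u, y)).
Proof.
move=> D0 k10 k20 uw SP df cf.
have [Dn|Dp|D00] := ltgtP D 0; last by rewrite D00 eqxx in D0.
  have -> : S = `[w, u]%classic.
    apply/seteqP; split => x; rewrite /= in_itv/=.
      move/SP => []; rewrite !nmulr_rge0 // !pmulr_rle0 // subr_le0 subr_le0.
      by move=> -> ->.
    move=> /andP[wx xu]; apply/SP.
    by rewrite !nmulr_rge0 // !pmulr_rle0 // !subr_le0.
  rewrite slice_FTC // ?ltr0_sg //; last by rewrite -subr_le0 -(nmulr_rge0 _ Dn).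
  by rewrite mulN1r opprB.
have -> : S = `[u, w]%classic.
  apply/seteqP; split => x; rewrite /= in_itv/=.
    move/SP => []; rewrite !pmulr_rge0 // !subr_ge0.
    by move=> -> ->.
  move=> /andP[wx xu]; apply/SP.
  by rewrite !pmulr_rge0 // !subr_ge0.
rewrite slice_FTC // ?gtr0_sg //; last by rewrite -subr_ge0 -(pmulr_rge0 _ Dp).
by rewrite mul1r.
Qed.

Lemma area2_edge_abs a b x y : a.2 != b.2 ->
  area2 (x, y) a b = (b.2 - a.2) * (edge_abs a b y - x).
Proof.
move=> ab; rewrite /area2 /edge_abs /=; field.
by rewrite subr_eq0 eq_sym.
Qed.

Lemma area2_bary p q r x :
  area2 x q r * p.2 + area2 x r p * q.2 + area2 x p q * r.2 = area2 p q r * x.2.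
Proof. by rewrite /area2; ring. Qed.

Lemma area2_sum p q r x : area2 x q r + area2 x r p + area2 x p q = area2 p q r.
Proof. by rewrite /area2; ring. Qed.

(** The ordinate of a point is a convex combination of those of the vertices. Multiplying by the
    squared area avoids a division by a quantity of unknown sign. *)
Lemma halfplanes_ordinate p q r x : area2 p q r != 0 -> p.2 <= q.2 -> q.2 <= r.2 ->
  halfplanes p q r x -> p.2 <= x.2 <= r.2.
Proof.
move=> D0 pq qr [hA hB hC].
have D2 : 0 < area2 p q r ^+ 2 by rewrite lt0r sqrf_eq0 D0 sqr_ge0.
have eB := area2_bary p q r x; have eS := area2_sum p q r x.
apply/andP; split; rewrite -subr_ge0 -(pmulr_rge0 _ D2).
  have -> : area2 p q r ^+ 2 * (x.2 - p.2) =
      (area2 p q r * area2 x r p) * (q.2 - p.2) + (area2 p q r * area2 x p q) * (r.2 - p.2).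
    by rewrite mulrBr expr2 -!mulrA -eB -{2}eS; ring.
  by rewrite addr_ge0 // mulr_ge0 // subr_ge0 // (le_trans pq).
have -> : area2 p q r ^+ 2 * (r.2 - x.2) =
      (area2 p q r * area2 x q r) * (r.2 - p.2) + (area2 p q r * area2 x r p) * (r.2 - q.2).
  by rewrite mulrBr expr2 -!mulrA -eB -{1}eS; ring.
by rewrite addr_ge0 // mulr_ge0 // subr_ge0 // (le_trans pq).
Qed.

(** Below the middle vertex [q], the half-plane condition of the edge [qr] follows from the other
    two, so that the slice ends on [pq] and [pr]. *)
Lemma halfplanes_slice_low p q r f y : area2 p q r != 0 -> p.2 < y < q.2 -> q.2 <= r.2 ->
  (forall x, derivable (fun t => f (t, x.2)) x.1 1) -> continuous (dx f) ->
  \int[mu]_(x in [set x | halfplanes p q r (x, y)]) dx f (x, y) =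
    Num.sg (area2 p q r) * (f (edge_abs p q y, y) - f (edge_abs p r y, y)).
Proof.
move=> D0 /andP[py yq] qr df cf.
have pq : p.2 < q.2 by exact: lt_trans yq.
have pr : p.2 < r.2 by exact: lt_le_trans qr.
apply: (@slice_integral f _ _ (r.2 - p.2) (q.2 - p.2)) => //; rewrite ?subr_gt0 //.
  have -> : edge_abs p q y - edge_abs p r y =
      area2 p q r * ((y - p.2) / ((q.2 - p.2) * (r.2 - p.2))).
    rewrite /edge_abs /area2; field.
    by rewrite !subr_eq0 !gt_eqF.
  by rewrite mulrA -expr2 mulr_ge0 ?sqr_ge0 // divr_ge0 ?mulr_ge0 ?subr_ge0 ?ltW.
move=> x; rewrite /halfplanes /=.
have eC : area2 (x, y) p q = (q.2 - p.2) * (edge_abs p q y - x).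
  by rewrite area2_edge_abs // lt_eqF.
have eB : area2 (x, y) r p = (r.2 - p.2) * (x - edge_abs p r y).
  have -> : area2 (x, y) r p = - area2 (x, y) p r by rewrite /area2; ring.
  by rewrite area2_edge_abs ?lt_eqF //; ring.
rewrite -eC -eB; split => [[]//|[hB hC]]; split => //.
have e := area2_bary p q r (x, y); have e' := area2_sum p q r (x, y).
have yp : 0 < y - p.2 by rewrite subr_gt0.
rewrite -(pmulr_lge0 _ yp).
have -> : area2 p q r * area2 (x, y) q r * (y - p.2) =
  (area2 p q r * area2 (x, y) r p) * (q.2 - y) + (area2 p q r * area2 (x, y) p q) * (r.2 - y).
  by rewrite -!mulrA -mulrDr; congr (_ * _); rewrite -e' /= in e; lra.
by rewrite addr_ge0 // mulr_ge0 // subr_ge0 ltW // (lt_le_trans yq).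
Qed.

Lemma halfplanes_slice_high p q r f y : area2 p q r != 0 -> p.2 <= q.2 -> q.2 < y < r.2 ->
  (forall x, derivable (fun t => f (t, x.2)) x.1 1) -> continuous (dx f) ->
  \int[mu]_(x in [set x | halfplanes p q r (x, y)]) dx f (x, y) =
    Num.sg (area2 p q r) * (f (edge_abs q r y, y) - f (edge_abs p r y, y)).
Proof.
move=> D0 pq /andP[qy yr] df cf.
have qr : q.2 < r.2 by exact: lt_trans yr.
have pr : p.2 < r.2 by exact: le_lt_trans qr.
apply: (@slice_integral f _ _ (r.2 - p.2) (r.2 - q.2)) => //; rewrite ?subr_gt0 //.
  have -> : edge_abs q r y - edge_abs p r y =
      area2 p q r * ((r.2 - y) / ((r.2 - q.2) * (r.2 - p.2))).
    rewrite /edge_abs /area2; field.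
    by rewrite !subr_eq0 !gt_eqF.
  by rewrite mulrA -expr2 mulr_ge0 ?sqr_ge0 // divr_ge0 ?mulr_ge0 ?subr_ge0 ?ltW.
move=> x; rewrite /halfplanes /=.
have eC : area2 (x, y) q r = (r.2 - q.2) * (edge_abs q r y - x).
  by rewrite area2_edge_abs // lt_eqF.
have eB : area2 (x, y) r p = (r.2 - p.2) * (x - edge_abs p r y).
  have -> : area2 (x, y) r p = - area2 (x, y) p r by rewrite /area2; ring.
  by rewrite area2_edge_abs ?lt_eqF //; ring.
rewrite -eC -eB; split => [[]//|[hB hC]]; split => //.
have e := area2_bary p q r (x, y); have e' := area2_sum p q r (x, y).
have yp : 0 < r.2 - y by rewrite subr_gt0.
rewrite -(pmulr_lge0 _ yp).
have -> : area2 p q r * area2 (x, y) p q * (r.2 - y) =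
  (area2 p q r * area2 (x, y) r p) * (y - q.2) + (area2 p q r * area2 (x, y) q r) * (y - p.2).
  by rewrite -!mulrA -mulrDr; congr (_ * _); rewrite -e' /= in e; lra.
by rewrite addr_ge0 // mulr_ge0 // subr_ge0 ltW // (le_lt_trans pq).
Qed.
End green.

Section green.
Context {R : realType}.
Notation mu := (@lebesgue_measure R).
Notation M2 := (measurableTypeR R * measurableTypeR R)%type.
Notation mu2 := (@leb2 R).
Implicit Types (p q r a b : plane R) (f : plane R -> R).

Lemma Rintegral_plane (S : set (plane R)) (g : plane R -> R) :
  @measurable _ M2 S -> mu2.-integrable S (EFin \o g) ->
  (\int[mu2]_(x in S) (g x)%:E
   = \int[mu]_y \int[mu]_(x in [set x | S (x, y)]) (g (x, y))%:E)%E.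
Proof.
move=> mS ig; rewrite integral_mkcond.
have -> : (fun x => (g x)%:E) \_ S = EFin \o (g \_ S) by exact: restrict_EFin.
have ig' : mu2.-integrable [set: M2] (EFin \o (g \_ S)).
  by rewrite -restrict_EFin; apply/(integrable_mkcond _ mS).
rewrite -(integral21_prod_meas1 ig'); apply: eq_integral => y _.
rewrite /fubini_G [RHS]integral_mkcond; apply: eq_integral => x _ /=.
by rewrite !patchE; case: ifPn; case: ifPn => //; rewrite !(inE, notin_setE).
Qed.

(* Fubini and the fundamental theorem of calculus on horizontal slices; once the
   vertices are sorted by ordinate, the slice at height [y] lies between the
   long edge [pr] and [pq] or [qr]. *)
Lemma green_dx_sorted p q r f (m : R) : area2 p q r != 0 ->
  p.2 <= q.2 -> q.2 <= r.2 -> closed (halfplanes p q r) -> halfplanes p q r `<=` box m ->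
  continuous f ->
  (forall x, derivable (fun t => f (t, x.2)) x.1 1) -> continuous (dx f) ->
  \int[mu2]_(x in halfplanes p q r) dx f x =
  Num.sg (area2 p q r) * ((q.2 - p.2) * eint p q f + (r.2 - q.2) * eint q r f
    + (p.2 - r.2) * eint r p f).
Proof.
move=> D0 pq qr cT bT cf df cdf.
have mT : @measurable _ M2 (halfplanes p q r) by exact: closed_measurable_plane.
have iT : mu2.-integrable (halfplanes p q r) (EFin \o dx f).
  exact: (integrable_bounded_plane (r := m)).
rewrite {1}/Rintegral (Rintegral_plane mT iT).
(* Each edge is extended by 0 beyond its own range of ordinates, so that the single formula [H]
   covers the slices below and above [q] as well as the empty ones. *)
pose g a b := (fun y => f (edge_abs a b y, y)) \_ `[a.2, b.2].
have ig a b : mu.-integrable setT (EFin \o g a b).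
  rewrite /g -restrict_EFin; apply/(@integrable_mkcond _ (measurableTypeR R) R mu `[a.2, b.2] _ (measurable_itv _)).
  by apply: (@continuous_itv_integrable _ (fun y => f (edge_abs a b y, y)));
    exact: edge_abs_comp_continuous.
have Eg a b : a.2 <= b.2 -> \int[mu]_y g a b y = (b.2 - a.2) * eint a b f.
  by move=> ab; rewrite eint_ordinate // -Rintegral_mkcond.
pose H y := Num.sg (area2 p q r) * (g p q y + g q r y - g p r y).
transitivity (\int[mu]_y H y).
  rewrite /Rintegral; congr fine; apply: ae_eq_integral => //.
  - have ig' : mu2.-integrable [set: M2] (EFin \o (dx f \_ (halfplanes p q r))).
      by rewrite -restrict_EFin; apply/(integrable_mkcond _ mT).
    have := measurable_fubini_G ig'; apply: eq_measurable_fun => y _.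
    rewrite /fubini_G [RHS]integral_mkcond; apply: eq_integral => x _ /=.
    by rewrite !patchE; case: ifPn; case: ifPn => //; rewrite !(inE, notin_setE).
  - apply/measurable_EFinP; apply: measurable_funM => //.
    by apply: measurable_funB; [apply: measurable_funD|]; apply/measurable_EFinP;
      exact: measurable_int (ig _ _).
  (* The pointwise identity may fail at the ordinates of the vertices, where the closed ranges
     overlap; these are at most three points. *)
  have N : mu.-negligible [set p.2; q.2; r.2].
    apply: negligibleU; first apply: negligibleU;
    by apply/negligibleP => //; exact: lebesgue_measure_set1.
  apply: negligibleS N => y /= /not_implyP[_ /= Hy].
  apply: contrapT => /not_orP[/not_orP[yp yq] yr]; apply: Hy.
  have gE a b : a.2 <= b.2 -> y != a.2 -> y != b.2 ->
      g a b y = if a.2 < y < b.2 then f (edge_abs a b y, y) else 0.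
    move=> ab ya yb; rewrite /g patchE mem_setE in_itv/=.
    by rewrite !lt_neqAle yb [_ == y]eq_sym ya.
  have [nyp nyq nyr] : [/\ y != p.2, y != q.2 & y != r.2].
    by split; apply/eqP => e; [apply: yp|apply: yq|apply: yr].
  have pr := le_trans pq qr.
  have cy : continuous (fun x : R => (x, y)).
    by apply: pair_continuous => ?; [exact: cvg_id|exact: cvg_cst].
  have slice_fin : (\int[mu]_(x in [set x | halfplanes p q r (x, y)]) (dx f (x, y))%:E)%E \is a fin_num.
    have mS : measurable [set x | halfplanes p q r (x, y)].
      by apply: closed_measurable; move/continuous_closedP : cy => /(_ _ cT).
    apply: (@integrable_fin_num _ _ _ mu _ mS).
    apply: (@integrableS _ _ _ mu `[- m, m]) => //.
      by move=> x /bT[].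
    apply: (@continuous_itv_integrable _ (fun x => dx f (x, y))) => x.
    by apply: (continuous_comp (g := dx f)); [exact: cy|exact: cdf].
  have out : ~~ (p.2 <= y <= r.2) -> [set x | halfplanes p q r (x, y)] = set0.
    move=> /negP h; apply/seteqP; split => // x /= /(halfplanes_ordinate D0 pq qr)//.
  rewrite /H !gE //.
  have [py|yp'|/esym/eqP] := ltgtP p.2 y; last by rewrite (negbTE nyp).
    have [yq'|qy|/eqP] := ltgtP y q.2; last by rewrite (negbTE nyq).
      rewrite (lt_le_trans yq' qr) /= addr0 -halfplanes_slice_low ?py //.
      by rewrite fineK // slice_fin.
    have [yr'|ry|/eqP] := ltgtP y r.2; last by rewrite (negbTE nyr).
      rewrite /= add0r -halfplanes_slice_high ?qy //.
      by rewrite fineK // slice_fin.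
    by rewrite out ?integral_set0 /= ?add0r ?oppr0 ?mulr0 // (leNgt y) ry andbF.
  have [yq'|qy|/eqP] := ltgtP y q.2; last by rewrite (negbTE nyq).
    by rewrite out ?integral_set0 /= ?add0r ?oppr0 ?mulr0 // leNgt yp'.
  by have := lt_trans qy yp'; rewrite ltNge pq.
have i1 : mu.-integrable setT (EFin \o (g p q \+ g q r)).
  by have := integrableD measurableT (ig p q) (ig q r).
have i2 : mu.-integrable setT (EFin \o ((g p q \+ g q r) \- g p r)).
  by have := integrableB measurableT i1 (ig p r).
rewrite RintegralZl // RintegralB //.
rewrite RintegralD // !Eg // ?(le_trans pq) //.
by rewrite (eint_swap p r cf); congr (_ * _); ring.
Qed.
End green.

(** * Green's formula on a triangle with vertices in any order *)

Section green.
Context {R : realType}.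
Notation mu := (@lebesgue_measure R).
Notation M2 := (measurableTypeR R * measurableTypeR R)%type.
Notation mu2 := (@leb2 R).
Implicit Types (p q r a b : plane R) (v : 'I_3 -> plane R) (f : plane R -> R).

(** Both sides of Green's formula are invariant under permutations of the vertices, which allows
    sorting them by ordinate: exchanging two vertices changes the sign of the area and reverses
    every edge, and the two effects cancel. *)
Definition green_dx_rhs p q r f := Num.sg (area2 p q r) *
  ((q.2 - p.2) * eint p q f + (r.2 - q.2) * eint q r f + (p.2 - r.2) * eint r p f).

Lemma green_dx_rhs_rot p q r f : green_dx_rhs q r p f = green_dx_rhs p q r f.
Proof. by rewrite /green_dx_rhs area2_rot; congr (_ * _); ring. Qed.

Lemma green_dx_rhs_swap p q r f : continuous f ->
  green_dx_rhs q p r f = green_dx_rhs p q r f.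
Proof.
move=> cf; rewrite /green_dx_rhs area2_swap sgrN (eint_swap p q) // (eint_swap r p) //.
by rewrite (eint_swap q r) // mulNr -mulrN; congr (_ * _); ring.
Qed.

Lemma green_dx_halfplanes p q r f (m : R) : area2 p q r != 0 ->
  closed (halfplanes p q r) -> halfplanes p q r `<=` box m -> continuous f ->
  (forall x, derivable (fun t => f (t, x.2)) x.1 1) -> continuous (dx f) ->
  \int[mu2]_(x in halfplanes p q r) dx f x = green_dx_rhs p q r f.
Proof.
move=> D0 cT bT cf df cdf.
have G a b c : a.2 <= b.2 -> area2 a b c != 0 -> closed (halfplanes a b c) -> halfplanes a b c `<=` box m ->
    \int[mu2]_(x in halfplanes a b c) dx f x = green_dx_rhs a b c f.
  move=> ab Dc cc cb; have [bc|cb'] := leP b.2 c.2; first exact: (green_dx_sorted (m := m)).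
  have [ac|ca] := leP a.2 c.2.
    rewrite -halfplanes_rot -halfplanes_swap -green_dx_rhs_rot -green_dx_rhs_swap // halfplanes_rot green_dx_rhs_rot.
    apply: (green_dx_sorted (m := m)) => //; rewrite ?ltW //.
    - by rewrite -area2_rot area2_swap oppr_eq0 area2_rot.
    - by rewrite -halfplanes_rot halfplanes_swap halfplanes_rot.
    - by rewrite -halfplanes_rot halfplanes_swap halfplanes_rot.
  rewrite -halfplanes_rot -halfplanes_rot -green_dx_rhs_rot -green_dx_rhs_rot.
  apply: (green_dx_sorted (m := m)) => //; rewrite ?ltW //.
  - by rewrite -area2_rot.
  - by rewrite -halfplanes_rot.
  - by rewrite -halfplanes_rot.
have [pq|/ltW qp] := leP p.2 q.2; first exact: G.
rewrite -halfplanes_swap -green_dx_rhs_swap //; apply: G => //.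
- by rewrite area2_swap oppr_eq0.
- by rewrite halfplanes_swap.
- by rewrite halfplanes_swap.
Qed.

Lemma green_dx v f : nondegenerate v -> continuous f ->
  (forall x, derivable (fun t => f (t, x.2)) x.1 1) -> continuous (dx f) ->
  \int[mu2]_(x in triangle v) dx f x =
  Num.sg (area2 (v 0) (v 1) (v 2)) *
    \sum_k ((v (k + 2)).2 - (v (k + 1)).2) * eint (v (k + 1)) (v (k + 2)) f.
Proof.
move=> D0 cf df cdf.
have cT := triangle_closed D0; have bT := @triangle_box _ v.
have E := triangle_halfplanes D0; rewrite E in cT bT *.
rewrite (green_dx_halfplanes (m := \sum_k (`|(v k).1| + `|(v k).2|))) // /green_dx_rhs; congr (_ * _).
by rewrite sum3 !add0r !ord3_add; ring.
Qed.

Definition swap (x : plane R) : plane R := (x.2, x.1).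

Lemma swap_continuous : continuous swap.
Proof. by apply: pair_continuous => x; [exact: cvg_snd|exact: cvg_fst]. Qed.

(** Fubini's theorem in its two orders gives the same iterated integral on both sides, which takes
    the place of a change of variables in the plane. *)
Lemma Rintegral_swap (S : set (plane R)) f (m : R) : closed S -> S `<=` box m ->
  continuous f ->
  \int[mu2]_(x in S) f x = \int[mu2]_(x in swap @^-1` S) f (swap x).
Proof.
move=> cS bS cf.
have mS := closed_measurable_plane cS.
have cS' : closed (swap @^-1` S) by move/continuous_closedP : swap_continuous; exact.
have mS' := closed_measurable_plane cS'.
have iS : mu2.-integrable S (EFin \o f) by exact: (integrable_bounded_plane (r := m)).
have iS' : mu2.-integrable (swap @^-1` S) (EFin \o (f \o swap)).
  apply: (integrable_bounded_plane (r := m)) => //; first by move=> x /bS[].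
  by move=> x; apply: continuous_comp; [exact: swap_continuous|exact: cf].
rewrite /Rintegral (@Rintegral_plane _ (swap @^-1` S) (f \o swap)) //; congr fine.
rewrite integral_mkcond.
have -> : (fun x => (f x)%:E) \_ S = EFin \o (f \_ S) by exact: restrict_EFin.
have ig' : mu2.-integrable [set: M2] (EFin \o (f \_ S)).
  by rewrite -restrict_EFin; apply/(integrable_mkcond _ mS).
rewrite -(integral12_prod_meas1 ig'); apply: eq_integral => y _.
rewrite /fubini_F [RHS]integral_mkcond; apply: eq_integral => x _ /=.
by rewrite !patchE; case: ifPn; case: ifPn => //; rewrite !(inE, notin_setE).
Qed.

(** Reflection in the diagonal reduces this to [green_dx]. The minus sign appears because a
    reflection reverses the orientation. *)
Lemma green_dy v f : nondegenerate v -> continuous f ->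
  (forall x, derivable (fun t => f (x.1, t)) x.2 1) -> continuous (dy f) ->
  \int[mu2]_(x in triangle v) dy f x =
  - (Num.sg (area2 (v 0) (v 1) (v 2)) *
    \sum_k ((v (k + 2)).1 - (v (k + 1)).1) * eint (v (k + 1)) (v (k + 2)) f).
Proof.
move=> D0 cf df cdf.
have Da a b c : area2 (swap a) (swap b) (swap c) = - area2 a b c.
  by rewrite /area2 /=; ring.
have D0' : nondegenerate (swap \o v) by rewrite /nondegenerate /= Da oppr_eq0.
rewrite (Rintegral_swap (m := \sum_k (`|(v k).1| + `|(v k).2|))) //; last 2 first.
  exact: triangle_closed.
  exact: triangle_box.
have -> : swap @^-1` triangle v = triangle (swap \o v).
  by apply/seteqP; split => x [l [? ? ? ?]]; exists l; split.
rewrite -[LHS]/(\int[mu2]_(x in triangle (swap \o v)) dx (f \o swap) x).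
have cfs : continuous (f \o swap).
  by move=> x; apply: continuous_comp; [exact: swap_continuous|exact: cf].
have dfs x : derivable (fun t => (f \o swap) (t, x.2)) x.1 1 by exact: (df (swap x)).
have cdfs : continuous (dx (f \o swap)).
  move=> x; rewrite -[dx _]/(dy f \o swap).
  by apply: continuous_comp; [exact: swap_continuous|exact: cdf].
rewrite (green_dx D0' cfs dfs cdfs).
rewrite /= Da sgrN mulNr; congr (- (_ * _)); apply: eq_bigr => k _; congr (_ * _).
Qed.

Lemma integrable_triangle v f : nondegenerate v -> continuous f ->
  mu2.-integrable (triangle v) (EFin \o f).
Proof.
move=> D0 cf.
have mT := closed_measurable_plane (triangle_closed D0).
exact: (integrable_bounded_plane mT (@triangle_box _ v)).
Qed.

Lemma green_triangle v f g : nondegenerate v -> Ck 1 f -> Ck 1 g ->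
  \int[mu2]_(x in triangle v) (dx f x + dy g x) =
  Num.sg (area2 (v 0) (v 1) (v 2)) *
    \sum_k (((v (k + 2)).2 - (v (k + 1)).2) * eint (v (k + 1)) (v (k + 2)) f
          - ((v (k + 2)).1 - (v (k + 1)).1) * eint (v (k + 1)) (v (k + 2)) g).
Proof.
move=> D0 [cf [dxf _ [cdxf _] _]] [cg [_ dyg _ [cdyg _]]].
have mT := closed_measurable_plane (triangle_closed D0).
have := RintegralD mT (integrable_triangle D0 cdxf) (integrable_triangle D0 cdyg).
by move=> ->; rewrite green_dx // green_dy // -mulrBr sumrB.
Qed.

End green.

(** * Test functions *)

Section Ck_theory.
Context {R : realType}.
Implicit Types (f g : plane R -> R) (k : nat).

Lemma Ck_continuous k f : Ck k f -> continuous f.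
Proof. by case: k => [|k] []. Qed.

Lemma CkW k f : Ck k.+1 f -> Ck k f.
Proof.
elim: k f => [|k IH] f; first by case.
move=> [cf [d1 d2 h1 h2]]; split; first exact: cf.
by split; [exact: d1|exact: d2|exact: (IH _ h1)|exact: (IH _ h2)].
Qed.

Lemma Ck_cst k (c : R) : Ck k (fun=> c).
Proof.
elim: k c => [|k IH] c; split; try exact: cst_continuous; split.
- by move=> x; exact: derivable_cst.
- by move=> x; exact: derivable_cst.
- rewrite (_ : dx _ = fun=> 0) //; apply/funext => x; rewrite /dx derive1E; exact: derive_cst.
- rewrite (_ : dy _ = fun=> 0) //; apply/funext => x; rewrite /dy derive1E; exact: derive_cst.
Qed.

Lemma Ck_fst k : Ck k (fst : plane R -> R).
Proof.
case: k => [|k]; split; try (by move=> x; exact: cvg_fst); split.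
- by move=> x; exact: derivable_id.
- by move=> x; exact: derivable_cst.
- rewrite (_ : dx _ = fun=> 1); first exact: Ck_cst.
  by apply/funext => x; rewrite /dx derive1E; exact: derive_id.
- rewrite (_ : dy _ = fun=> 0); first exact: Ck_cst.
  by apply/funext => x; rewrite /dy derive1E; exact: derive_cst.
Qed.

Lemma Ck_snd k : Ck k (snd : plane R -> R).
Proof.
case: k => [|k]; split; try (by move=> x; exact: cvg_snd); split.
- by move=> x; exact: derivable_cst.
- by move=> x; exact: derivable_id.
- rewrite (_ : dx _ = fun=> 0); first exact: Ck_cst.
  by apply/funext => x; rewrite /dx derive1E; exact: derive_cst.
- rewrite (_ : dy _ = fun=> 1); first exact: Ck_cst.
  by apply/funext => x; rewrite /dy derive1E; exact: derive_id.
Qed.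

Lemma dxD f g : (forall x, derivable (fun t => f (t, x.2)) x.1 1) ->
  (forall x, derivable (fun t => g (t, x.2)) x.1 1) ->
  dx (fun x => f x + g x) = (fun x => dx f x + dx g x).
Proof.
by move=> df dg; apply/funext => x; rewrite /dx !derive1E; exact: deriveD.
Qed.

Lemma dyD f g : (forall x, derivable (fun t => f (x.1, t)) x.2 1) ->
  (forall x, derivable (fun t => g (x.1, t)) x.2 1) ->
  dy (fun x => f x + g x) = (fun x => dy f x + dy g x).
Proof.
by move=> df dg; apply/funext => x; rewrite /dy !derive1E; exact: deriveD.
Qed.

Lemma dxM f g : (forall x, derivable (fun t => f (t, x.2)) x.1 1) ->
  (forall x, derivable (fun t => g (t, x.2)) x.1 1) ->
  dx (fun x => f x * g x) = (fun x => dx f x * g x + f x * dx g x).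
Proof.
move=> df dg; apply/funext => -[x1 x2]; rewrite /dx !derive1E /=.
by rewrite (deriveM (df (x1, x2)) (dg (x1, x2))) addrC [g _ *: _]mulrC.
Qed.

Lemma dyM f g : (forall x, derivable (fun t => f (x.1, t)) x.2 1) ->
  (forall x, derivable (fun t => g (x.1, t)) x.2 1) ->
  dy (fun x => f x * g x) = (fun x => dy f x * g x + f x * dy g x).
Proof.
move=> df dg; apply/funext => -[x1 x2]; rewrite /dy !derive1E /=.
by rewrite (deriveM (df (x1, x2)) (dg (x1, x2))) addrC [g _ *: _]mulrC.
Qed.

Lemma CkD k f g : Ck k f -> Ck k g -> Ck k (fun x => f x + g x).
Proof.
elim: k f g => [|k IH] f g.
  by move=> [cf _] [cg _]; split => // x; apply: cvgD; [exact: cf|exact: cg].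
move=> [cf [fx fy cfx cfy]] [cg [gx gy cgx cgy]]; split.
  by move=> x; apply: cvgD; [exact: cf|exact: cg].
split.
- by move=> x; exact: (derivableD (fx x) (gx x)).
- by move=> x; exact: (derivableD (fy x) (gy x)).
- by rewrite dxD //; exact: IH.
- by rewrite dyD //; exact: IH.
Qed.

Lemma CkM k f g : Ck k f -> Ck k g -> Ck k (fun x => f x * g x).
Proof.
elim: k f g => [|k IH] f g.
  by move=> [cf _] [cg _]; split => // x; apply: cvgM; [exact: cf|exact: cg].
move=> Cf Cg; have [[cf [fx fy cfx cfy]] [cg [gx gy cgx cgy]]] := (Cf, Cg); split.
  by move=> x; apply: cvgM; [exact: cf|exact: cg].
split.
- by move=> x; exact: (derivableM (fx x) (gx x)).
- by move=> x; exact: (derivableM (fy x) (gy x)).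
- by rewrite dxM //; apply: CkD; apply: IH => //; exact: CkW.
- by rewrite dyM //; apply: CkD; apply: IH => //; exact: CkW.
Qed.

Lemma CkX k f n : Ck k f -> Ck k (fun x => f x ^+ n).
Proof.
move=> Cf; elim: n => [|n IH]; first exact: Ck_cst.
by under eq_fun do rewrite exprS; exact: CkM.
Qed.

Lemma Ck_sum k (I : Type) (s : seq I) (P : pred I) (F : I -> plane R -> R) :
  (forall i, Ck k (F i)) -> Ck k (fun x => \sum_(i <- s | P i) F i x).
Proof.
move=> CF; elim: s => [|i s IH].
  by under eq_fun do rewrite big_nil; exact: Ck_cst.
under eq_fun do rewrite big_cons; case: (P i) => //.
exact: CkD.
Qed.

Lemma Ck_Pd k d (p : plane R -> R) : Pd d p -> Ck k p.
Proof.
move=> [c pE]; rewrite (_ : p = fun x => \sum_(i < d.+1)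
    \sum_(j < d.+1 | (i + j <= d)%N) c i j * x.1 ^+ i * x.2 ^+ j); last exact/funext.
apply: Ck_sum => i; apply: Ck_sum => j.
apply: CkM; last by apply: CkX; exact: Ck_snd.
by apply: CkM; [exact: Ck_cst|apply: CkX; exact: Ck_fst].
Qed.

(** [Ck] recurses through the partial derivatives, so the induction needs a whole family: the chain
    rule replaces [h n] by a multiple of [h n.+1]. *)
Lemma Ck_comp_affine (h : nat -> R -> R) (a b c : R) k n :
  (forall n t, is_derive t (1 : R) (h n) (h n.+1 t)) ->
  Ck k (fun x : plane R => h n (a + b * x.1 + c * x.2)).
Proof.
move=> dh; elim: k n => [|k IH] n.
  have ch : continuous (h n).
    by move=> t; apply/differentiable_continuous/derivable1_diffP; have [] := dh n t.
  split => // x; apply: (continuous_comp (f := fun x : plane R => a + b * x.1 + c * x.2) (g := h n)); last exact: ch.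
  apply: cvgD; [apply: cvgD; first exact: cvg_cst|];
    apply: cvgM; [exact: cvg_cst|exact: cvg_fst|exact: cvg_cst|exact: cvg_snd].
have dX x2 t : is_derive t (1 : R) (fun t => h n (a + b * t + c * x2)) (b * h n.+1 (a + b * t + c * x2)).
  have dl : is_derive t (1 : R) (fun t => a + b * t + c * x2) b.
    by apply: is_derive_eq; rewrite ?scaler0 /GRing.scale /= !add0r mul1r addr0 mulr1.
  have := (@is_derive1_comp _ (h n) (fun t => a + b * t + c * x2) _ _ _ (dh n _) dl).
  by rewrite (mulrC b (h n.+1 _)).
have dY x1 t : is_derive t (1 : R) (fun t => h n (a + b * x1 + c * t)) (c * h n.+1 (a + b * x1 + c * t)).
  have dl : is_derive t (1 : R) (fun t => a + b * x1 + c * t) c.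
    by apply: is_derive_eq; rewrite ?scaler0 /GRing.scale /= !add0r mul1r mulr1.
  have := (@is_derive1_comp _ (h n) (fun t => a + b * x1 + c * t) _ _ _ (dh n _) dl).
  by rewrite (mulrC c (h n.+1 _)).
split; first exact: (Ck_continuous (IH n)); split.
- by move=> x; have [] := dX x.2 x.1.
- by move=> x; have [] := dY x.1 x.2.
- rewrite (_ : dx _ = fun x => b * h n.+1 (a + b * x.1 + c * x.2)).
    by apply: CkM; [exact: Ck_cst|exact: IH].
  by apply/funext => x; rewrite /dx derive1E /=; have [_ <-] := dX x.2 x.1.
- rewrite (_ : dy _ = fun x => c * h n.+1 (a + b * x.1 + c * x.2)).
    by apply: CkM; [exact: Ck_cst|exact: IH].
  by apply/funext => x; rewrite /dy derive1E /=; have [_ <-] := dY x.1 x.2.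
Qed.

End Ck_theory.

(** * A flat smooth function and compactly supported bumps *)

Section bump.
Context {R : realType}.
Implicit Types p : {poly R}.

(* The functions [p(1/t) exp(-1/t)], extended by [0] to [t <= 0], form a family
   closed under differentiation, hence are smooth. *)
Definition flat p (t : R) : R := if 0 < t then p.[t^-1] * expR (- t^-1) else 0.

(** With [s = 1/t], the exponential series gives [s ^+ i.+2 <= i.+2! * exp s]. The two powers beyond
    degree [i] are the quadratic decay at 0 that makes the derivative vanish there. *)
Lemma flat_bound p : exists C : R, forall t, `|flat p t| <= C * t ^+ 2.
Proof.
exists (\sum_(i < size p) `|p`_i| * (i.+2)`!%:R) => t; rewrite /flat.
case: ifPn => [t0|_]; last first.
  by rewrite normr0; apply: mulr_ge0; [apply: sumr_ge0 => i _; exact: mulr_ge0|exact: sqr_ge0].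
rewrite horner_coef !mulr_suml (le_trans (ler_norm_sum _ _ _)) // ler_sum // => i _.
rewrite !normrM -!mulrA ler_wpM2l //.
have s0 : 0 < t^-1 by rewrite invr_gt0.
rewrite (ger0_norm (expR_ge0 _)) ger0_norm ?exprn_ge0 ?(ltW s0) // expRN.
rewrite ler_pdivrMr ?expR_gt0 //.
have F0 : 0 < (i.+2)`!%:R :> R by rewrite ltr0n fact_gt0.
have : (t^-1) ^+ i.+2 / i.+2`!%:R <= expR t^-1.
  by apply: le_trans (expR_ge1Dxn i.+1 (ltW s0)); rewrite lerDr.
rewrite ler_pdivrMr // => H.
have -> : t^-1 ^+ i = t ^+ 2 * t^-1 ^+ i.+2.
  by rewrite -(addn2 i) exprD mulrCA -exprMn divff ?gt_eqF // expr1n mulr1.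
rewrite (_ : (i.+2)`!%:R * t ^+ 2 * expR t^-1 = t ^+ 2 * (expR t^-1 * (i.+2)`!%:R)); last by ring.
by rewrite ler_pM2l ?exprn_gt0.
Qed.

(** For [t > 0], the inner function [1/t] has derivative [- t ^- 2], which produces the factor
    ['X^2] and, together with the derivative of the exponential, the difference [p - p']. At 0 the
    difference quotient is at most a constant times [|h|] by [flat_bound]. *)
Lemma flat_derive p t :
  is_derive t (1 : R) (flat p) (flat ('X^2 * (p - p^`())) t).
Proof.
have [t0|t0|->] := ltgtP t 0.
- have E : \forall z \near t, flat p z = cst 0 z.
    near=> z; rewrite /flat ifF //; apply/negbTE; rewrite -leNgt ltW //.
    by near: z; exact: lt_nbhsl.
  rewrite {2}/flat ifF; last by apply/negbTE; rewrite -leNgt ltW.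
  apply: near_eq_is_derive (is_derive_cst _ _ _).
  by apply: filterS E => z ->.
- have E : \forall z \near t, flat p z = p.[z^-1] * expR (- z^-1).
    by near=> z; rewrite /flat ifT //; near: z; exact: lt_nbhsr.
  have d : is_derive t (1 : R) (fun z : R => p.[z^-1] * expR (- z^-1)) (flat ('X^2 * (p - p^`())) t).
    have t0' : t != 0 by rewrite gt_eqF.
    have dV : is_derive t (1 : R) (fun z : R => z^-1) (- t ^- 2).
      by apply: (is_derive_eq (is_deriveV _ (is_derive_id t 1))); rewrite // /GRing.scale /= mulr1.
    have dp := @is_derive1_comp _ (horner p) (fun z : R => z^-1) _ _ _ (is_derive_poly p _) dV.
    have dVN : is_derive t (1 : R) (fun z : R => - z^-1) (t ^- 2).
      by apply: (is_derive_eq (is_deriveN dV)); rewrite opprK.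
    have de := @is_derive1_comp _ expR (fun z : R => - z^-1) _ _ _ (is_derive_expR _) dVN.
    apply: (is_derive_eq (is_deriveM dp de)); rewrite /flat t0 /GRing.scale /=.
    by rewrite !hornerE /= exprVn; ring.
  by apply: near_eq_is_derive d; apply: filterS E => z ->.
have F0 q : flat q 0 = 0 by rewrite /flat ltxx.
rewrite F0.
have H : h^-1 *: ((flat p \o shift 0) (h *: 1) - flat p 0) @[h --> 0^'] --> (0 : R).
  have [C HC] := flat_bound p.
  apply/cvgr0Pnorm_lt => e e0; near=> h.
  have h0 : h != 0 by near: h; exact: nbhs_dnbhs_neq.
  have C0 : 0 < `|C| + 1 by rewrite ltr_wpDl.
  have he : `|h| < e / (`|C| + 1).
    by near: h; apply: dnbhs0_lt; rewrite divr_gt0.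
  rewrite /= F0 subr0 addr0 /GRing.scale /= mulr1 normrM normfV.
  rewrite ltr_pdivrMl ?normr_gt0 //.
  apply: le_lt_trans (HC h) _; apply: le_lt_trans (ler_norm _) _.
  rewrite normrM normrX expr2 mulrCA ltr_pM2l ?normr_gt0 //.
  move: he; rewrite ltr_pdivlMr // mulrDr mulr1 mulrC; apply: le_lt_trans.
  by rewrite lerDl.
split; first by apply/cvg_ex; exists 0.
exact/cvg_lim.
Unshelve. all: by end_near.
Qed.

(** The [n]-th derivative of [theta] is [flat (flat_poly n)]. *)
Definition flat_poly n : {poly R} := iter n (fun p => 'X^2 * (p - p^`())) 1.

Definition theta : R -> R := flat 1.

Lemma theta_ge0 t : 0 <= theta t.
Proof. by rewrite /theta /flat; case: ifP => // _; rewrite hornerE mul1r expR_ge0. Qed.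

Lemma theta_le1 t : theta t <= 1.
Proof.
rewrite /theta /flat; case: ifP => // t0; rewrite hornerE mul1r.
by rewrite expR_le1 oppr_le0 invr_ge0 ltW.
Qed.

Lemma theta_gt0 t : (0 < theta t) = (0 < t).
Proof.
by rewrite /theta /flat; case: ifP => t0; rewrite ?ltxx // hornerE mul1r expR_gt0.
Qed.

Lemma theta_eq0 t : t <= 0 -> theta t = 0.
Proof. by move=> t0; rewrite /theta /flat ltNge t0. Qed.

Lemma Ck_theta k (a b c : R) : Ck k (fun x : plane R => theta (a + b * x.1 + c * x.2)).
Proof.
by apply: (Ck_comp_affine (h := fun n => flat (flat_poly n)) _ _ _ _ 0) => n t; exact: flat_derive.
Qed.

(** The factors 0 and 1 put each argument into the affine form of [Ck_theta]. *)
Definition bump_at (x : plane R) (r : R) (y : plane R) : R :=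
  theta ((r - x.1) + 1 * y.1 + 0 * y.2) * theta ((r + x.1) + (-1) * y.1 + 0 * y.2)
  * (theta ((r - x.2) + 0 * y.1 + 1 * y.2) * theta ((r + x.2) + 0 * y.1 + (-1) * y.2)).

Lemma Ck_bump k x r : Ck k (bump_at x r).
Proof. by apply: CkM; apply: CkM; exact: Ck_theta. Qed.

Lemma bump_ge0 x r y : 0 <= bump_at x r y.
Proof. by rewrite !mulr_ge0 ?theta_ge0. Qed.

Lemma bump_gt0 x r : 0 < r -> 0 < bump_at x r x.
Proof.
by move=> r0; rewrite !mulr_gt0 // theta_gt0 !(mul0r, mul1r, mulN1r, addr0, subrK, addrK).
Qed.

Definition square (x : plane R) (r : R) : set (plane R) :=
  `[x.1 - r, x.1 + r]%classic `*` `[x.2 - r, x.2 + r]%classic.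

Lemma bump_eq0 x r y : ~ square x r y -> bump_at x r y = 0.
Proof.
rewrite /square /bump_at /= !in_itv /= => H.
rewrite !(mul0r, mul1r, mulN1r, addr0).
apply/eqP; rewrite !mulf_eq0; apply/negPn/negP; rewrite !negb_or => /andP[/andP[a b] /andP[c d]].
have pos t : theta t != 0 -> 0 < t by move=> t0; rewrite -theta_gt0 lt0r t0 theta_ge0.
move/pos : a => a; move/pos : b => b; move/pos : c => c; move/pos : d => d.
by apply: H; split; apply/andP; split; lra.
Qed.

Lemma test_fun_bump (Omega : set (plane R)) x r (h : plane R -> R) :
  (forall k, Ck k h) -> square x r `<=` Omega ->
  test_fun Omega (fun y => bump_at x r y * h y).
Proof.
move=> Ch rO.
have cS : compact (square x r) by apply: compact_setX; exact: segment_compact.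
have clS : closed (square x r).
  by apply: compact_closed => //; exact: norm_hausdorff.
have sS : closure [set y | bump_at x r y * h y != 0] `<=` square x r.
  rewrite [X in _ `<=` X](closure_id _).1 //; apply: closureS => y /=.
  by apply: contra_neqP => /bump_eq0 ->; rewrite mul0r.
split.
- by move=> k; apply: CkM => //; exact: Ck_bump.
- by apply: subclosed_compact cS sS; exact: closed_closure.
- exact: subset_trans rO.
Qed.

End bump.

(** * Edges and neighbouring triangles *)

Section bary_theory.
Context {R : realType}.
Implicit Types (x y a b : plane R) (v w : 'I_3 -> plane R) (k l : 'I_3).

Lemma ord3_shift k : ((k + 1 + 1 = k + 2)%R * (k + 1 + 2 = k)%R * (k + 2 + 1 = k)%R
  * (k + 2 + 2 = k + 1)%R)%type.
Proof. by case: (ord3P k) => ->; do !split; exact: val_inj. Qed.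

Lemma ord3_shiftP k l : [\/ l = k, l = k + 1 | l = k + 2].
Proof.
by case: (ord3P k) => ->; case: (ord3P l) => ->;
  (try by apply: Or31; exact: val_inj); (try by apply: Or32; exact: val_inj);
  apply: Or33; exact: val_inj.
Qed.

Lemma ord3_neq k : ((k + 1 == k) = false) * ((k + 2 == k) = false) * ((k + 1 == k + 2) = false)
  * ((k == k + 1) = false) * ((k == k + 2) = false) * ((k + 2 == k + 1) = false).
Proof. by case: (ord3P k) => ->. Qed.

Lemma sum3_shift (V : nmodType) (F : 'I_3 -> V) k : \sum_j F j = F k + F (k + 1) + F (k + 2).
Proof.
rewrite sum3; case: (ord3P k) => ->; rewrite ?add0r ?ord3_add //.
- by rewrite -addrA addrC.
- by rewrite addrC addrA.
Qed.

Lemma area2_shift v k : area2 (v k) (v (k + 1)) (v (k + 2)) = area2 (v 0) (v 1) (v 2).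
Proof.
case: (ord3P k) => ->; rewrite ?add0r ?ord3_add //; first exact: area2_rot.
by rewrite -area2_rot.
Qed.

Lemma bary_vertex v k j : nondegenerate v -> bary v k (v j) = (k == j)%:R.
Proof.
move=> D0; rewrite (@bary_uniq _ v (fun k => (k == j)%:R)) //.
- by rewrite (bigD1 j) //= eqxx big1 ?addr0 // => i /negbTE ->.
- by rewrite (bigD1 j) //= eqxx mul1r big1 ?addr0 // => i /negbTE ->; rewrite mul0r.
- by rewrite (bigD1 j) //= eqxx mul1r big1 ?addr0 // => i /negbTE ->; rewrite mul0r.
Qed.

Lemma bary_line v k a b t :
  bary v k (line_point a b t) = (1 - t) * bary v k a + t * bary v k b.
Proof. by rewrite /bary /area2 /line_point /=; ring. Qed.

Lemma bary_affine v w k y : nondegenerate v ->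
  bary w k y = \sum_j bary v j y * bary w k (v j).
Proof.
move=> D0; have [s1 s2 s3] := bary_sum y D0; move: s1 s2 s3; rewrite !sum3.
move: (bary v 0 y) (bary v 1 y) (bary v 2 y) => l0 l1 l2 e1 e2 e3.
rewrite /bary !mulrA -!mulrDl; congr (_ / _); rewrite /area2 -e2 -e3.
have -> : l0 = 1 - l1 - l2 by rewrite -e1; ring.
by ring.
Qed.

Lemma nondegenerate_inj v : nondegenerate v -> injective v.
Proof.
move=> D0 i j ij; have := bary_vertex i j D0; rewrite -ij bary_vertex // eqxx.
by case: eqP => // _ /eqP; rewrite oner_eq0.
Qed.

Lemma triangle_vertex v j : nondegenerate v -> triangle v (v j).
Proof.
by move=> D0; apply/triangleP => // k; rewrite bary_vertex.
Qed.

(** This is how proper meeting excludes overlaps: no three common points span a triangle. *)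
Lemma meet_collinear v w x y z : meet_properly v w ->
  (triangle v `&` triangle w) x -> (triangle v `&` triangle w) y ->
  (triangle v `&` triangle w) z -> area2 x y z = 0.
Proof.
case=> [->//|[a _ ->] /= -> -> ->|[a [b [_ ->]]] [s _ <-] [t _ <-] [u _ <-]].
  by rewrite /area2; ring.
by rewrite /area2 /line_point /=; ring.
Qed.

(** The edge opposite to the vertex [k], without its endpoints: near a vertex there may be many
    triangles, near any other point of the edge at most two. *)
Definition oedge v k : set (plane R) :=
  [set x | [/\ bary v k x = 0, 0 < bary v (k + 1) x & 0 < bary v (k + 2) x]].

Lemma oedge_triangle v k : nondegenerate v -> oedge v k `<=` triangle v.
Proof.
move=> D0 x [h0 h1 h2]; apply/triangleP => // l.
by case: (ord3_shiftP k l) => ->; rewrite ?h0 // ltW.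
Qed.

Lemma oedge_line v k t : nondegenerate v -> 0 < t < 1 ->
  oedge v k (line_point (v (k + 1)) (v (k + 2)) t).
Proof.
move=> D0 /andP[t0 t1].
split; rewrite bary_line !bary_vertex // ?eqxx ?ord3_neq ?mulr0 ?mulr1 ?addr0 ?add0r //.
by rewrite subr_gt0.
Qed.

(** Both directions have to be allowed, since the triangles may be listed with either
    orientation. *)
Definition share v k w l : Prop :=
  (w (l + 1) = v (k + 1) /\ w (l + 2) = v (k + 2)) \/
  (w (l + 1) = v (k + 2) /\ w (l + 2) = v (k + 1)).

Lemma share_sym v k w l : share v k w l -> share w l v k.
Proof. by case=> -[e1 e2]; [left|right]; split. Qed.

Lemma share_trans u j v k w l : share u j v k -> share v k w l -> share u j w l.
Proof.
by case=> -[e1 e2] [] [e3 e4]; (try by left; split; congruence); right; split; congruence.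
Qed.

Lemma share_uniq v k w l l' : nondegenerate w -> share v k w l -> share v k w l' -> l = l'.
Proof.
move=> D0 s s'; have [] := share_trans (share_sym s) s' => -[e1 e2];
  have {}e1 := nondegenerate_inj D0 e1; have {}e2 := nondegenerate_inj D0 e2.
  by apply: (addIr 1); rewrite -e1.
exfalso; move: e1 e2; have [] := ord3_shiftP l l' => ->; rewrite ?ord3_shift => e1 e2.
- by move/eqP: e1; rewrite ord3_neq.
- by move/eqP: e2; rewrite ord3_neq.
- by move/eqP: e1; rewrite ord3_neq.
Qed.

Lemma vertices_edge w a b : a != b -> vertices w a -> vertices w b ->
  exists l, (w (l + 1) = a /\ w (l + 2) = b) \/ (w (l + 1) = b /\ w (l + 2) = a).
Proof.
move=> ab [i _ ai] [j _ bj]; subst a b.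
have [ji|ji|ji] := ord3_shiftP i j; subst j.
- by rewrite eqxx in ab.
- by exists (i + 2); left; rewrite !ord3_shift.
- by exists (i + 1); right; rewrite !ord3_shift.
Qed.

(** Both coordinates are affine and vanish on the common edge, hence they are proportional; the
    factor is found by evaluating at [v k]. *)
Lemma share_bary v k w l y : nondegenerate v -> nondegenerate w -> share v k w l ->
  bary w l y = bary w l (v k) * bary v k y.
Proof.
move=> Dv Dw s; rewrite (bary_affine w l y Dv) (sum3_shift _ k) mulrC.
have [e1 e2] : bary w l (v (k + 1)) = 0 /\ bary w l (v (k + 2)) = 0.
  by case: s => -[<- <-]; rewrite !bary_vertex // !ord3_neq.
by rewrite e1 e2 !mulr0 !addr0.
Qed.

Lemma share_oedge v k w l : nondegenerate v -> nondegenerate w -> share v k w l ->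
  oedge v k `<=` oedge w l.
Proof.
move=> Dv Dw s x [h0 h1 h2].
have H j : bary w j x = bary v (k + 1) x * bary w j (v (k + 1)) + bary v (k + 2) x * bary w j (v (k + 2)).
  by rewrite (bary_affine w j x Dv) (sum3_shift _ k) h0 mul0r add0r.
by split; rewrite H; case: s => -[<- <-]; rewrite !bary_vertex // ?eqxx ?ord3_neq ?mulr0 ?mulr1 ?addr0 ?add0r.
Qed.

Lemma near0_pos (P : R -> Prop) : (\forall t \near 0, P t) -> exists2 t, 0 < t < 1 & P t.
Proof.
move=> [e /= e0 He]; exists (Num.min (e / 2) (1 / 2)).
  by rewrite lt_min gt_min; apply/andP; split; [apply/andP; split|apply/orP; right]; lra.
apply: He; rewrite /= sub0r normrN ger0_norm; last by rewrite le_min; apply/andP; split; lra.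
by rewrite gt_min; apply/orP; left; lra.
Qed.

Lemma near0_neg (P : R -> Prop) : (\forall t \near 0, P t) -> exists2 t, t < 0 & P t.
Proof.
move=> [e /= e0 He]; exists (- (e / 2)); first by lra.
by apply: He; rewrite /= sub0r opprK ger0_norm; lra.
Qed.

Lemma near_bary_gt0 v k x : 0 < bary v k x -> \forall y \near x, 0 < bary v k y.
Proof. exact: (cvgr_gt (bary v k x) (@bary_continuous R v k x)). Qed.

Lemma line_point0 a b : line_point a b 0 = a.
Proof. by rewrite /line_point !mul0r !addr0; case: a. Qed.

(* Were the opposite vertices on the same side, both triangles would contain a
   point slightly off the common edge. *)
Lemma share_opposite v k w l : nondegenerate v -> nondegenerate w -> meet_properly v w ->
  share v k w l -> bary w l (v k) < 0.
Proof.
move=> Dv Dw m s; rewrite ltNge; apply/negP => h.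
pose x := line_point (v (k + 1)) (v (k + 2)) (1 / 2).
have ox : oedge v k x by apply: oedge_line => //; apply/andP; split; lra.
have [x0 x1 x2] := ox.
have [y0 y1 y2] := share_oedge Dv Dw s ox.
have : \forall t \near 0, 0 < bary w (l + 1) (line_point x (v k) t) /\
     0 < bary w (l + 2) (line_point x (v k) t).
  have c := @line_point_continuous R x (v k) 0.
  rewrite /continuous_at line_point0 in c.
  exact: (filterI (c _ (near_bary_gt0 y1)) (c _ (near_bary_gt0 y2))).
move=> /near0_pos[t /andP[t0 t1] [z1 z2]].
set z := line_point x (v k) t in z1 z2.
have vz : triangle v z.
  apply/triangleP => // j; rewrite bary_line bary_vertex //.
  apply: addr_ge0; apply: mulr_ge0 => //; rewrite ?(ltW t0) ?subr_ge0 ?(ltW t1) //.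
  exact: ((triangleP x Dv).1 (oedge_triangle Dv ox) j).
have wz : triangle w z.
  apply/triangleP => // j; have [] := ord3_shiftP l j => ->; rewrite ?(ltW z1) ?(ltW z2) //.
  by rewrite bary_line y0 mulr0 add0r mulr_ge0 // ltW.
have [wa wb] : triangle w (v (k + 1)) /\ triangle w (v (k + 2)).
  by case: s => -[<- <-]; split; exact: triangle_vertex.
(* Collinearity with the edge would give [bary v k z = 0], whereas this coordinate is [t] by
   construction. *)
have := @meet_collinear _ _ z (v (k + 1)) (v (k + 2)) m.
move=> /(_ (conj vz wz) (conj (triangle_vertex _ Dv) wa) (conj (triangle_vertex _ Dv) wb)) A0.
have : bary v k z = 0 by rewrite /bary A0 mul0r.
rewrite bary_line x0 mulr0 add0r bary_vertex // eqxx mulr1 => t00.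
by rewrite t00 ltxx in t0.
Qed.

(** The vertex of [v] and the vertex of [w] opposite to the edge both lie on the side away from [u],
    hence on the same side, against [share_opposite]. In coordinates, a product of two negative
    numbers would be negative. *)
Lemma share_third u j v k w l : nondegenerate u -> nondegenerate v -> nondegenerate w ->
  meet_properly u v -> meet_properly v u -> meet_properly u w -> meet_properly v w ->
  share u j v k -> share u j w l -> False.
Proof.
move=> Du Dv Dw muv mvu muw mvw suv suw.
have svw := share_trans (share_sym suv) suw.
have h1 := share_opposite Dv Dw mvw svw.
have h2 := share_opposite Du Dw muw suw.
have h3 := share_opposite Dv Du mvu (share_sym suv).
move: h1; rewrite (share_bary _ Du Dw suw) ltNge => /negP; apply.
by rewrite mulr_le0 // ltW.
Qed.

(** A point of an open edge is not a vertex and lies on no other edge of [v]. Hence the triangles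
    meet along an edge, and it can only be the edge [k]. *)
Lemma meet_oedge v w k x : nondegenerate v -> nondegenerate w -> meet_properly v w ->
  oedge v k x -> triangle w x -> exists l, share v k w l.
Proof.
move=> Dv Dw m ox wx; have vx := oedge_triangle Dv ox.
have [x0 x1 x2] := ox.
have : (triangle v `&` triangle w) x by [].
case: m => [->//|[a [[j _ ja] _] ->] /= xa|[a [b [[ab [va vb] [wa wb]] ->]]] [t _ tx]].
  subst a; move: x1 x2; rewrite xa !bary_vertex //.
  have [] := ord3_shiftP k j => ->; rewrite ?eqxx ?ord3_neq ?ltxx //.
have [i [[e1 e2]|[e1 e2]]] := vertices_edge ab va vb.
  have H : i = k.
    move: x0 x1 x2; rewrite -tx !bary_line -e1 -e2 !bary_vertex //.
    have [] := ord3_shiftP i k => ->; rewrite ?ord3_shift ?eqxx ?ord3_neq //;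
      rewrite ?mulr0 ?addr0 ?ltxx //.
  subst i; have [l [[f1 f2]|[f1 f2]]] := vertices_edge ab wa wb; exists l; [left|right]; split; congruence.
have H : i = k.
  move: x0 x1 x2; rewrite -tx !bary_line -e1 -e2 !bary_vertex //.
  have [] := ord3_shiftP i k => ->; rewrite ?ord3_shift ?eqxx ?ord3_neq //;
    rewrite ?mulr0 ?addr0 ?ltxx //.
subst i; have [l [[f1 f2]|[f1 f2]]] := vertices_edge ab wa wb; exists l; [right|left]; split; congruence.
Qed.

(** Near [x] the coordinates of the edge endpoints stay positive in both triangles. The remaining
    ones have opposite signs across the line, so at each point one of them is nonnegative. *)
Lemma share_near v k w l x : nondegenerate v -> nondegenerate w -> meet_properly v w ->
  share v k w l -> oedge v k x -> \forall y \near x, (triangle v `|` triangle w) y.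
Proof.
move=> Dv Dw m s ox; have [x0 x1 x2] := ox; have [y0 y1 y2] := share_oedge Dv Dw s ox.
near=> y.
have h1 : 0 < bary w (l + 2) y by near: y; exact: near_bary_gt0.
have h2 : 0 < bary w (l + 1) y by near: y; exact: near_bary_gt0.
have h3 : 0 < bary v (k + 2) y by near: y; exact: near_bary_gt0.
have h4 : 0 < bary v (k + 1) y by near: y; exact: near_bary_gt0.
have [h|h] := leP 0 (bary v k y).
  by left; apply/triangleP => // j; have [] := ord3_shiftP k j => ->; rewrite ?(ltW h3) ?(ltW h4).
right; apply/triangleP => // j; have [] := ord3_shiftP l j => ->; rewrite ?(ltW h1) ?(ltW h2) //.
by rewrite (share_bary _ Dv Dw s) mulr_le0 // ltW // share_opposite.
Unshelve. all: by end_near.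
Qed.

End bary_theory.

(** * Bernstein form of polynomials *)

Section polynomials.
Context {R : realType}.
Implicit Types (p q : plane R -> R) (v : 'I_3 -> plane R).

Lemma Pd_add d p q : Pd d p -> Pd d q -> Pd d (fun x => p x + q x).
Proof.
move=> [c pE] [c' qE]; exists (fun i j => c i j + c' i j) => x.
rewrite pE qE -big_split; apply: eq_bigr => i _; rewrite -big_split.
by apply: eq_bigr => j _; rewrite !mulrDl.
Qed.

Lemma Pd_scale d (a : R) p : Pd d p -> Pd d (fun x => a * p x).
Proof.
move=> [c pE]; exists (fun i j => a * c i j) => x.
rewrite pE mulr_sumr; apply: eq_bigr => i _; rewrite mulr_sumr.
by apply: eq_bigr => j _; rewrite !mulrA.
Qed.

Lemma Pd_sum d (I : Type) (s : seq I) (P : pred I) (F : I -> plane R -> R) :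
  (forall i, P i -> Pd d (F i)) -> Pd d (fun x => \sum_(i <- s | P i) F i x).
Proof.
move=> PF; elim: s => [|i s IH].
  exists (fun _ _ => 0) => x; rewrite big_nil; symmetry.
  by apply: big1 => i _; apply: big1 => j _; rewrite !mul0r.
under eq_fun do rewrite big_cons; have [Pi|//] := boolP (P i).
by apply: Pd_add => //; exact: PF.
Qed.

Lemma Pd_monomial d i j : (i + j <= d)%N -> Pd d (fun x : plane R => x.1 ^+ i * x.2 ^+ j).
Proof.
move=> ijd; have id1 : (i < d.+1)%N by lia.
have jd1 : (j < d.+1)%N by lia.
exists (fun a b => ((a == i) && (b == j))%:R) => x.
rewrite (bigD1 (Ordinal id1)) //= (bigD1 (Ordinal jd1)) //= !eqxx mul1r.
rewrite big1 ?addr0; last first.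
  by move=> b /andP[_]; rewrite -val_eqE /= => /negbTE ->; rewrite !mul0r.
rewrite big1 ?addr0 // => a; rewrite -val_eqE /= => /negbTE ai.
by rewrite big1 // => b _; rewrite ai !mul0r.
Qed.

Lemma Pd_mul d e p q : Pd d p -> Pd e q -> Pd (d + e) (fun x => p x * q x).
Proof.
move=> [c pE] [c' qE].
rewrite (_ : (fun x => _) = fun x => \sum_(i < d.+1) \sum_(j < d.+1 | (i + j <= d)%N)
  \sum_(i' < e.+1) \sum_(j' < e.+1 | (i' + j' <= e)%N)
    c i j * c' i' j' * (x.1 ^+ (i + i') * x.2 ^+ (j + j'))).
  apply: Pd_sum => i _; apply: Pd_sum => j ij; apply: Pd_sum => i' _; apply: Pd_sum => j' ij'.
  by apply: Pd_scale; apply: Pd_monomial; lia.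
apply/funext => x; rewrite pE qE mulr_suml; apply: eq_bigr => i _.
rewrite mulr_suml; apply: eq_bigr => j _; rewrite mulr_sumr; apply: eq_bigr => i' _.
rewrite mulr_sumr; apply: eq_bigr => j' _; rewrite !exprD; ring.
Qed.

Lemma Pd_cst d (a : R) : Pd d (fun=> a).
Proof.
have := Pd_scale a (@Pd_monomial d 0 0 (leq0n _)).
by under eq_fun do rewrite !expr0 !mulr1.
Qed.

Lemma Pd_widen d e p : (d <= e)%N -> Pd d p -> Pd e p.
Proof.
move=> de Pp; rewrite -(subnKC de); have := Pd_mul Pp (Pd_cst (e - d) 1).
by under eq_fun do rewrite mulr1.
Qed.

Lemma Pd_exp d p n : Pd d p -> Pd (n * d) (fun x => p x ^+ n).
Proof.
move=> Pp; elim: n => [|n IH]; first exact: Pd_cst.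
by under eq_fun do rewrite exprS; rewrite mulSn; exact: Pd_mul.
Qed.

Lemma Pd_bary v k : Pd 1 (bary v k).
Proof.
pose a := v (k + 1); pose b := v (k + 2); pose D := area2 (v k) a b.
rewrite (_ : bary v k = fun x => (a.1 * b.2 - a.2 * b.1) / D
  + (((a.2 - b.2) / D) * (x.1 ^+ 1 * x.2 ^+ 0) + ((b.1 - a.1) / D) * (x.1 ^+ 0 * x.2 ^+ 1))).
  apply: Pd_add; first exact: Pd_cst.
  by apply: Pd_add; apply: Pd_scale; exact: Pd_monomial.
by apply/funext => x; rewrite /bary -/a -/b -/D {1}/area2 !expr0 !expr1; ring.
Qed.

Lemma prod3 (F : 'I_3 -> R) : \prod_k F k = F 0 * F 1 * F 2.
Proof.
rewrite !big_ord_recl big_ord0 mulr1 mulrA.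
by congr (F _ * F _ * F _); exact: val_inj.
Qed.

Lemma Pd_piece N d (tri : 'I_N -> 'I_3 -> plane R) (s : Sm1 R N d) T : Pd d (piece tri s T).
Proof.
apply: Pd_sum => alpha _; apply: Pd_scale; apply: Pd_scale.
under eq_fun do rewrite prod3.
have := eqP (valP alpha); rewrite sum3 => /eq_leq le_d; apply: Pd_widen le_d _.
have B k n : Pd n (fun x => bary (tri T) k x ^+ n).
  by rewrite -[X in Pd X _]muln1; apply: Pd_exp; exact: Pd_bary.
by apply: Pd_mul; [apply: Pd_mul|]; exact: B.
Qed.

Definition bspan v d p := exists c : bindex d -> R,
  forall x, p x = \sum_(alpha : bindex d) c alpha * bernstein v alpha x.

Lemma bspan_add v d p q : bspan v d p -> bspan v d q -> bspan v d (fun x => p x + q x).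
Proof.
move=> [c pE] [c' qE]; exists (fun i => c i + c' i) => x.
by rewrite pE qE -big_split; apply: eq_bigr => i _; rewrite mulrDl.
Qed.

Lemma bspan_scale v d (a : R) p : bspan v d p -> bspan v d (fun x => a * p x).
Proof.
move=> [c pE]; exists (fun i => a * c i) => x.
by rewrite pE mulr_sumr; apply: eq_bigr => i _; rewrite !mulrA.
Qed.

Lemma bspan_sum v d (I : Type) (s : seq I) (P : pred I) (F : I -> plane R -> R) :
  (forall i, P i -> bspan v d (F i)) -> bspan v d (fun x => \sum_(i <- s | P i) F i x).
Proof.
move=> PF; elim: s => [|i s IH].
  exists (fun _ => 0) => x; rewrite big_nil; symmetry.
  by apply: big1 => i _; rewrite mul0r.
under eq_fun do rewrite big_cons; have [Pi|//] := boolP (P i).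
by apply: bspan_add => //; exact: PF.
Qed.

Lemma bspan_monomial v d (b : 'I_3 -> nat) : (\sum_k b k = d)%N ->
  bspan v d (fun x => \prod_k bary v k x ^+ b k).
Proof.
move=> bd; pose f : {ffun 'I_3 -> 'I_d.+1} := [ffun k => inord (b k)].
have fE k : f k = b k :> nat.
  by rewrite ffunE inordK // ltnS -bd (bigD1 k) //= leq_addr.
have fd : (\sum_k f k == d)%N by apply/eqP; rewrite -[RHS]bd; apply: eq_bigr => k _.
pose al : bindex d := exist _ f fd.
pose C : R := d`!%:R / (\prod_k (f k)`!)%:R.
have C0 : C != 0.
  rewrite mulf_neq0 ?invr_eq0 // pnatr_eq0 -lt0n ?fact_gt0 //.
  by rewrite prodn_gt0 // => k; rewrite fact_gt0.
exists (fun a => if a == al then C^-1 else 0) => x.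
rewrite (bigD1 al) //= eqxx [X in _ + X]big1 ?addr0; last by move=> a /negbTE ->; rewrite mul0r.
rewrite /bernstein /= -/C mulKf //; apply: eq_bigr => k _.
by rewrite fE.
Qed.

Lemma bspan_bary v d k p : bspan v d p -> bspan v d.+1 (fun x => bary v k x * p x).
Proof.
move=> [c pE]; rewrite (_ : (fun x => _) = fun x => \sum_(al : bindex d)
    c al * (d`!%:R / (\prod_k (val al k)`!)%:R * \prod_j bary v j x ^+ ((j == k) + val al j)%N)).
  apply: bspan_sum => al _; do 2 apply: bspan_scale; apply: bspan_monomial.
  rewrite big_split /= (eqP (valP al)) (bigD1 k) //= eqxx big1 ?addn0 // => j /negbTE ->.
  by [].
apply/funext => x; rewrite pE mulr_sumr; apply: eq_bigr => al _.
rewrite /bernstein mulrCA; congr (_ * _); rewrite mulrCA; congr (_ * _).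
rewrite [RHS](eq_bigr (fun j => bary v j x ^+ (j == k) * bary v j x ^+ val al j)); last first.
  by move=> j _; rewrite exprD.
rewrite big_split /= [X in _ = X * _](bigD1 k) //= eqxx expr1 [X in _ = _ * X * _]big1 ?mulr1 // => j /negbTE ->.
by rewrite expr0.
Qed.

Lemma bspan_linear v d (z : 'I_3 -> R) p : bspan v d p ->
  bspan v d.+1 (fun x => (\sum_k bary v k x * z k) * p x).
Proof.
move=> bp; under eq_fun do rewrite mulr_suml.
apply: bspan_sum => k _; under eq_fun do rewrite mulrAC mulrC.
by apply: bspan_scale; exact: bspan_bary.
Qed.

Lemma bspan_linearX v d n (z : 'I_3 -> R) p : bspan v d p ->
  bspan v (n + d) (fun x => (\sum_k bary v k x * z k) ^+ n * p x).
Proof.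
move=> bp; elim: n => [|n IH]; first by under eq_fun do rewrite expr0 mul1r.
by under eq_fun do rewrite exprS -mulrA; exact: bspan_linear.
Qed.

(** Homogenisation: both Cartesian coordinates are linear in the barycentric ones, and the missing
    degree is supplied by a power of their sum, which is 1. *)
Lemma Pd_bspan v d p : nondegenerate v -> Pd d p -> bspan v d p.
Proof.
move=> D0 [c pE]; rewrite (_ : p = fun x => \sum_(i < d.+1)
    \sum_(j < d.+1 | (i + j <= d)%N) c i j * (x.1 ^+ i * x.2 ^+ j)); last first.
  by apply/funext => x; rewrite pE; apply: eq_bigr => i _; apply: eq_bigr => j _; rewrite mulrA.
apply: bspan_sum => i _; apply: bspan_sum => j ij; apply: bspan_scale.
rewrite (_ : (fun x => _) = fun x => (\sum_k bary v k x * (v k).1) ^+ i *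
  ((\sum_k bary v k x * (v k).2) ^+ j *
   ((\sum_k bary v k x * 1) ^+ (d - (i + j)) * \prod_k bary v k x ^+ 0))).
  rewrite -[X in bspan _ X](subnKC ij) -addnA.
  apply: bspan_linearX; apply: bspan_linearX; rewrite -[X in bspan _ X]addn0.
  by apply: bspan_linearX; apply: bspan_monomial; rewrite big1.
apply/funext => x; have [e1 e2 e3] := bary_sum x D0; rewrite e2 e3.
under [X in _ * (_ * (X ^+ _ * _))]eq_bigr do rewrite mulr1.
by rewrite e1 expr1n [X in _ * (_ * (_ * X))]big1 ?mulr1 // => k _; rewrite expr0.
Qed.

End polynomials.

(** * Piecewise defined functions on the triangulation *)

Section null_sets.
Context {R : realType}.
Notation mu := (@lebesgue_measure R).
Notation M2 := (measurableTypeR R * measurableTypeR R)%type.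
Notation mu2 := (@leb2 R).
Implicit Types (a b x : plane R) (v w : 'I_3 -> plane R).

Definition line a b : set (plane R) := [set x | area2 x a b = 0].

Lemma area2_continuous a b : continuous (fun x : plane R => area2 x a b).
Proof.
move=> x; rewrite /area2.
by apply: cvgB; apply: cvgM; apply: cvgB; by [exact: cvg_cst|exact: cvg_fst|exact: cvg_snd].
Qed.

Lemma line_measurable a b : @measurable _ M2 (line a b).
Proof.
apply: closed_measurable_plane.
have -> : line a b = (fun x => area2 x a b) @^-1` [set 0] by [].
by apply: preimage_closed; [apply: in1W; exact: area2_continuous|exact: closed_eq].
Qed.

Lemma leb2_vertical (c : R) : mu2 ([set c] `*` setT) = 0%E.
Proof.
have -> : mu2 ([set c] `*` setT) = (mu [set c] * mu setT)%E.
  by apply: product_measure1E => //; exact: measurable_set1.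
by rewrite lebesgue_measure_set1 mul0e.
Qed.

Lemma line_null a b : a != b -> mu2 (line a b) = 0%E.
Proof.
move=> ab; have [e|ne] := eqVneq a.1 b.1.
  have ab2 : a.2 != b.2.
    by apply: contra ab => /eqP e2; case: a b e e2 => ? ? [? ?] /= -> ->.
  apply/eqP; rewrite eq_le measure_ge0 andbT -(leb2_vertical a.1).
  apply: le_measure; rewrite ?inE.
  - exact: line_measurable.
  - by apply: measurableX => //; exact: measurable_set1.
  move=> x; rewrite /line /area2 /= -e => H; split => //=.
  have : (a.1 - x.1) * (b.2 - a.2) = 0 by rewrite -H; ring.
  by move/eqP; rewrite mulf_eq0 !subr_eq0 [b.2 == _]eq_sym (negbTE ab2) orbF => /eqP.
rewrite -[LHS]/(\int[mu]_x (mu (xsection (line a b) x)))%E.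
rewrite integral0_eq // => x _.
pose y := a.2 + (x - a.1) / (b.1 - a.1) * (b.2 - a.2).
have ba : b.1 - a.1 != 0 by rewrite subr_eq0 eq_sym.
have -> : xsection (line a b) x = [set y].
  apply/seteqP; split => z; rewrite /xsection /= inE /line /area2 /=.
    move=> H; have : (z - y) * (b.1 - a.1) = 0.
      by rewrite -[RHS]H /y; field.
    by move/eqP; rewrite mulf_eq0 (negbTE ba) orbF subr_eq0 => /eqP.
  by move=> ->; rewrite /y; field.
exact: lebesgue_measure_set1.
Qed.

Lemma line_negligible a b : a != b -> mu2.-negligible (line a b).
Proof. by move=> ab; apply/negligibleP; [exact: line_measurable|exact: line_null]. Qed.

Lemma meet_negligible v w : meet_properly v w -> mu2.-negligible (triangle v `&` triangle w).
Proof.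
have sub a b (S : set (plane R)) : a != b -> S `<=` line a b -> mu2.-negligible S.
  by move=> /line_negligible ab Sab; exact: negligibleS ab.
case=> [->|[a _ ->]|[a [b [[ab _ _] ->]]]].
- exact: negligible_set0.
(* A single point is null because it lies on a line; the second point of that line is arbitrary. *)
- apply: (sub a (a.1 + 1, a.2)).
    by apply/eqP; case: a => a1 a2 /= [] /eqP; rewrite -subr_eq0 opprD addNKr oppr_eq0 oner_eq0.
  by move=> _ ->; rewrite /line /area2 /=; ring.
- by apply: (sub a b) => // _ [t _ <-]; rewrite /line /area2 /line_point /=; ring.
Qed.

Lemma bary0_negligible v k : nondegenerate v -> mu2.-negligible [set x | bary v k x = 0].
Proof.
move=> D0; apply: negligibleS (line_negligible (a := v (k + 1)) (b := v (k + 2)) _).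
  move=> x /= /eqP; rewrite /bary mulf_eq0 invr_eq0 area2_shift (negbTE D0) orbF => /eqP.
  by [].
by apply/eqP => /(nondegenerate_inj D0) /eqP; rewrite ord3_neq.
Qed.

End null_sets.

Lemma Rintegral_sum d (T : measurableType d) (R : realType) (mu : {measure set T -> \bar R})
    (D : set T) (I : Type) (s : seq I) (F : I -> T -> R) : measurable D ->
  (forall i, mu.-integrable D (EFin \o F i)) ->
  \int[mu]_(x in D) (\sum_(i <- s) F i x) = \sum_(i <- s) \int[mu]_(x in D) F i x.
Proof.
move=> mD iF; have iS s' : mu.-integrable D (EFin \o (fun x => \sum_(i <- s') F i x)).
  have := @integrable_sum _ _ _ mu D mD _ s' xpredT (fun i => EFin \o F i) (fun i _ => iF i).
  by apply: eq_integrable => // x _ /=; rewrite sumEFin.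
elim: s => [|i s IH].
  under eq_Rintegral do rewrite big_nil.
  by rewrite big_nil Rintegral_cst // mul0r.
under eq_Rintegral do rewrite big_cons.
rewrite big_cons -IH; exact: (RintegralD mD (iF i) (iS s)).
Qed.

Section almost_everywhere.
Context {R : realType}.
Notation mu2 := (@leb2 R).

Lemma aeS (P Q : plane R -> Prop) : (forall x, P x -> Q x) ->
  (\forall x \ae mu2, P x) -> \forall x \ae mu2, Q x.
Proof. by move=> PQ; apply: negligibleS => x /= nQ Px; apply: nQ; exact: PQ. Qed.

Lemma aeI (P Q : plane R -> Prop) : (\forall x \ae mu2, P x) ->
  (\forall x \ae mu2, Q x) -> \forall x \ae mu2, P x /\ Q x.
Proof.
move=> p q; apply: negligibleS (negligibleU p q) => x /= nPQ.
by apply: contrapT => /not_orP[/contrapT ? /contrapT ?]; apply: nPQ.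
Qed.

End almost_everywhere.

Section paste.
Context {R : realType} (Omega : set (plane R)) (N : nat) (tri : 'I_N -> 'I_3 -> plane R).
Context (hO : domain Omega) (htri : triangulation Omega tri).
Notation M2 := (measurableTypeR R * measurableTypeR R)%type.
Notation mu2 := (@leb2 R).

Lemma tri_nondegenerate T : nondegenerate (tri T).
Proof. by case: htri. Qed.

Lemma tri_meet T T' : T != T' -> meet_properly (tri T) (tri T').
Proof. by case: htri => _ H _ _; exact: H. Qed.

Lemma Omega_measurable : @measurable _ M2 Omega.
Proof. by case: hO => _ oO _; exact: open_measurable_plane. Qed.

Lemma triangle_measurable T : @measurable _ M2 (triangle (tri T)).
Proof. exact: (closed_measurable_plane (triangle_closed (tri_nondegenerate T))). Qed.

Lemma Omega_covered x : Omega x -> exists T, triangle (tri T) x.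
Proof.
by case: htri => _ _ _ -> /interior_subset [T _ Tx]; exists T.
Qed.

Lemma Omega_near (x : plane R) : (\forall y \near x, exists T, triangle (tri T) y) -> Omega x.
Proof.
case: htri => _ _ _ -> H; rewrite /interior; apply: filterS H => y [T Ty].
by exists T.
Qed.

Lemma Omega_inner T x : (forall k, 0 < bary (tri T) k x) -> Omega x.
Proof.
move=> b0; apply: Omega_near; near=> y; exists T.
apply/triangleP; first exact: tri_nondegenerate.
have H : forall k, 0 < bary (tri T) k y.
  near: y; apply: filter_forall => k; exact: near_bary_gt0.
by move=> k; rewrite ltW.
Unshelve. all: by end_near.
Qed.

Lemma Omega_box : exists m : R, Omega `<=` box m.
Proof.
exists (\sum_T \sum_k (`|(tri T k).1| + `|(tri T k).2|)) => x /Omega_covered[T].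
have le_m : \sum_k (`|(tri T k).1| + `|(tri T k).2|) <=
    \sum_T \sum_k (`|(tri T k).1| + `|(tri T k).2|).
  rewrite [leRHS](bigD1 T) //= lerDl sumr_ge0 // => T' _.
  by rewrite sumr_ge0 // => k _; rewrite addr_ge0.
move/triangle_box; rewrite /box /= !in_itv /=.
move: (\sum_k _) (\sum_T _) le_m => a b ab [/andP[? ?] /andP[? ?]].
by split; apply/andP; split; lra.
Qed.

(** A point with positive coordinates is interior to its triangle, hence in [Omega]. Only points on
    the three side lines remain. *)
Lemma tri_outside_negligible T : mu2.-negligible (triangle (tri T) `\` Omega).
Proof.
have D0 := tri_nondegenerate T.
have A : mu2.-negligible ([set x | bary (tri T) 0 x = 0] `|`
  [set x | bary (tri T) 1 x = 0] `|` [set x | bary (tri T) 2 x = 0]).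
  by apply: negligibleU; [apply: negligibleU|]; exact: bary0_negligible.
apply: negligibleS A => x [/triangleP-/(_ D0) b0 nO].
apply: contrapT => /not_orP[/not_orP[n0 n1] n2].
apply: nO; apply: (@Omega_inner T) => k; rewrite lt0r b0 andbT.
by apply/eqP; case: (ord3P k) => ->.
Qed.

Lemma ae_unique_triangle :
  \forall x \ae mu2, forall T T', T != T' -> ~ (triangle (tri T) `&` triangle (tri T')) x.
Proof.
apply: filter_forall => T; apply: filter_forall => T'.
have [->|TT'] := eqVneq T T'; first by apply: aeW.
apply: negligibleS (meet_negligible (tri_meet TT')) => x /= /not_implyP[_].
by move/contrapT.
Qed.

(** On overlaps the contributions add up, which is harmless: there are no overlaps outside a null
    set, and [paste] is compared with other functions only almost everywhere. *)
Definition paste (hT : 'I_N -> plane R -> R) (x : plane R) : R :=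
  \sum_T (hT T \_ (triangle (tri T))) x.

Lemma pasteE hT T x : triangle (tri T) x ->
  (forall T', T != T' -> ~ (triangle (tri T) `&` triangle (tri T')) x) ->
  paste hT x = hT T x.
Proof.
move=> Tx H; rewrite /paste (bigD1 T) //= patchE mem_set // big1 ?addr0 // => T' T'T.
by rewrite patchE memNset // => T'x; apply: (H T'); rewrite 1?eq_sym.
Qed.

Lemma paste_ae T hT : hT T = paste hT %[ae mu2 in triangle (tri T)].
Proof.
apply: (aeS _ ae_unique_triangle) => x H Tx; rewrite (pasteE _ Tx) // => T'.
exact: H.
Qed.

Lemma ae_paste h hT : (forall T, h = hT T %[ae mu2 in triangle (tri T)]) ->
  h = paste hT %[ae mu2 in Omega].
Proof.
move=> hE.
have A : \forall x \ae mu2, forall T, triangle (tri T) x -> h x = hT T x.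
  by apply: filter_forall => T; exact: hE.
apply: (aeS _ (aeI A ae_unique_triangle)) => x [hx ux] /Omega_covered[T Tx].
by rewrite (hx T Tx) (pasteE _ Tx) // => T'; exact: ux.
Qed.

Lemma restrict_integrable (f : plane R -> R) T : continuous f ->
  mu2.-integrable setT (EFin \o (f \_ (triangle (tri T)))).
Proof.
move=> cf; rewrite -restrict_EFin; apply/(integrable_mkcond _ (triangle_measurable T)).
exact: (integrable_triangle (tri_nondegenerate T)).
Qed.

Lemma paste_integrable hT (D : set (plane R)) : @measurable _ M2 D ->
  (forall T, continuous (hT T)) -> mu2.-integrable D (EFin \o paste hT).
Proof.
move=> mD chT; apply: (@integrableS _ _ _ mu2 setT) => //.
have := @integrable_sum _ _ _ mu2 setT measurableT _ (index_enum 'I_N) xpredT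
  (fun T => EFin \o (hT T \_ (triangle (tri T)))) (fun T _ => @restrict_integrable (hT T) T (chT T)).
apply: eq_integrable => // x _ /=.
by rewrite sumEFin.
Qed.

Lemma ae_eq_integrable (D : set (plane R)) (f g : plane R -> R) : @measurable _ M2 D ->
  @measurable_fun _ _ M2 R D f -> f = g %[ae mu2 in D] ->
  mu2.-integrable D (EFin \o g) -> mu2.-integrable D (EFin \o f).
Proof.
move=> mD mf fg /integrableP[mg ig]; apply/integrableP; split; first exact/measurable_EFinP.
rewrite (@ge0_ae_eq_integral _ _ _ mu2 _ _ (fun x => `|(EFin \o g) x|%E)) //.
- by apply: measurableT_comp => //; exact/measurable_EFinP.
- by apply: measurableT_comp.
by apply: (aeS _ fg) => x fgx Dx /=; rewrite fgx.
Qed.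

Lemma pasted_integrable h hT : @measurable_fun _ _ M2 R Omega h ->
  (forall T, continuous (hT T)) -> (forall T, h = hT T %[ae mu2 in triangle (tri T)]) ->
  mu2.-integrable Omega (EFin \o h).
Proof.
move=> mh chT hE; apply: ae_eq_integrable (ae_paste hE) _ => //.
  exact: Omega_measurable.
by apply: paste_integrable => //; exact: Omega_measurable.
Qed.

(** The overlaps of the triangles and their parts outside [Omega] are null sets, so integration over
    [Omega] can be carried out triangle by triangle. *)
Lemma integral_Omega h hT : @measurable_fun _ _ M2 R Omega h ->
  (forall T, continuous (hT T)) -> (forall T, h = hT T %[ae mu2 in triangle (tri T)]) ->
  \int[mu2]_(x in Omega) h x = \sum_T \int[mu2]_(x in triangle (tri T)) hT T x.
Proof.
move=> mh chT hE; have mO := Omega_measurable.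
have iG := paste_integrable mO chT.
transitivity (\int[mu2]_(x in Omega) paste hT x).
  rewrite /Rintegral; congr fine; apply: ae_eq_integral => //.
  - exact/measurable_EFinP.
  - exact: measurable_int iG.
  - by apply: (aeS _ (ae_paste hE)) => x H Ox /=; rewrite H.
have iT T : mu2.-integrable Omega (EFin \o (hT T \_ (triangle (tri T)))).
  by apply: (@integrableS _ _ _ mu2 setT) => //; exact: restrict_integrable.
have -> : \int[mu2]_(x in Omega) paste hT x =
    \sum_T \int[mu2]_(x in Omega) (hT T \_ (triangle (tri T))) x.
  exact: Rintegral_sum.
apply: eq_bigr => T _; rewrite -Rintegral_mkcondr.
have mT := triangle_measurable T.
rewrite setIC /Rintegral; congr fine.
rewrite [RHS](@negligible_integral _ _ _ mu2 _ (triangle (tri T) `\` Omega)) ?setDD //.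
- exact: measurableD.
- exact: (integrable_triangle (tri_nondegenerate T)).
- apply/negligibleP; first exact: measurableD.
  exact: tri_outside_negligible.
Qed.

End paste.

(** * Square integrable functions and concentrating test functions *)

Section L2_theory.
Context {R : realType} (Omega : set (plane R)).
Notation M2 := (measurableTypeR R * measurableTypeR R)%type.
Notation mu2 := (@leb2 R).
Context (mO : @measurable _ M2 Omega).

Lemma L2P (u : plane R -> R) : L2 Omega u <->
  @measurable_fun _ _ M2 R Omega u /\ mu2.-integrable Omega (EFin \o (fun x => u x ^+ 2)).
Proof.
have sqE : EFin \o (fun x => (u \_ Omega) x ^+ 2) = (EFin \o (fun x => u x ^+ 2)) \_ Omega.
  by apply/funext => x /=; rewrite !patchE; case: ifP => // _; rewrite expr0n.
split.
  move=> h; have iu := Lfun2_integrable_sqr h; split.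
    move: h; rewrite /L2 /= inE => /andP[]; rewrite inE /= => mu' _.
    by apply/(measurable_restrictT _ mO).
  by apply/(integrable_mkcond _ mO); rewrite -sqE.
move=> [mu' iu]; rewrite /L2 /= inE; apply/andP; split; rewrite inE /=.
  by apply/(measurable_restrictT _ mO).
rewrite /finite_norm unlock; apply: poweR_lty.
move/(integrable_mkcond _ mO) : iu; rewrite -sqE => /integrableP[_].
congr (_ < _)%E; apply: eq_integral => x _ /=.
by rewrite normrX powR_mulrn.
Qed.

Context (m : R) (bO : Omega `<=` box m).

Lemma cst_integrable (c : R) : mu2.-integrable Omega (EFin \o (fun=> c)).
Proof. by apply: (integrable_bounded_plane mO bO) => x; exact: cvg_cst. Qed.

(** [|u| <= 1 + u ^+ 2], and constants are integrable on the bounded set [Omega]. *)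
Lemma L2_integrable (u : plane R -> R) : L2 Omega u -> mu2.-integrable Omega (EFin \o u).
Proof.
move=> /L2P[mu' iu].
have i1 := integrableD mO (cst_integrable 1) iu.
apply: (le_integrable mO _ _ i1); first exact/measurable_EFinP.
move=> x _ /=; rewrite lee_fin [leRHS]ger0_norm ?addr_ge0 ?sqr_ge0 //.
have [h|h] := leP `|u x| 1; first by rewrite (le_trans h) // lerDl sqr_ge0.
rewrite -[u x ^+ 2]real_normK ?num_real // expr2 ler_wpDl //.
by rewrite ler_peMr // ltW.
Qed.

Lemma integrable_mul_continuous (g phi : plane R -> R) : continuous phi ->
  mu2.-integrable Omega (EFin \o g) -> mu2.-integrable Omega (EFin \o (fun x => g x * phi x)).
Proof.
move=> cphi ig; have [M [_ HM]] := continuous_bounded_box m cphi.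
have HM' x : Omega x -> `|phi x| <= `|M| + 1.
  by move=> Ox; apply: HM; [rewrite (le_lt_trans (ler_norm _)) // ltrDl|exact: bO].
have mg : @measurable_fun _ _ M2 R Omega g by apply/measurable_EFinP; exact: measurable_int ig.
have := integrableZl mO (`|M| + 1) ig; apply: (le_integrable mO).
  apply/measurable_EFinP; apply: measurable_funM => //.
  exact: measurable_funS (continuous_measurable_plane cphi).
move=> x Ox /=; rewrite lee_fin !normrM mulrC ler_wpM2r //.
by rewrite [leRHS]ger0_norm ?addr_ge0 // HM'.
Qed.

(** The integrands tend to 0 off [S] and are dominated by [|g psi|]. Dominated convergence then
    forces the constant sequence of their integrals to converge to 0. *)
Lemma concentrating_integral (g psi : plane R -> R) (th : nat -> plane R -> R) (S : set (plane R))
    (c : R) :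
  mu2.-integrable Omega (EFin \o g) -> continuous psi ->
  (forall n, continuous (th n)) -> (forall n x, 0 <= th n x <= 1) ->
  mu2.-negligible S -> (forall x, ~ S x -> \forall n \near \oo, th n x = 0) ->
  (forall n, \int[mu2]_(x in Omega) (g x * (psi x * th n x)) = c) -> c = 0.
Proof.
move=> ig cpsi cth th01 nS thS Ec.
have igp := integrable_mul_continuous cpsi ig.
have cpt n : continuous (fun x => psi x * th n x).
  by move=> x; apply: cvgM; [exact: cpsi|exact: cth].
have ign n := integrable_mul_continuous (cpt n) ig.
have P1 : {ae mu2, forall x, Omega x ->
    (fun n => (g x * (psi x * th n x))%:E) @ \oo --> (cst 0%E : M2 -> \bar R) x}.
  apply: negligibleS nS => x /= /not_implyP[Ox nx]; apply: contrapT => nSx; apply: nx.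
  apply: cvg_near_cst; apply: filterS (thS x nSx) => n ->.
  by rewrite !mulr0.
have P2 : mu2.-integrable Omega (fun x => `|(g x * psi x)%:E|%E).
  by have := integrable_abse igp.
have P3 : {ae mu2, forall x n, Omega x ->
    (`|(g x * (psi x * th n x))%:E| <= `|(g x * psi x)%:E|)%E}.
  apply: aeW => x n Ox; rewrite /= lee_fin mulrA normrM ler_piMr //.
  by have /andP[h0 h1] := th01 n x; rewrite ger0_norm.
have [_ _] := dominated_convergence mO (fun n => measurable_int mu2 (ign n))
  (@measurable_cst _ _ M2 _ Omega 0%E) P1 P2 P3.
rewrite integral0 => H.
have E n : (\int[mu2]_(x in Omega) (g x * (psi x * th n x))%:E)%E = c%:E.
  by rewrite -(Ec n) /Rintegral fineK //; exact: integrable_fin_num (ign n).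
have {}H : (fun n : nat => c%:E) @ \oo --> 0%E.
  have <- : (fun n => (\int[mu2]_(x in Omega) (g x * (psi x * th n x))%:E)%E) = (fun=> c%:E).
    by apply/funext => n; exact: E.
  exact: H.
have e : 0%E = c%:E := cvg_unique (@ereal_hausdorff R) H (cvg_cst (c%:E : \bar R)).
by apply/eqP; rewrite -eqe -e.
Qed.

End L2_theory.

(** * Weak divergence and normal jumps *)

Section edge_integral2.
Context {R : realType}.
Notation mu := (@lebesgue_measure R).
Implicit Types (a b : plane R) (f g : plane R -> R).

Lemma line_comp_continuous a b f : continuous f -> continuous (f \o line_point a b).
Proof.
by move=> cf t; apply: continuous_comp; [exact: line_point_continuous|exact: cf].
Qed.

(** Agreement is asked on the open edge only, the place where the neighbouring triangles are under
    control. *)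
Lemma eq_eint a b f g : continuous f -> continuous g ->
  (forall t, 0 < t < 1 -> f (line_point a b t) = g (line_point a b t)) ->
  eint a b f = eint a b g.
Proof.
move=> /(@line_comp_continuous a b) cf /(@line_comp_continuous a b) cg fg.
have mc (h : R -> R) : continuous h -> measurable_fun (`]0, 1[%classic : set R) (EFin \o h).
  move=> ch; apply/measurable_EFinP.
  by apply: measurable_funS (continuous_measurable_fun ch) => //.
rewrite /eint /Rintegral; congr fine.
rewrite (@integral_itv_bndoo R 0 1 (EFin \o (f \o line_point a b)) true false (mc _ cf)).
rewrite (@integral_itv_bndoo R 0 1 (EFin \o (g \o line_point a b)) true false (mc _ cg)).
by apply: eq_integral => t; rewrite inE /= in_itv /= => t01; rewrite fg.
Qed.

Lemma eint0 a b : eint a b (fun=> 0) = 0.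
Proof. by rewrite /eint Rintegral_cst // mul0r. Qed.

Lemma eintD a b f g : continuous f -> continuous g ->
  eint a b (fun x => f x + g x) = eint a b f + eint a b g.
Proof.
move=> /(@line_comp_continuous a b) cf /(@line_comp_continuous a b) cg.
have mI : @measurable _ (measurableTypeR R) `[0, 1]%classic by exact: measurable_itv.
exact: (@RintegralD _ _ _ mu _ (f \o line_point a b) (g \o line_point a b) mI (@continuous_itv_integrable _ _ 0 1 cf)
  (@continuous_itv_integrable _ _ 0 1 cg)).
Qed.

Lemma eintZ a b f c : continuous f -> eint a b (fun x => c * f x) = c * eint a b f.
Proof.
move=> /(@line_comp_continuous a b) cf.
have mI : @measurable _ (measurableTypeR R) `[0, 1]%classic by exact: measurable_itv.
exact: (@RintegralZl _ _ _ mu _ (f \o line_point a b) c mI (@continuous_itv_integrable _ _ 0 1 cf)).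
Qed.

(** A nonnegative function with zero integral vanishes almost everywhere, whereas a positive value
    at [t] would persist on an interval of positive length. *)
Lemma eint_eq0 a b f t : continuous f -> (forall x, 0 <= f x) -> eint a b f = 0 ->
  0 < t < 1 -> f (line_point a b t) = 0.
Proof.
move=> cf f0 E t01; apply/eqP; rewrite eq_le f0 andbT leNgt; apply/negP => ft.
pose h := f \o line_point a b.
have ch : continuous h by exact: line_comp_continuous.
have ih := @continuous_itv_integrable _ h 0 1 ch.
have mI : measurable (`[0, 1]%classic : set R) by exact: measurable_itv.
have E0 : (\int[mu]_(x in `[0%R, 1%R]) `|(EFin \o h) x| = 0)%E.
  transitivity (\int[mu]_(x in `[0%R, 1%R]) (EFin \o h) x)%E.
    by apply: eq_integral => x _ /=; rewrite ger0_norm // f0.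
  by rewrite -[LHS]fineK; [congr EFin; exact: E|exact: integrable_fin_num ih].
move/(ae_eq_integral_abs mu mI (measurable_int mu ih)) : E0 => Z.
have : \forall s \near t, 0 < h s by exact: (cvgr_gt (h t) (ch t)).
move=> [e /= e0 He].
have [t0 t1] := andP t01.
pose d := Num.min e (Num.min t (1 - t)).
have d0 : 0 < d by rewrite !lt_min e0 t0 subr_gt0.
have : mu.-negligible (`]t - d, t + d[%classic : set R).
  apply: negligibleS Z => s /=; rewrite in_itv /= => /andP[s1 s2] H.
  have de : d <= e by rewrite ge_min lexx.
  have dt : d <= t by rewrite !ge_min lexx orbT.
  have dt1 : d <= 1 - t by rewrite !ge_min lexx !orbT.
  have : 0 < h s.
    by apply: He; rewrite /= (lt_le_trans _ de) // ltr_distlC; apply/andP; split; lra.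
  have : (EFin \o h) s = cst 0%E s by apply: H => /=; rewrite in_itv /=; apply/andP; split; lra.
  by move=> [->]; rewrite ltxx.
have mJ : @measurable _ (measurableTypeR R) (`]t - d, t + d[%classic : set R).
  exact: measurable_itv.
move=> /(negligibleP mu mJ).
have := lebesgue_measure_itv `]t - d, t + d[.
rewrite /= lte_fin ltrD2l (lt_trans _ d0) ?oppr_lt0 // => -> /eqP.
by rewrite -EFinB eqe => /eqP; lra.
Qed.

End edge_integral2.

(** * Fluxes through the edges and Green's formula on the domain *)

Section flux.
Context {R : realType} (Omega : set (plane R)) (N : nat) (tri : 'I_N -> 'I_3 -> plane R).
Context (hO : domain Omega) (htri : triangulation Omega tri).
Notation M2 := (measurableTypeR R * measurableTypeR R)%type.
Notation mu2 := (@leb2 R).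
Let D0 := tri_nondegenerate htri.

(** If no other triangle contained [x], none would come near [x]. But a small step across the edge,
    away from the opposite vertex, stays in [Omega] and leaves [T], as its coordinate [k] becomes
    negative. *)
Lemma edge_neighbour T k x : oedge (tri T) k x -> Omega x ->
  exists2 T', T != T' & triangle (tri T') x.
Proof.
move=> ox Ox; apply: contrapT => H.
have open_near (S : set (plane R)) : open S -> S x -> nbhs x S.
  by rewrite openE => h; exact: h.
have nT' : \forall y \near x, forall T', T != T' -> ~ triangle (tri T') y.
  apply: (@filter_forall _ _ _ (nbhs x) (nbhs_filter x)) => T'.
  have [<-|TT'] := eqVneq T T'; first by near=> y.
  have : nbhs x (~` triangle (tri T')).
    apply: open_near; first exact/closed_openC/triangle_closed/D0.
    by move=> Tx; apply: H; exists T'.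
  move=> nx; near=> y => _; near: y; exact: nx.
have oO : open Omega by case: hO.
have nO : \forall y \near x, Omega y by exact: open_near.
have c := @line_point_continuous R x (tri T k) 0.
rewrite /continuous_at line_point0 in c.
have [t t0 [ht Ot]] := near0_neg (filterI (c _ nT') (c _ nO)).
have [T1 T1t] := Omega_covered htri Ot.
have [e|ne] := eqVneq T T1; last exact: (ht T1).
subst T1; move/(triangleP _ (D0 T)): T1t => /(_ k).
rewrite bary_line bary_vertex // eqxx mulr1.
by case: ox => -> _ _; rewrite mulr0 add0r leNgt t0.
Unshelve. all: by end_near.
Qed.

Definition ntrace (P Q : 'I_N -> plane R -> R) T (a b x : plane R) : R :=
  (b.2 - a.2) * P T x - (b.1 - a.1) * Q T x.

(* [ntrace] is the normal component scaled by the length of [ab], which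
   compensates the normalisation of [eint]. *)
Definition flux (P Q : 'I_N -> plane R -> R) (phi : plane R -> R) (z : 'I_N * 'I_3) : R :=
  let a := tri z.1 (z.2 + 1) in let b := tri z.1 (z.2 + 2) in
  Num.sg (area2 (tri z.1 0) (tri z.1 1) (tri z.1 2)) *
    eint a b (fun x => ntrace P Q z.1 a b x * phi x).

Context (P Q : 'I_N -> plane R -> R).
Context (CP : forall T k, Ck k (P T)) (CQ : forall T k, Ck k (Q T)).

Lemma Ck_ntrace T a b k : Ck k (ntrace P Q T a b).
Proof.
apply: CkD; first by apply: CkM; [exact: Ck_cst|exact: CP].
under eq_fun do rewrite -mulNr.
by apply: CkM; [exact: Ck_cst|exact: CQ].
Qed.

Lemma ntrace_phi_continuous T a b phi : continuous phi ->
  continuous (fun x => ntrace P Q T a b x * phi x).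
Proof.
move=> cphi x; apply: cvgM; last exact: cphi.
exact: (Ck_continuous (Ck_ntrace T a b 0)).
Qed.

(** The opposite vertices lie on different sides. If both triangles traverse the edge in the same
    direction, their areas have opposite signs; otherwise the signs agree, but reversing the edge
    negates the trace. Either way the sum of the fluxes is the flux of the jump. *)
Lemma flux_pair T T' k l phi : T != T' -> share (tri T) k (tri T') l -> continuous phi ->
  let a := tri T (k + 1) in let b := tri T (k + 2) in
  flux P Q phi (T, k) + flux P Q phi (T', l) =
  Num.sg (area2 (tri T 0) (tri T 1) (tri T 2)) *
    eint a b (fun x => (ntrace P Q T a b x - ntrace P Q T' a b x) * phi x).
Proof.
move=> TT' s cphi a b.
have m : meet_properly (tri T) (tri T') by exact: (tri_meet htri).
have opp := share_opposite (D0 T) (D0 T') m s.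
have -> : eint a b (fun x => (ntrace P Q T a b x - ntrace P Q T' a b x) * phi x) =
  eint a b (fun x => ntrace P Q T a b x * phi x) - eint a b (fun x => ntrace P Q T' a b x * phi x).
  rewrite -mulN1r -eintZ; last exact: ntrace_phi_continuous.
  rewrite -eintD; last 2 first.
  - exact: ntrace_phi_continuous.
  - by move=> x; apply: cvgM; [exact: cvg_cst|exact: ntrace_phi_continuous].
  by congr (eint _ _ _); apply/funext => x; ring.
rewrite /flux /= -/a -/b -(area2_shift (tri T) k) -(area2_shift (tri T') l) -/a -/b.
rewrite mulrBr; congr (_ + _).
have sg_opp (X Y : R) : X / Y < 0 -> Num.sg Y = - Num.sg X.
  by move/ltr0_sg; rewrite sgrM sgrV; case: (sgrP X); case: (sgrP Y) => *; lra.
move: opp; rewrite /bary; case: s => -[e1 e2]; rewrite e1 e2 -/a -/b.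
  by move/sg_opp => ->; rewrite mulNr.
have -> : area2 (tri T k) b a = - area2 (tri T k) a b by rewrite /area2; ring.
move/sg_opp => ->; rewrite sgrN opprK (eint_swap a b); last first.
  exact: ntrace_phi_continuous.
have -> : (fun x => ntrace P Q T' b a x * phi x) =
    (fun x => (-1) * (ntrace P Q T' a b x * phi x)).
  by apply/funext => x; rewrite /ntrace; ring.
by rewrite eintZ ?mulN1r ?mulrN //; exact: ntrace_phi_continuous.
Qed.

Lemma green_Omega (v1 v2 phi : plane R -> R) :
  @measurable_fun _ _ M2 R Omega v1 -> @measurable_fun _ _ M2 R Omega v2 ->
  (forall T, v1 = P T %[ae mu2 in triangle (tri T)]) ->
  (forall T, v2 = Q T %[ae mu2 in triangle (tri T)]) -> Ck 1 phi ->
  \int[mu2]_(x in Omega) (v1 x * dx phi x + v2 x * dy phi x) =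
  \sum_z flux P Q phi z -
  \int[mu2]_(x in Omega) (paste tri (fun T x => dx (P T) x + dy (Q T) x) x * phi x).
Proof.
move=> m1 m2 e1 e2 Cphi.
have [cphi [dxphi dyphi [cdx _] [cdy _]]] := Cphi.
have mres (f : plane R -> R) : continuous f -> @measurable_fun _ _ M2 R Omega f.
  by move=> cf; exact: measurable_funS (continuous_measurable_plane cf).
have cP T := Ck_continuous (CP T 1); have cQ T := Ck_continuous (CQ T 1).
have cdP T : continuous (dx (P T)) by case: (CP T 1) => _ [_ _ []].
have cdQ T : continuous (dy (Q T)) by case: (CQ T 1) => _ [_ _ _ []].
have cD T : continuous (fun x => dx (P T) x + dy (Q T) x).
  by move=> x; apply: cvgD; [exact: cdP|exact: cdQ].
have iG := paste_integrable htri (Omega_measurable hO) cD.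
have mul_c (f g : plane R -> R) : continuous f -> continuous g -> continuous (fun x => f x * g x).
  by move=> cf cg x; apply: cvgM; [exact: cf|exact: cg].
rewrite (integral_Omega hO htri (hT := fun T x => P T x * dx phi x + Q T x * dy phi x)); last 3 first.
- by apply: measurable_funD; apply: measurable_funM => //; exact: mres.
- move=> T x; apply: cvgD; [exact: (mul_c _ _ (cP T) cdx x)|exact: (mul_c _ _ (cQ T) cdy x)].
- by move=> T; apply: (aeS _ (aeI (e1 T) (e2 T))) => x [h1 h2] Tx; rewrite h1 // h2.
rewrite (integral_Omega hO htri (hT := fun T x => (dx (P T) x + dy (Q T) x) * phi x)); last 3 first.
- apply: measurable_funM; last exact: mres.
  by apply/measurable_EFinP; exact: measurable_int iG.
- by move=> T; exact: mul_c.
- by move=> T; apply: (aeS _ (paste_ae htri T (fun T x => dx (P T) x + dy (Q T) x))) => x h Tx; rewrite -h.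
rewrite -(pair_bigA _ (fun T k => flux P Q phi (T, k))) /= -sumrB; apply: eq_bigr => T _.
have CPphi : Ck 1 (fun x => P T x * phi x) by exact: CkM.
have CQphi : Ck 1 (fun x => Q T x * phi x) by exact: CkM.
have mT := triangle_measurable htri T.
have -> : \sum_k flux P Q phi (T, k) =
    \int[mu2]_(x in triangle (tri T)) (dx (fun x => P T x * phi x) x + dy (fun x => Q T x * phi x) x).
  rewrite green_triangle // mulr_sumr; apply: eq_bigr => k _; rewrite /flux /=; congr (_ * _).
  rewrite -!eintZ; [|exact: mul_c|exact: mul_c].
  rewrite -[X in _ = _ - X]mul1r -mulNr -eintZ; last by apply: (mul_c); [move=> x; exact: cvg_cst|exact: mul_c].
  rewrite -eintD; last 2 first.
  - by apply: (mul_c); [move=> x; exact: cvg_cst|exact: mul_c].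
  - by apply: (mul_c); [move=> x; exact: cvg_cst|apply: (mul_c); [move=> x; exact: cvg_cst|exact: mul_c]].
  by congr (eint _ _ _); apply/funext => x; rewrite /ntrace; ring.
have [_ [dxP _ _ _]] := CP T 1; have [_ [_ dyQ _ _]] := CQ T 1.
rewrite dxM // dyM //.
have c1 : continuous (fun x => dx (P T) x * phi x + P T x * dx phi x +
     (dy (Q T) x * phi x + Q T x * dy phi x)).
  move=> x; apply: cvgD; apply: cvgD.
  - exact: (mul_c _ _ (cdP T) cphi x).
  - exact: (mul_c _ _ (cP T) cdx x).
  - exact: (mul_c _ _ (cdQ T) cphi x).
  - exact: (mul_c _ _ (cQ T) cdy x).
have c2 : continuous (fun x => (dx (P T) x + dy (Q T) x) * phi x) by exact: mul_c.
have iB := RintegralB mT (integrable_triangle (D0 T) c1) (integrable_triangle (D0 T) c2).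
rewrite -[RHS]iB; apply: eq_Rintegral => x _; ring.
Qed.

End flux.

(** * Existence of a weak divergence and continuity of the normal trace *)

Section weak_divergence.
Context {R : realType} (Omega : set (plane R)) (N : nat) (tri : 'I_N -> 'I_3 -> plane R).
Context (hO : domain Omega) (htri : triangulation Omega tri).
Notation M2 := (measurableTypeR R * measurableTypeR R)%type.
Notation mu2 := (@leb2 R).
Let D0 := tri_nondegenerate htri.
Context (P Q : 'I_N -> plane R -> R).
Context (CP : forall T k, Ck k (P T)) (CQ : forall T k, Ck k (Q T)).

Definition normal_continuous : Prop := forall T T' k l, T != T' ->
  share (tri T) k (tri T') l -> forall t, 0 < t < 1 ->
  let a := tri T (k + 1) in let b := tri T (k + 2) in
  ntrace P Q T a b (line_point a b t) = ntrace P Q T' a b (line_point a b t).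

Lemma test_fun_support phi x : test_fun Omega phi -> phi x != 0 -> Omega x.
Proof. by case=> _ _ sO px; apply: sO; exact: subset_closure. Qed.

(* Each edge with nonzero flux is shared with exactly one other triangle, which
   has the opposite flux. *)
Lemma sum_flux_eq0 phi : normal_continuous -> test_fun Omega phi ->
  \sum_z flux tri P Q phi z = 0.
Proof.
move=> nc tphi; have cphi : continuous phi by case: tphi => /(_ 0) [].
pose r (y z : 'I_N * 'I_3) := `[< y.1 <> z.1 /\ share (tri y.1) y.2 (tri z.1) z.2 >].
have r_sym y z : r y z = r z y.
  by apply/asboolP/asboolP => -[n s]; split; [exact/nesym|exact: share_sym|exact/nesym|exact: share_sym].
have opp y z : r y z -> flux tri P Q phi y + flux tri P Q phi z = 0.
  case: y z => [T k] [T' l] /asboolP[/= /eqP n s].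
  rewrite (flux_pair htri CP CQ n s cphi).
  rewrite [X in _ * X](_ : _ = 0) ?mulr0 // -[RHS](eint0 (tri T (k + 1)) (tri T (k + 2))).
  apply: eq_eint => [x|x|t t01]; last 1 first.
  - by rewrite (nc T T' k l n s t t01) subrr mul0r.
  - apply: cvgM; last exact: cphi.
    by apply: cvgB; [exact: (Ck_continuous (Ck_ntrace CP CQ T _ _ 0))|
      exact: (Ck_continuous (Ck_ntrace CP CQ T' _ _ 0))].
  - exact: cvg_cst.
have uniq y : flux tri P Q phi y != 0 -> exists2 z, r y z & forall z', r y z' -> z' = z.
  case: y => T k F0; pose a := tri T (k + 1); pose b := tri T (k + 2).
  have [t t01 pt] : exists2 t : R, 0 < t < 1 & phi (line_point a b t) != 0.
    apply: contrapT => H; move/eqP: F0; apply; rewrite /flux /= -/a -/b.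
    rewrite [X in _ * X](_ : _ = 0) ?mulr0 // -[RHS](eint0 a b).
    apply: eq_eint => [x|x|t t01].
    - exact: ntrace_phi_continuous.
    - exact: cvg_cst.
    - have [->|n] := eqVneq (phi (line_point a b t)) 0; first by rewrite mulr0.
      by exfalso; apply: H; exists t.
  have Ox := test_fun_support tphi pt.
  have ox := oedge_line k (D0 T) t01.
  have [T' TT' T'x] := edge_neighbour hO htri ox Ox.
  have [l s] := meet_oedge (D0 T) (D0 T') (tri_meet htri TT') ox T'x.
  exists (T', l); first by apply/asboolP; split => //; exact/eqP.
  case=> T1 l1 /asboolP[/= /eqP n1 s1].
  have [e|n] := eqVneq T' T1.
    by subst T1; rewrite (share_uniq (D0 T') s s1).
  exfalso; apply: (share_third (D0 T) (D0 T') (D0 T1) _ _ _ _ s s1); apply: (tri_meet htri) => //.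
  by rewrite eq_sym.
have E y : flux tri P Q phi y = \sum_z (if r y z then flux tri P Q phi y else 0).
  have [->|F0] := eqVneq (flux tri P Q phi y) 0.
    by rewrite big1 // => z _; case: ifP.
  have [z rz uz] := uniq y F0.
  rewrite (bigD1 z) //= rz big1 ?addr0 // => z' nz.
  by case: ifP => // /uz e; rewrite e eqxx in nz.
(* Double counting: a nonzero flux has exactly one partner, so the total can be summed over related
   pairs through either member. Adding the two expressions cancels every pair, and twice the total
   is 0. *)
have S : \sum_y flux tri P Q phi y = \sum_y \sum_z (if r y z then flux tri P Q phi y else 0).
  by apply: eq_bigr => y _; exact: E.
have S' : \sum_y flux tri P Q phi y = \sum_y \sum_z (if r y z then flux tri P Q phi z else 0).
  rewrite S exchange_big; apply: eq_bigr => y _; apply: eq_bigr => z _.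
  by rewrite r_sym.
have : \sum_y flux tri P Q phi y + \sum_y flux tri P Q phi y = 0.
  rewrite {1}S S' -big_split big1 // => y _; rewrite -big_split big1 // => z _ /=.
  by case: ifP => [/opp|_] //; rewrite addr0.
by move/eqP; rewrite -mulr2n mulrn_eq0 => /eqP.
Qed.

Context (v1 v2 : plane R -> R).
Context (m1 : @measurable_fun _ _ M2 R Omega v1) (m2 : @measurable_fun _ _ M2 R Omega v2).
Context (e1 : forall T, v1 = P T %[ae mu2 in triangle (tri T)]).
Context (e2 : forall T, v2 = Q T %[ae mu2 in triangle (tri T)]).

Let D : plane R -> R := paste tri (fun T x => dx (P T) x + dy (Q T) x).

Lemma divergence_continuous T : continuous (fun x => dx (P T) x + dy (Q T) x).
Proof.
have cdP : continuous (dx (P T)) by case: (CP T 1) => _ [_ _ []].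
have cdQ : continuous (dy (Q T)) by case: (CQ T 1) => _ [_ _ _ []].
by move=> x; apply: cvgD; [exact: cdP|exact: cdQ].
Qed.

Lemma L2_pasted (u : plane R -> R) (uT : 'I_N -> plane R -> R) :
  @measurable_fun _ _ M2 R Omega u -> (forall T, continuous (uT T)) ->
  (forall T, u = uT T %[ae mu2 in triangle (tri T)]) -> L2 Omega u.
Proof.
move=> mu' cu ae; apply/(L2P (Omega_measurable hO)); split => //.
apply: (pasted_integrable hO htri (hT := fun T x => uT T x ^+ 2)).
- exact: measurable_funX.
- by move=> T x; apply: cvgM; exact: cu.
- by move=> T; apply: (aeS _ (ae T)) => x h Tx; rewrite h.
Qed.

Lemma L2_divergence : L2 Omega D.
Proof.
have iD := paste_integrable htri (Omega_measurable hO) divergence_continuous.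
apply: (L2_pasted _ divergence_continuous).
  by apply/measurable_EFinP; exact: measurable_int iD.
move=> T; apply: (aeS _ (paste_ae htri T (fun T x => dx (P T) x + dy (Q T) x))) => x h Tx.
exact: (esym (h Tx)).
Qed.

Lemma weak_div_exists : normal_continuous ->
  exists2 g, L2 Omega g & weak_div Omega (fun x => (v1 x, v2 x)) g.
Proof.
move=> nc; exists D; first exact: L2_divergence.
move=> phi tphi; rewrite /integral_on.
have Cphi : Ck 1 phi by case: tphi.
rewrite (green_Omega hO htri CP CQ m1 m2 e1 e2 Cphi) (sum_flux_eq0 nc tphi).
by rewrite sub0r opprK.
Qed.

Lemma square_near (x : plane R) (S : set (plane R)) : nbhs x S ->
  exists2 r : R, 0 < r & square x r `<=` S.
Proof.
move=> /nbhs_ballP[e /= e0 xe]; exists (e / 2); first by rewrite divr_gt0.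
move=> y [/=]; rewrite !in_itv /= => /andP[h1 h2] /andP[h3 h4]; apply: xe.
by split; rewrite /ball /= ltr_distlC; apply/andP; split; lra.
Qed.

Lemma edge_segment_closed (a b : plane R) : closed (edge_segment a b).
Proof.
apply: compact_closed; first exact: norm_hausdorff.
apply: continuous_compact; last exact: segment_compact.
by apply: continuous_subspaceT; exact: line_point_continuous.
Qed.

(** Bumps near [x] should see only one edge, which is listed twice, once for each of its triangles.
    Any other edge through [x] would give a third triangle sharing this edge, so the remaining
    edges, being closed and finitely many, stay away from [x]. *)
Lemma oedge_isolated T T' k l x : T != T' -> share (tri T) k (tri T') l -> oedge (tri T) k x ->
  \forall y \near x, forall z, z != (T, k) -> z != (T', l) ->
    ~ edge_segment (tri z.1 (z.2 + 1)) (tri z.1 (z.2 + 2)) y.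
Proof.
move=> TT' s ox; apply: (@filter_forall _ _ _ (nbhs x) (nbhs_filter x)) => -[T1 k1].
have [->|n1] := eqVneq (T1, k1) (T, k); first by near=> y.
have [->|n2] := eqVneq (T1, k1) (T', l); first by near=> y.
have ox' := share_oedge (D0 T) (D0 T') s ox.
have : nbhs x (~` edge_segment (tri T1 (k1 + 1)) (tri T1 (k1 + 2))).
  have : open (~` edge_segment (tri T1 (k1 + 1)) (tri T1 (k1 + 2))).
    exact/closed_openC/edge_segment_closed.
  rewrite openE; apply; move=> /= [t]; rewrite /= in_itv /= => /andP[t0 t1] tx.
  have bx : bary (tri T1) k1 x = 0.
    by rewrite -tx bary_line !bary_vertex // ?ord3_neq ?mulr0 ?addr0 // eq_sym ord3_neq.
  have T1x : triangle (tri T1) x.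
    apply/(triangleP _ (D0 T1)) => j; rewrite -tx bary_line !bary_vertex //.
    by rewrite addr_ge0 // mulr_ge0 // subr_ge0.
  have same v j j' : oedge v j x -> bary v j' x = 0 -> j' = j.
    move=> [_ h1 h2]; have [] := ord3_shiftP j j' => -> // h0.
      by rewrite h0 ltxx in h1.
    by rewrite h0 ltxx in h2.
  have [e|nT] := eqVneq T T1.
    by subst T1; rewrite (same _ _ _ ox bx) eqxx in n1.
  have [e|nT'] := eqVneq T' T1.
    by subst T1; rewrite (same _ _ _ ox' bx) eqxx in n2.
  have [j sj] := meet_oedge (D0 T) (D0 T1) (tri_meet htri nT) ox T1x.
  apply: (share_third (D0 T) (D0 T') (D0 T1) _ _ _ _ s sj); apply: (tri_meet htri) => //.
  by rewrite eq_sym.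
by move=> nx; near=> y => _ _; near: y; exact: nx.
Unshelve. all: by end_near.
Qed.

Lemma edge_in_Omega T T' k l x : T != T' -> share (tri T) k (tri T') l -> oedge (tri T) k x ->
  Omega x.
Proof.
move=> TT' s ox; apply: (Omega_near htri).
have h := share_near (D0 T) (D0 T') (tri_meet htri TT') s ox.
near=> y.
have : (triangle (tri T) `|` triangle (tri T')) y by near: y; exact: h.
by case=> ?; [exists T|exists T'].
Unshelve. all: by end_near.
Qed.

(* The test functions are the jump [J] times a fixed bump times [th n], which is
   constant on the edge and tends to [0] off its line. *)
Lemma weak_div_normal_continuous g : L2 Omega g ->
  weak_div Omega (fun x => (v1 x, v2 x)) g -> normal_continuous.
Proof.
move=> gL2 wg T T' k l TT' s t0 t01 a b; set x0 := line_point a b t0.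
have ox : oedge (tri T) k x0 by exact: oedge_line.
pose J x := ntrace P Q T a b x - ntrace P Q T' a b x.
have CJ n : Ck n J.
  apply: CkD; first exact: Ck_ntrace.
  under eq_fun do rewrite -mulN1r.
  by apply: CkM; [exact: Ck_cst|exact: Ck_ntrace].
have Ox0 := edge_in_Omega TT' s ox.
have nO : nbhs x0 Omega by case: hO => _; rewrite openE => h _; exact: h.
have [r r0 rS] := square_near (filterI nO (oedge_isolated TT' s ox)).
have rO : square x0 r `<=` Omega by move=> y /rS[].
pose A x : R := area2 x a b.
pose th (n : nat) x := theta (1 + n%:R * A x) * theta (1 - n%:R * A x).
have Cth n m : Ck m (th n).
  apply: CkM.
    rewrite (_ : (fun x => _) = fun x => theta ((1 + n%:R * (a.1 * b.2 - a.2 * b.1)) +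
      (n%:R * (a.2 - b.2)) * x.1 + (n%:R * (b.1 - a.1)) * x.2)); first exact: Ck_theta.
    by apply/funext => x; congr theta; rewrite /A /area2; ring.
  rewrite (_ : (fun x => _) = fun x => theta ((1 - n%:R * (a.1 * b.2 - a.2 * b.1)) +
    (- n%:R * (a.2 - b.2)) * x.1 + (- n%:R * (b.1 - a.1)) * x.2)); first exact: Ck_theta.
  by apply/funext => x; congr theta; rewrite /A /area2; ring.
have tphi n : test_fun Omega (fun x => bump_at x0 r x * (J x * th n x)).
  by apply: test_fun_bump => // m; apply: CkM.
have cth n := Ck_continuous (Cth n 0).
pose psi x := bump_at x0 r x * J x.
have cpsi : continuous psi by apply: (@Ck_continuous _ 0); apply: CkM => //; exact: Ck_bump.
(* The jump occurs twice, once in the normal trace and once in the test function; this makes the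
   edge integrand nonnegative. *)
pose f x := bump_at x0 r x * J x ^+ 2.
have cf : continuous f.
  by apply: (@Ck_continuous _ 0); apply: CkM; [exact: Ck_bump|exact: CkX].
pose c := Num.sg (area2 (tri T 0) (tri T 1) (tri T 2)) * ((theta 1 * theta 1) * eint a b f).
have Fc n : \sum_z flux tri P Q (fun x => bump_at x0 r x * (J x * th n x)) z = c.
  have cphi : continuous (fun x => bump_at x0 r x * (J x * th n x)).
    by have [C _ _] := tphi n; exact: (Ck_continuous (C 0)).
  rewrite (bigD1 (T, k)) //= (bigD1 (T', l)) /=; last first.
    by rewrite xpair_eqE eq_sym (negbTE TT').
  rewrite [X in _ + (_ + X)]big1 ?addr0; last first.
    move=> [T1 k1] /andP[n1 n2]; rewrite /flux /=.
    rewrite [X in _ * X](_ : _ = 0) ?mulr0 // -[RHS](eint0 (tri T1 (k1 + 1)) (tri T1 (k1 + 2))).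
    apply: eq_eint => [x|x|t /andP[t1 t2]].
    - exact: ntrace_phi_continuous.
    - exact: cvg_cst.
    rewrite bump_eq0 ?mul0r ?mulr0 // => /rS[_] /(_ (T1, k1) n1 n2); apply.
    by exists t => //=; rewrite in_itv /= !ltW.
  rewrite (flux_pair htri CP CQ TT' s cphi) /c; congr (_ * _).
  rewrite -eintZ //; apply: eq_eint => [x|x|t t01'].
  - apply: cvgM; last exact: cphi.
    exact: (Ck_continuous (CJ 0)).
  - by apply: cvgM; [exact: cvg_cst|exact: cf].
  have A0 : A (line_point a b t) = 0 by rewrite /A /area2 /line_point /=; ring.
  by rewrite /th A0 mulr0 addr0 subr0 /f -/(J _); ring.
have [m bO] := Omega_box htri.
have mO := Omega_measurable hO.
have ig := L2_integrable mO bO gL2.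
have iD := L2_integrable mO bO L2_divergence.
have iDg : mu2.-integrable Omega (EFin \o (fun x => D x - g x)).
  by have := integrableB mO iD ig.
have c0 : c = 0.
  apply: (concentrating_integral mO bO iDg cpsi cth (S := line a b)).
  - move=> n x; rewrite mulr_ge0 ?theta_ge0 //=.
    by rewrite mulr_ile1 ?theta_ge0 ?theta_le1.
  - apply: line_negligible; apply/eqP => /(nondegenerate_inj (D0 T)) /eqP.
    by rewrite ord3_neq.
  - move=> x /eqP; rewrite -/(A x) => Ax0.
    (* As soon as [n |A x| >= 1], one of the two arguments of [theta] is at most 0. *)
    exists (Num.bound `|A x|^-1) => // n /= nA.
    have An : 1 <= n%:R * `|A x|.
      rewrite -ler_pdivrMr ?normr_gt0 // div1r (le_trans (ltW (archi_boundP _))) ?invr_ge0 //.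
      by rewrite ler_nat.
    rewrite /th; have [h|h] := leP 0 (A x).
      by rewrite ger0_norm // in An; rewrite [X in _ * X]theta_eq0 ?mulr0 // subr_le0.
    rewrite ltr0_norm // in An; rewrite theta_eq0 ?mul0r //.
    by move: An; rewrite mulrN; lra.
  move=> n.
  pose phi x := bump_at x0 r x * (J x * th n x).
  have cphi : continuous phi by have [C _ _] := tphi n; exact: (Ck_continuous (C 0)).
  have := wg _ (tphi n); have Cphi : Ck 1 phi by case: (tphi n).
  rewrite /integral_on (green_Omega hO htri CP CQ m1 m2 e1 e2 Cphi) (Fc n) -/D => H.
  (* [H] compares Green's formula with the definition of the weak divergence: the edge term is the
     integral of [(D - g) phi]. *)
  have E := RintegralB mO (integrable_mul_continuous mO bO cphi iD) (integrable_mul_continuous mO bO cphi ig).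
  transitivity (\int[mu2]_(x in Omega) (D x * phi x - g x * phi x)).
    by apply: eq_Rintegral => x _; rewrite /psi /phi; ring.
  by rewrite E H; ring.
have th1 : theta (1 : R) != 0 by rewrite gt_eqF // theta_gt0.
have : eint a b f = 0.
  move/eqP: c0; rewrite /c !mulf_eq0 (negbTE th1) sgr_eq0 /= -[_ == 0]/(_ == 0).
  by rewrite (negbTE (D0 T)) => /eqP.
have f0 x : 0 <= f x by rewrite mulr_ge0 ?bump_ge0 ?sqr_ge0.
move=> /(eint_eq0 cf f0) /(_ t01) /eqP.
rewrite -/x0 mulf_eq0 (gt_eqF (bump_gt0 _ r0)) /= sqrf_eq0 subr_eq0 => /eqP.
by [].
Qed.

End weak_divergence.

(** * Jump conditions as agreement on edges *)

Section jumps.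
Context {R : realType}.

Lemma poly_eq_oo (p q : {poly R}) : (forall t, 0 < t < 1 -> p.[t] = q.[t]) -> p = q.
Proof.
move=> pq; apply/eqP; rewrite -subr_eq0; apply/negPn/negP => /max_poly_roots H.
set r := p - q in H.
suff : (size r < size r)%N by rewrite ltnn.
(* The numbers [1/(n+2)] lie in the open interval; as many of them as the size of [r] is one more
   than its degree allows as roots. *)
rewrite -{1}(size_iota 0 (size r)) -(size_map (fun n => n.+2%:R^-1 : R)); apply: H.
  apply/allP => _ /mapP[n _ ->]; rewrite /root /r !hornerE pq ?subrr //.
  by rewrite invr_gt0 ltr0n /= invf_lt1 ?ltr0n // ltr1n.
rewrite map_inj_uniq ?iota_uniq // => x y /invr_inj /eqP.
by rewrite eqr_nat => /eqP [].
Qed.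

Lemma edge_jump_eq0 N (e : edge R N) d (f : 'I_N -> plane R -> R) :
  (forall T, exists2 p : {poly R}, (size p <= d.+1)%N &
     forall t, f T (line_point (org e) (dst e) t) = p.[t]) ->
  edge_jump e d f = 0 <->
  forall t, 0 < t < 1 ->
    f (plus e) (line_point (org e) (dst e) t) = f (minus e) (line_point (org e) (dst e) t).
Proof.
move=> fp; have [p sp pE] := fp (plus e); have [q sq qE] := fp (minus e).
set a := org e in pE qE *; set b := dst e in pE qE *.
have cp := (edge_coefsP (edge_coefs a b d (f (plus e))) sp pE).1 erefl.
have cq := (edge_coefsP (edge_coefs a b d (f (minus e))) sq qE).1 erefl.
rewrite /edge_jump; split.
  by move/eqP; rewrite subr_eq0 => /eqP E t _; rewrite cp cq E.
move=> H; apply/eqP; rewrite subr_eq0; apply/eqP.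
apply/(edge_coefsP (edge_coefs a b d (f (minus e))) sp pE) => t.
have pq : p = q by apply: poly_eq_oo => s s01; rewrite -pE -qE H.
by rewrite pE pq -qE cq.
Qed.

Context (N M : nat) (tri : 'I_N -> 'I_3 -> plane R) (E : 'I_M -> edge R N).
Context (D0 : forall T, nondegenerate (tri T)).
Context (tri_meet : forall T T', T != T' -> meet_properly (tri T) (tri T')).
Context (hE : interior_edges tri E).

Lemma line_point_swap (a b : plane R) t : line_point b a t = line_point a b (1 - t).
Proof. by rewrite /line_point; congr (_, _); ring. Qed.

(** Passage from the listed edges, with their arbitrary orientations and namings, to all pairs of
    local edges. [K] receives the endpoints so as to cover both values and normal traces, and its
    hypothesis says that reversing an edge preserves agreement. *)
Lemma jumps_iff (K : 'I_N -> plane R -> plane R -> plane R -> R) :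
  (forall T T' a b x, K T a b x = K T' a b x -> K T b a x = K T' b a x) ->
  (forall i t, 0 < t < 1 -> let e := E i in
     K (plus e) (org e) (dst e) (line_point (org e) (dst e) t)
     = K (minus e) (org e) (dst e) (line_point (org e) (dst e) t)) <->
  (forall T T' k l, T != T' -> share (tri T) k (tri T') l -> forall t, 0 < t < 1 ->
     let a := tri T (k + 1) in let b := tri T (k + 2) in
     K T a b (line_point a b t) = K T' a b (line_point a b t)).
Proof.
move=> Ksym.
have flip T T' a b : (forall t, 0 < t < 1 -> K T a b (line_point a b t) = K T' a b (line_point a b t)) ->
    forall t, 0 < t < 1 -> K T b a (line_point b a t) = K T' b a (line_point b a t).
  move=> H t /andP[t0 t1]; rewrite line_point_swap; apply: Ksym; apply: H.
  by apply/andP; split; lra.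
have [hE1 hE2] := hE; split => H.
  move=> T T' k l TT' s t t01 a b; move: t t01.
  have ab : a != b by apply/eqP => /(nondegenerate_inj (D0 T)) /eqP; rewrite ord3_neq.
  have common : common_edge (tri T) (tri T') a b.
    split => //; first by split; [exists (k + 1)|exists (k + 2)].
    by case: s => -[e1 e2]; split; [exists (l + 1)|exists (l + 2)|exists (l + 2)|exists (l + 1)].
  have [i [Ei _]] := hE2 (Edge T T' a b) (conj TT' common).
  have [pm [odE [po pd] [mo md]]] := hE1 i.
  have [ka ska] := vertices_edge odE po pd.
  have [kb skb] := vertices_edge odE mo md.
  have od : (org (E i) = a /\ dst (E i) = b) \/ (org (E i) = b /\ dst (E i) = a).
    have oab : [set a; b] (org (E i)) by rewrite -[X in X _]Ei; left.
    have dab : [set a; b] (dst (E i)) by rewrite -[X in X _]Ei; right.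
    case: oab dab odE => /= -> [] /= ->; rewrite ?eqxx //; by [left|right].
  have sh (w : 'I_3 -> plane R) j : (w (j + 1) = org (E i) /\ w (j + 2) = dst (E i)) \/
      (w (j + 1) = dst (E i) /\ w (j + 2) = org (E i)) -> share (tri T) k w j.
    by case: od => -[-> ->] [] [e1 e2]; [left|right|right|left].
  have spl := sh _ _ ska; have smi := sh _ _ skb.
  (* The list identifies an edge by its endpoints only; that its two triangles are [T] and [T']
     follows because no third triangle shares them. *)
  have cases T1 j : share (tri T) k (tri T1) j -> T1 = T \/ T1 = T'.
    move=> s1; have [->|n] := eqVneq T1 T; first by left.
    have [->|n'] := eqVneq T1 T'; first by right.
    exfalso; apply: (share_third (D0 T) (D0 T') (D0 T1) _ _ _ _ s s1); apply: tri_meet => //;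
      by rewrite eq_sym.
  have HT : forall t, 0 < t < 1 -> K T (org (E i)) (dst (E i)) (line_point (org (E i)) (dst (E i)) t) =
      K T' (org (E i)) (dst (E i)) (line_point (org (E i)) (dst (E i)) t).
    move=> t t01; have := H i t t01; cbv zeta.
    move: pm; have [->|->] := cases _ _ spl; have [->|->] := cases _ _ smi; rewrite ?eqxx // => _ h;
      first [exact: h|exact: esym h].
  by case: od HT => -[-> ->] //; exact: flip.
move=> i t t01; cbv zeta; move: t t01.
have [pm [odE [po pd] [mo md]]] := hE1 i.
have [k sk] := vertices_edge odE po pd; have [l sl] := vertices_edge odE mo md.
have s : share (tri (plus (E i))) k (tri (minus (E i))) l.
  by case: sk sl => -[e1 e2] [] [f1 f2]; [left|right|right|left]; split; congruence.
have := H _ _ k l pm s.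
case: sk => -[-> ->] //; exact: flip.
Qed.

End jumps.

(** * Continuity at interior vertices *)

Section continuity.
Context {R : realType} (Omega : set (plane R)) (N : nat) (tri : 'I_N -> 'I_3 -> plane R).
Context (hO : domain Omega) (htri : triangulation Omega tri).
Let D0 := tri_nondegenerate htri.
Context (U : 'I_N -> plane R -> R) (cU : forall T, continuous (U T)).

Definition edge_continuous : Prop := forall T T' k l, T != T' ->
  share (tri T) k (tri T') l -> forall t, 0 < t < 1 ->
  let a := tri T (k + 1) in let b := tri T (k + 2) in
  U T (line_point a b t) = U T' (line_point a b t).

Lemma eq_on_segment (f g : plane R -> R) (a b : plane R) : continuous f -> continuous g ->
  (forall t, 0 < t < 1 -> f (line_point a b t) = g (line_point a b t)) ->
  forall t, 0 <= t <= 1 -> f (line_point a b t) = g (line_point a b t).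
Proof.
move=> cf cg fg t /andP[t0 t1]; apply/eqP; rewrite -subr_eq0; apply/negPn/negP => n0.
pose h s := f (line_point a b s) - g (line_point a b s).
have ch : continuous h.
  move=> s; apply: cvgB;
  by apply: continuous_comp; [exact: line_point_continuous|by [exact: cf|exact: cg]].
have : \forall s \near t, h s != 0.
  by apply: (cvgr_neq0 (h t) (ch t)).
move=> [e /= e0 He].
(* A step of length [d] towards the middle stays where [h] is nonzero; the bound 1/4 keeps it inside
   the open interval. *)
pose d := Num.min (e / 2) (1 / 4).
have d0 : 0 < d by rewrite lt_min; apply/andP; split; lra.
have de : d < e by rewrite gt_min; apply/orP; left; lra.
have d4 : d <= 1 / 4 by rewrite ge_min lexx orbT.
have K s : 0 < s < 1 -> `|t - s| < e -> False.
  by move=> s01 /He; rewrite /h fg // subrr eqxx.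
have [h2|h2] := leP t (1 / 2).
  apply: (K (t + d)); first by apply/andP; split; lra.
  by rewrite opprD addNKr normrN ger0_norm // ltW.
apply: (K (t - d)); first by apply/andP; split; lra.
by rewrite opprB addrCA subrr addr0 ger0_norm // ltW.
Qed.

(** A second common point excludes meeting in a vertex only. On the common edge the pieces agree up
    to the endpoints by continuity, so [x] may be a vertex. *)
Lemma pieces_agree T T' x y : edge_continuous -> x != y ->
  (triangle (tri T) `&` triangle (tri T')) x -> (triangle (tri T) `&` triangle (tri T')) y ->
  U T x = U T' x.
Proof.
move=> ec xy; have [->//|TT'] := eqVneq T T'.
case: (tri_meet htri TT') => [->//|[a _ ->] /= xa ya|[a [b [[ab [va vb] [wa wb]] ->]]] [t]].
  by rewrite xa ya eqxx in xy.
rewrite /= in_itv /= => t01 <- _.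
have [k sk] := vertices_edge ab va vb; have [l sl] := vertices_edge ab wa wb.
have s : share (tri T) k (tri T') l.
  by case: sk sl => -[e1 e2] [] [f1 f2]; [left|right|right|left]; split; congruence.
have H := ec T T' k l TT' s; apply: eq_on_segment => // {t t01} t t01.
case: sk H => -[-> ->] H; first exact: H.
have -> : line_point a b t = line_point b a (1 - t).
  by rewrite /line_point; congr (_, _); ring.
by apply: H; move/andP: t01 => [? ?]; apply/andP; split; lra.
Qed.

Lemma near_triangles x : \forall y \near x, forall T, triangle (tri T) y -> triangle (tri T) x.
Proof.
apply: (@filter_forall _ _ _ (nbhs x) (nbhs_filter x)) => T.
have [Tx|nTx] := pselect (triangle (tri T) x); first by near=> y.
have : open (~` triangle (tri T)) by exact/closed_openC/triangle_closed/D0.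
rewrite openE => /(_ x nTx) nx; near=> y => Ty; exfalso.
have : (~` triangle (tri T)) y by near: y; exact: nx.
exact.
Unshelve. all: by end_near.
Qed.

Lemma line_point_square x r (y z : plane R) t : square x r y -> square x r z -> 0 <= t <= 1 ->
  square x r (line_point y z t).
Proof.
rewrite /square /line_point /= !in_itv /= => -[/andP[a1 a2] /andP[a3 a4]] [/andP[b1 b2] /andP[b3 b4]] /andP[t0 t1].
by split; apply/andP; split; nra.
Qed.

Lemma triangle_convex T y z t : triangle (tri T) y -> triangle (tri T) z -> 0 <= t <= 1 ->
  triangle (tri T) (line_point y z t).
Proof.
move=> /(triangleP _ (D0 T)) Ty /(triangleP _ (D0 T)) Tz /andP[t0 t1].
by apply/(triangleP _ (D0 T)) => k; rewrite bary_line addr_ge0 // mulr_ge0 // subr_ge0.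
Qed.

Lemma not_collinear T x y : x != y -> exists j, area2 x y (tri T j) != 0.
Proof.
move=> xy; apply: contrapT => H.
have Z j : area2 x y (tri T j) = 0.
  by apply/eqP/negPn/negP => nz; apply: H; exists j.
have := D0 T; rewrite /nondegenerate => /eqP; apply.
have E (z : plane R) : area2 x y z = (y.1 - x.1) * (z.2 - x.2) - (y.2 - x.2) * (z.1 - x.1) by [].
have [e|n] := eqVneq y.1 x.1.
  have n2 : y.2 - x.2 != 0.
    by rewrite subr_eq0; apply: contra xy => /eqP e2; case: x y e e2 {Z E H} => ? ? [? ?] /= -> ->.
  have F k : (tri T k).1 = x.1.
    have /eqP := Z k; rewrite E e subrr mul0r sub0r oppr_eq0 mulf_eq0 (negbTE n2) subr_eq0.
    by move/eqP.
  by rewrite /area2 !F; ring.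
have n1 : y.1 - x.1 != 0 by rewrite subr_eq0.
have F k : (tri T k).2 = x.2 + (y.2 - x.2) / (y.1 - x.1) * ((tri T k).1 - x.1).
  apply: (mulfI n1); have := Z k; rewrite E => /eqP; rewrite subr_eq0 => /eqP h.
  have -> : (y.1 - x.1) * (x.2 + (y.2 - x.2) / (y.1 - x.1) * ((tri T k).1 - x.1)) =
      (y.1 - x.1) * x.2 + (y.2 - x.2) * ((tri T k).1 - x.1) by field.
  by rewrite -h; ring.
by rewrite /area2 !F; ring.
Qed.

(* The values at [x] of the pieces met along a segment [g] close to [x] and
   avoiding [x] split [0, 1] into disjoint closed sets. *)
Lemma agree_Omega T T' x : edge_continuous -> Omega x -> triangle (tri T) x -> triangle (tri T') x ->
  U T x = U T' x.
Proof.
move=> ec Ox Tx T'x; apply: contrapT => neq.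
have nO : nbhs x Omega by case: hO => _; rewrite openE => h _; exact: h.
have [r r0 rS] := square_near (filterI nO (near_triangles x)).
have [j' xj'] : exists j, x != tri T' j.
  have [e|n] := eqVneq x (tri T' 0); last by exists 0.
  by exists 1; rewrite e; apply/eqP => /(nondegenerate_inj (D0 T')) /eqP.
(* The vertex [p] of [T] is chosen off the line through [x] and [q], so that the segment between
   points of [xp] and [xq] other than [x] misses [x]. *)
have [j xj] := not_collinear T xj'.
pose p := tri T j; pose q := tri T' j'.
have c (z : plane R) := @line_point_continuous R x z 0.
have sq : nbhs x (square x r).
  apply/nbhs_ballP; exists r => //= z [/=]; rewrite /ball /= !ltr_distlC.
  by move=> /andP[? ?] /andP[? ?]; split; rewrite /= in_itv /=; apply/andP; split; lra.
rewrite /continuous_at in c.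
have cp := c p; have cq := c q; rewrite line_point0 in cp; rewrite line_point0 in cq.
have sp : \forall t \near 0, square x r (line_point x p t) := cp _ sq.
have sq' : \forall t \near 0, square x r (line_point x q t) := cq _ sq.
have [e /andP[e0 e1] [Se1 Se2]] := near0_pos (filterI sp sq').
pose y := line_point x p e; pose z := line_point x q e.
have e01 : 0 <= e <= 1 by rewrite !ltW.
have Ty : triangle (tri T) y.
  by apply: triangle_convex => //; exact: triangle_vertex.
have T'z : triangle (tri T') z.
  by apply: triangle_convex => //; exact: triangle_vertex.
pose g t := line_point y z t.
have gx t : g t != x.
  apply/eqP => gt.
  have a1 : area2 x q (g t) = (1 - t) * (e * area2 x q p) by rewrite /g /y /z /area2 /line_point /=; ring.
  have a2 : area2 x p (g t) = t * (e * area2 x p q) by rewrite /g /y /z /area2 /line_point /=; ring.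
  have a3 : area2 x p q = - area2 x q p by rewrite /area2; ring.
  have az (w : plane R) : area2 x w x = 0 by rewrite /area2; ring.
  rewrite gt az in a1; rewrite gt az a3 in a2.
  have nz : e * area2 x q p != 0 by rewrite mulf_neq0 // gt_eqF.
  move/eqP: a1; rewrite eq_sym mulf_eq0 (negbTE nz) orbF subr_eq0 => /eqP t1.
  by move/eqP: a2; rewrite -t1 mul1r mulrN eq_sym oppr_eq0 (negbTE nz).
have gS t : 0 <= t <= 1 -> square x r (g t) by exact: line_point_square.
have gO t : 0 <= t <= 1 -> exists T1, triangle (tri T1) (g t).
  by move=> /gS/rS[/(Omega_covered htri)].
have gTx t T1 : 0 <= t <= 1 -> triangle (tri T1) (g t) -> triangle (tri T1) x.
  by move=> /gS/rS[_ h]; exact: h.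
pose A b : set R := `[0, 1]%classic `&`
  \bigcup_(T1 in [set T1 | (U T1 x == U T x) = b]) (g @^-1` triangle (tri T1)).
have cA b : closed (A b).
  apply: closedI; first exact: itv_closed.
  apply: closed_bigcup => [|T1 _]; first exact: finite_finset.
  apply: preimage_closed; last exact/triangle_closed/D0.
  by apply: in1W; exact: line_point_continuous.
have AI : A true `&` A false = set0.
  apply/seteqP; split => // t [[/= t01 [T1 /= b1 T1t]] [_ [T2 /= b2 T2t]]].
  rewrite in_itv /= in t01.
  (* Two triangles met at the same parameter share [x] and the different point [g t], hence their
     pieces agree at [x]. *)
  have E : U T1 x = U T2 x.
    apply: (@pieces_agree T1 T2 x (g t) ec); first by rewrite eq_sym gx.
      by split; exact: gTx t01 _.
    by split.
  by rewrite E b2 in b1.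
have := @segment_connected R 0 1; move/connectedP => /(_ A); apply; split.
- case.
    exists 0; split; first by rewrite /= in_itv /= lexx ler01.
    by exists T => /=; rewrite ?eqxx // /g line_point0.
  exists 1; split; first by rewrite /= in_itv /= lexx ler01.
  exists T' => /=; first by apply/eqP => h; exact: neq.
  by rewrite /g /line_point !mul1r !subrKC -surjective_pairing.
- apply/seteqP; split => t; last by case=> -[].
  move=> t01; have t01' : 0 <= t <= 1 by move: t01; rewrite /= in_itv.
  have [T1 T1t] := gO t t01'.
  by case E : (U T1 x == U T x); [right|left]; split => //; exists T1.
- rewrite /separated -!(closure_id _).1 //; split; first by rewrite setIC.
  by rewrite setIC.
Qed.

(** Here, in contrast to [paste], the value has to be right at every point of [Omega]. Any piece
    containing the point may be picked, by [agree_Omega]. *)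
Definition paste_Omega (x : plane R) : R :=
  if [pick T | `[< triangle (tri T) x >]] is Some T then U T x else 0.

Lemma paste_OmegaE T x : edge_continuous -> Omega x -> triangle (tri T) x ->
  paste_Omega x = U T x.
Proof.
move=> ec Ox Tx; rewrite /paste_Omega; case: pickP => [T1 /asboolP T1x|/(_ T)/asboolP//].
exact: agree_Omega.
Qed.

(** Near [x] only triangles containing [x] occur, so the continuity at [x] of finitely many pieces
    is enough. *)
Lemma paste_Omega_continuous : edge_continuous -> {within Omega, continuous paste_Omega}.
Proof.
move=> ec; have oO : open Omega by case: hO.
rewrite continuous_open_subspace // => x; rewrite inE => Ox.
apply/cvgrPdist_lt => e e0; near=> y.
have Oy : Omega y.
  by near: y; move: oO; rewrite openE; exact.
have ny : forall T, triangle (tri T) y -> triangle (tri T) x by near: y; exact: near_triangles.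
have Uy : forall T, `|U T x - U T y| < e.
  near: y; apply: (@filter_forall _ _ _ (nbhs x) (nbhs_filter x)) => T.
  by have /cvgrPdist_lt := @cU T x; exact.
have [T Ty] := Omega_covered htri Oy.
by rewrite (paste_OmegaE ec Oy Ty) (paste_OmegaE ec Ox (ny T Ty)).
Unshelve. all: by end_near.
Qed.

End continuity.

(** * Spline spaces *)

Section spline_spaces.
Context {R : realType} (Omega : set (plane R)) (N M : nat) (tri : 'I_N -> 'I_3 -> plane R)
  (E : 'I_M -> edge R N).
Context (hO : domain Omega) (htri : triangulation Omega tri) (hE : interior_edges tri E).
Notation M2 := (measurableTypeR R * measurableTypeR R)%type.
Notation mu2 := (@leb2 R).
Let D0 := tri_nondegenerate htri.
Let mO := Omega_measurable hO.

Lemma Ck_piece d (s : Sm1 R N d) T k : Ck k (piece tri s T).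
Proof. exact/Ck_Pd/Pd_piece. Qed.

Lemma continuous_piece d (s : Sm1 R N d) T : continuous (piece tri s T).
Proof. exact: (Ck_continuous (Ck_piece s T 0)). Qed.

Lemma spline_of_Pd d (p : 'I_N -> plane R -> R) : (forall T, Pd d (p T)) ->
  exists s : Sm1 R N d, forall T x, piece tri s T x = p T x.
Proof.
move=> pP.
have /choice[c cE] : forall T, exists c : bindex d -> R, forall x,
    p T x = \sum_(alpha : bindex d) c alpha * bernstein (tri T) alpha x.
  by move=> T; exact: Pd_bspan.
exists [ffun z => c z.1 z.2] => T x; rewrite cE; apply: eq_bigr => alpha _.
by rewrite ffunE.
Qed.

Lemma spline_of_piecewise_P d u : piecewise_P d tri u ->
  exists s : Sm1 R N d, forall T, u = piece tri s T %[ae mu2 in triangle (tri T)].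
Proof.
move=> uP; have /choice[p pE] : forall T, exists p, Pd d p /\ u = p %[ae mu2 in triangle (tri T)].
  by move=> T; have [p ? ?] := uP T; exists p.
have [s sE] := spline_of_Pd (fun T => (pE T).1).
by exists s => T; apply: (aeS _ (pE T).2) => x ux Tx; rewrite sE; exact: ux.
Qed.

Lemma piecewise_P_of_spline d (s : Sm1 R N d) u :
  (forall T, u = piece tri s T %[ae mu2 in triangle (tri T)]) -> piecewise_P d tri u.
Proof. by move=> us T; exists (piece tri s T); [exact: Pd_piece|exact: us]. Qed.

Lemma row_matrix_eq0 d (f : 'I_M -> 'rV[R]_d) : \matrix_(i < M) f i = 0 <-> forall i, f i = 0.
Proof.
split=> [H i|H]; last by apply/row_matrixP => i; rewrite rowK H row0.
by rewrite -(rowK f i) H row0.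
Qed.

Lemma V0_iff d (s : Sm1 R N d) : C0 tri E s = 0 <-> edge_continuous tri (piece tri s).
Proof.
apply: iff_trans (row_matrix_eq0 _) _.
apply: iff_trans (jumps_iff D0 (tri_meet htri) hE (K := fun T _ _ x => piece tri s T x) _) => //.
by split=> H i; have := H i; rewrite edge_jump_eq0 // => T; exact: piece_line.
Qed.

Lemma edge_length_neq0 i : let e := E i in
  Num.sqrt (((dst e).1 - (org e).1) ^+ 2 + ((dst e).2 - (org e).2) ^+ 2) != 0.
Proof.
have [_ [od _ _]] := hE.1 i; rewrite /= sqrtr_eq0 -ltNge lt0r.
rewrite addr_ge0 ?sqr_ge0 // andbT paddr_eq0 ?sqr_ge0 // !sqrf_eq0 !subr_eq0.
by apply: contra od; case: (org _) (dst _) => ? ? [? ?] /= /andP[/eqP -> /eqP ->].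
Qed.

Lemma dot_line d (v : Sm1 R N d * Sm1 R N d) n T a b : exists2 p : {poly R}, (size p <= d.+1)%N &
  forall t, piece_dot tri v n T (line_point a b t) = p.[t].
Proof.
have [p sp pE] := piece_line tri v.1 T a b; have [q sq qE] := piece_line tri v.2 T a b.
exists (n.1 *: p + n.2 *: q).
  by rewrite (leq_trans (size_polyD _ _)) // geq_max !(leq_trans (size_scale_leq _ _)).
by move=> t; rewrite /piece_dot pE qE !hornerE; ring.
Qed.

(** The factor [c] absorbs the edge length and the sign of the normal, which keeps square roots out
    of the condition on traces. *)
Lemma jump_dot_iff d (v : Sm1 R N d * Sm1 R N d) (n : edge R N -> plane R)
    (P Q : 'I_N -> plane R -> R) (c : 'I_M -> R) : (forall i, c i != 0) ->
  (forall i T x, piece_dot tri v (n (E i)) T x = c i * ntrace P Q T (org (E i)) (dst (E i)) x) ->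
  \matrix_(i < M) edge_jump (E i) d (piece_dot tri v (n (E i))) = 0 <-> normal_continuous tri P Q.
Proof.
move=> c0 nE; apply: iff_trans (row_matrix_eq0 _) _.
apply: iff_trans (jumps_iff D0 (tri_meet htri) hE (K := ntrace P Q) _); last first.
  move=> T T' a b x; rewrite /ntrace => h; apply: oppr_inj.
  by move: h; rewrite !opprB -!mulNr !opprB; lra.
split=> H i.
  move=> t t01; have := (edge_jump_eq0 (fun T => dot_line v (n (E i)) T _ _)).1 (H i) t t01.
  by rewrite !nE => /(mulfI (c0 i)).
by apply/(edge_jump_eq0 (fun T => dot_line v (n (E i)) T _ _)) => t t01; rewrite !nE H.
Qed.

Lemma V1div_iff d (v : Sm1 R N d * Sm1 R N d) :
  C1div tri E v = 0 <-> normal_continuous tri (piece tri v.1) (piece tri v.2).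
Proof.
have L0 := edge_length_neq0; cbv zeta in L0.
apply: (jump_dot_iff (c := fun i => - (Num.sqrt (((dst (E i)).1 - (org (E i)).1) ^+ 2 +
   ((dst (E i)).2 - (org (E i)).2) ^+ 2))^-1)) => [i|i T x].
  by rewrite oppr_eq0 invr_eq0.
by rewrite /piece_dot /normal /tangent /ntrace /=; ring.
Qed.

Lemma V1curl_iff d (v : Sm1 R N d * Sm1 R N d) :
  C1curl tri E v = 0 <->
  normal_continuous tri (piece tri v.2) (fun T x => - piece tri v.1 T x).
Proof.
have L0 := edge_length_neq0; cbv zeta in L0.
apply: (jump_dot_iff (c := fun i => (Num.sqrt (((dst (E i)).1 - (org (E i)).1) ^+ 2 +
   ((dst (E i)).2 - (org (E i)).2) ^+ 2))^-1)) => [i|i T x].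
  by rewrite invr_eq0.
by rewrite /piece_dot /tangent /ntrace /=; ring.
Qed.

Lemma weak_div_iff (v1 v2 : plane R -> R) (P Q : 'I_N -> plane R -> R) :
  @measurable_fun _ _ M2 R Omega v1 -> @measurable_fun _ _ M2 R Omega v2 ->
  (forall T k, Ck k (P T)) -> (forall T k, Ck k (Q T)) ->
  (forall T, v1 = P T %[ae mu2 in triangle (tri T)]) ->
  (forall T, v2 = Q T %[ae mu2 in triangle (tri T)]) ->
  (exists2 g, L2 Omega g & weak_div Omega (fun x => (v1 x, v2 x)) g) <-> normal_continuous tri P Q.
Proof.
move=> m1 m2 CP CQ e1 e2; split=> [[g gL2 wg]|].
  exact: (weak_div_normal_continuous hO htri CP CQ m1 m2 e1 e2 gL2 wg).
exact: (weak_div_exists hO htri CP CQ m1 m2 e1 e2).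
Qed.

Lemma L2_measurable u : L2 Omega u -> @measurable_fun _ _ M2 R Omega u.
Proof. by move/(L2P mO) => -[]. Qed.

Lemma L2_spline d (s : Sm1 R N d) u : @measurable_fun _ _ M2 R Omega u ->
  (forall T, u = piece tri s T %[ae mu2 in triangle (tri T)]) -> L2 Omega u.
Proof. by move=> mu' us; apply: (L2_pasted hO htri mu' _ us) => T; exact: continuous_piece. Qed.

(** The normal jumps of the two fields are the jump of [U] times, up to sign, the two components of
    the edge vector, and these do not both vanish. *)
Lemma edge_continuous_normal (U : 'I_N -> plane R -> R) : edge_continuous tri U <->
  normal_continuous tri U (fun _ _ => 0) /\ normal_continuous tri (fun _ _ => 0) U.
Proof.
split=> [H|[H1 H2]].
  by split=> T T' k l TT' s t t01 a b; rewrite /ntrace (H T T' k l).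
move=> T T' k l TT' s t t01 a b.
have /= := H1 T T' k l TT' s t t01; have /= := H2 T T' k l TT' s t t01.
rewrite /ntrace !mulr0 !sub0r !subr0 -/a -/b => /oppr_inj h2 h1.
have [e|n] := eqVneq b.2 a.2; last by apply: mulfI h1; rewrite subr_eq0.
apply: mulfI h2; rewrite subr_eq0; apply: contraTN isT => /eqP e'.
have : b = a by case: (a) (b) e e' => ? ? [? ?] /= -> ->.
by move/(nondegenerate_inj (D0 T)) => /eqP; rewrite ord3_neq.
Qed.

Lemma weak_gradient_iff d (s : Sm1 R N d) u : @measurable_fun _ _ M2 R Omega u ->
  (forall T, u = piece tri s T %[ae mu2 in triangle (tri T)]) ->
  ((exists2 g, L2 Omega g & weak_dx Omega u g) /\ (exists2 g, L2 Omega g & weak_dy Omega u g)) <->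
  C0 tri E s = 0.
Proof.
move=> mu' us; rewrite V0_iff edge_continuous_normal.
have m0 : @measurable_fun _ _ M2 R Omega (fun=> 0) by exact: measurable_cst.
have Cs T k := Ck_piece s T k.
have C00 (T : 'I_N) k : Ck k (fun=> 0 : R) by exact: Ck_cst.
have e0 (T : 'I_N) : (fun=> 0 : R) = (fun=> 0) %[ae mu2 in triangle (tri T)] by apply: aeW.
have <- := weak_div_iff mu' m0 Cs C00 us e0.
have <- := weak_div_iff m0 mu' C00 Cs e0 us.
have X g : weak_dx Omega u g <-> weak_div Omega (fun x => (u x, 0)) g.
  split=> H phi tphi; rewrite (H phi tphi); congr (- _); apply: eq_Rintegral => x _ /=;
  by rewrite mul0r addr0.
have Y g : weak_dy Omega u g <-> weak_div Omega (fun x => (0, u x)) g.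
  split=> H phi tphi; rewrite (H phi tphi); congr (- _); apply: eq_Rintegral => x _ /=;
  by rewrite mul0r add0r.
by split=> -[[g g2 /X wg] [h h2 /Y wh]]; split; [exists g|exists h|exists g|exists h].
Qed.

Lemma spline_class_S0 d :
  spline_class Omega tri (V0 d tri E) = fun_class Omega (S0 Omega d.+1 tri).
Proof.
apply/seteqP; split=> u [mu'].
  move=> [s /V0_iff ec us]; split => //.
  have cs T := @continuous_piece d.+1 s T.
  exists (paste_Omega tri (piece tri s)).
    split; first exact: (paste_Omega_continuous hO htri).
    move=> T; exists (piece tri s T); first exact: Pd_piece.
    by move=> x [Tx Ox]; exact: (paste_OmegaE hO htri cs).
  have A : \forall x \ae mu2, forall T, triangle (tri T) x -> u x = piece tri s T x.
    by apply: filter_forall => T; exact: us.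
  apply: (aeS _ A) => x ux Ox; have [T Tx] := Omega_covered htri Ox.
  by rewrite (ux T Tx) (paste_OmegaE hO htri cs ec Ox Tx).
move=> [w [_ wT] uw]; split => //.
have /choice[p pE] : forall T, exists p, Pd d.+1 p /\
    forall x, (triangle (tri T) `&` Omega) x -> w x = p x.
  by move=> T; have [p ? ?] := wT T; exists p.
have [s sE] := spline_of_Pd (fun T => (pE T).1).
exists s.
  apply/V0_iff => T T' k l TT' st t t01 a b; rewrite !sE.
  have ox := oedge_line k (D0 T) t01.
  have Ox := edge_in_Omega htri TT' st ox.
  have Tx := oedge_triangle (D0 T) ox.
  have T'x := oedge_triangle (D0 T') (share_oedge (D0 T) (D0 T') st ox).
  by rewrite -(pE T).2 // (pE T').2.
(* [w] is a polynomial only on the part of the triangle inside [Omega]; the rest is a null set. *)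
move=> T; apply: (negligibleS _ (negligibleU uw (tri_outside_negligible htri T))).
move=> x /= /not_implyP[Tx nu]; have [Ox|nOx] := pselect (Omega x); last by right.
by left => h; apply: nu; rewrite (h Ox) sE; exact: (pE T).2.
Qed.

Lemma spline_class_H1 d :
  spline_class Omega tri (V0 d tri E) = H1 Omega `&` piecewise_P d.+1 tri.
Proof.
apply/seteqP; split=> u.
  move=> [mu' [s s0 us]]; split; last exact: piecewise_P_of_spline us.
  have [h1 h2] := (weak_gradient_iff mu' us).2 s0.
  by split=> //; exact: L2_spline us.
move=> [[uL2 h1 h2] /spline_of_piecewise_P[s us]].
have mu' := L2_measurable uL2.
by split=> //; exists s => //; apply/(weak_gradient_iff mu' us).
Qed.

Lemma spline_class_L2 d :
  spline_class Omega tri (V2 R N d) = L2 Omega `&` piecewise_P d.-1 tri.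
Proof.
apply/seteqP; split=> u.
  by move=> [mu' [s _ us]]; split; [exact: L2_spline us|exact: piecewise_P_of_spline us].
move=> [uL2 /spline_of_piecewise_P[s us]]; split; first exact: L2_measurable.
by exists s.
Qed.

Lemma measurable_components (v : plane R -> plane R) :
  @measurable_fun _ _ M2 M2 Omega v <->
  @measurable_fun _ _ M2 R Omega (fst \o v) /\ @measurable_fun _ _ M2 R Omega (snd \o v).
Proof.
split=> [mv|[m1 m2]].
  by split; [apply: (measurableT_comp measurable_fst mv)|apply: (measurableT_comp measurable_snd mv)].
have r1 := (measurable_restrictT _ mO).1 m1; have r2 := (measurable_restrictT _ mO).1 m2.
have := measurable_funS measurableT (@subsetT _ Omega) (measurable_fun_pair r1 r2).
apply: eq_measurable_fun => x xO; rewrite !patchE xO /=.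
by case: (v x).
Qed.

Lemma spline2_ae d (s : Sm1 R N d * Sm1 R N d) (v : plane R -> plane R) T :
  v = (fun x => (piece tri s.1 T x, piece tri s.2 T x)) %[ae mu2 in triangle (tri T)] <->
  fst \o v = piece tri s.1 T %[ae mu2 in triangle (tri T)] /\
  snd \o v = piece tri s.2 T %[ae mu2 in triangle (tri T)].
Proof.
split=> [H|[H1 H2]].
  by split; apply: (aeS _ H) => x vx Tx /=; rewrite vx.
apply: (aeS _ (aeI H1 H2)) => x [h1 h2] Tx.
by rewrite -h1 // -h2 //=; case: (v x).
Qed.

(** Measurability, square integrability and the passage to B-coefficients are common to both vector
    spaces. What is left for each of them is to match its weak derivative with its jump
    condition. *)
Lemma spline2_class_eq d (H : set (plane R -> plane R)) (K : set (Sm1 R N d * Sm1 R N d)) :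
  H `<=` L2vec Omega ->
  (forall v s, L2vec Omega v ->
    (forall T, v = (fun x => (piece tri s.1 T x, piece tri s.2 T x)) %[ae mu2 in triangle (tri T)]) ->
    H v <-> K s) ->
  spline2_class Omega tri K = H `&` piecewise_P2 d tri.
Proof.
move=> HL2 HK; apply/seteqP; split=> v.
  move=> [mv [s Ks vs]].
  have [m1 m2] := (measurable_components v).1 mv.
  have vs1 T := ((spline2_ae s v T).1 (vs T)).1; have vs2 T := ((spline2_ae s v T).1 (vs T)).2.
  have vL2 : L2vec Omega v by split; [exact: L2_spline vs1|exact: L2_spline vs2].
  split; first exact/(HK v s).
  by split; [exact: piecewise_P_of_spline vs1|exact: piecewise_P_of_spline vs2].
move=> [Hv [/spline_of_piecewise_P[s1 vs1] /spline_of_piecewise_P[s2 vs2]]].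
have [l1 l2] := HL2 _ Hv.
have vs T : v = (fun x => (piece tri (s1, s2).1 T x, piece tri (s1, s2).2 T x))
    %[ae mu2 in triangle (tri T)] by apply/spline2_ae; split; [exact: vs1|exact: vs2].
split; first by apply/measurable_components; split; exact: L2_measurable.
by exists (s1, s2) => //; apply/(HK v (s1, s2)).
Qed.

Lemma spline2_class_Hdiv d :
  spline2_class Omega tri (V1div d tri E) = Hdiv Omega `&` piecewise_P2 d tri.
Proof.
apply: spline2_class_eq => [v []//|v s vL2 vs].
have [l1 l2] := vL2; rewrite [X in _ <-> X]V1div_iff.
rewrite -(weak_div_iff (L2_measurable l1) (L2_measurable l2) (Ck_piece s.1) (Ck_piece s.2)
  (fun T => ((spline2_ae s v T).1 (vs T)).1) (fun T => ((spline2_ae s v T).1 (vs T)).2)).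
by split=> [[_]|].
Qed.

Lemma spline2_class_Hcurl d :
  spline2_class Omega tri (V1curl d tri E) = Hcurl Omega `&` piecewise_P2 d tri.
Proof.
apply: spline2_class_eq => [v []//|v s vL2 vs].
have [l1 l2] := vL2; rewrite [X in _ <-> X]V1curl_iff.
have m1 : @measurable_fun _ _ M2 R Omega (fun x => - (v x).1).
  exact: (measurableT_comp _ (L2_measurable l1)).
have CN T k : Ck k (fun x => - piece tri s.1 T x).
  by under eq_fun do rewrite -mulN1r; apply: CkM; [exact: Ck_cst|exact: Ck_piece].
have e1 T : (fun x => - (v x).1) = (fun x => - piece tri s.1 T x) %[ae mu2 in triangle (tri T)].
  by apply: (aeS _ (vs T)) => x vx Tx; rewrite vx.
rewrite -(weak_div_iff (L2_measurable l2) m1 (Ck_piece s.2) CN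
  (fun T => ((spline2_ae s v T).1 (vs T)).2) e1).
have X g : weak_curl Omega v g <-> weak_div Omega (fun x => ((v x).2, - (v x).1)) g.
  split=> H phi tphi; rewrite (H phi tphi); congr (- _); apply: eq_Rintegral => x _ /=;
  by rewrite mulNr.
by split=> [[_ [g g2 /X wg]]|[g g2 /X wg]]; [exists g|split=> //; exists g].
Qed.

End spline_spaces.

Theorem theorem3p1 (R : realType) (Omega : set (plane R)) (N M : nat)
    (tri : 'I_N -> 'I_3 -> plane R) (E : 'I_M -> edge R N) (d : nat)
    (hOmega : domain Omega) (htri : triangulation Omega tri)
    (hE : interior_edges tri E) (hd : (1 <= d)%N) :
  [/\ spline_class Omega tri (V0 d tri E) = fun_class Omega (S0 Omega d.+1 tri),
      spline_class Omega tri (V0 d tri E) = H1 Omega `&` piecewise_P d.+1 tri,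
      spline2_class Omega tri (V1curl d tri E)
        = Hcurl Omega `&` piecewise_P2 d tri,
      spline2_class Omega tri (V1div d tri E)
        = Hdiv Omega `&` piecewise_P2 d tri
    & spline_class Omega tri (V2 R N d) = L2 Omega `&` piecewise_P d.-1 tri].
Proof.
split.
- exact: spline_class_S0.
- exact: spline_class_H1.
- exact: spline2_class_Hcurl.
- exact: spline2_class_Hdiv.
- exact: spline_class_L2.
Qed.
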